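(* For every integer $K\ge2$ there is a constant $c(K)\ge1$ such that the following holds for all integers $1\le d\le n$, every normalized unitary local basis $\mathcal U$ of $M_K(\mathbb C)$, every nonzero Hermitian $H\in\mathcal H_{\le d,K}(n)$, every $t\ge0$ and every $0<\varepsilon<1$: given unit-cost query access to the PREPARE and SELECT operators associated with the expansion of $H$ in $\mathcal U^{\otimes n}$, the time evolution $e^{-itH}$ can be simulated to spectral-norm error $\varepsilon$ using $$O\!\left(c(K)^d\left(\frac nd\right)^{(d-1)/2}\|H\|_{\mathrm{op}}\,t+\log\frac1\varepsilon\right)$$ queries to these oracles, with a universal implied constant. In particular this applies when $\mathcal U$ is the Heisenberg--Weyl basis, in which case the encoding is the canonical generalized-Pauli PREPARE--SELECT encoding.
   Context: $M_K(\mathbb C)$ is the algebra of complex $K\times K$ matrices and $M_K^0=\{A\in M_K(\mathbb C):\operatorname{tr}A=0\}$. A normalized unitary local basis is a family $\mathcal U=\{U_0=I,U_1,\ldots,U_{K^2-1}\}$ of unitary matrices that is an orthonormal basis of $M_K(\mathbb C)$ for $\langle A,B\rangle=\frac1K\operatorname{tr}(AB^* )$. The Heisenberg--Weyl basis is $\{X^aZ^b:a,b\in\mathbb Z_K\}$, where $X|r\rangle=|r+1\rangle$ (indices mod $K$) and $Z|r\rangle=e^{2\pi ir/K}|r\rangle$. For $\beta\in\{0,\ldots,K^2-1\}^n$ put $U_\beta=U_{\beta_1}\otimes\cdots\otimes U_{\beta_n}$. For $S\subset[n]$ let $\mathcal H_S=(\bigotimes_{j\in S}M_K^0)\otimes(\bigotimes_{j\notin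 S}\mathbb CI)$ and $\mathcal H_{\le d,K}(n)=\bigoplus_{|S|\le d}\mathcal H_S\subset M_K(\mathbb C)^{\otimes n}$. $\|\cdot\|_{\mathrm{op}}$ is the operator (spectral) norm. Oracles. Write $H=\sum_\beta h_\beta U_\beta$ with $h_\beta=K^{-n}\operatorname{tr}(HU_\beta^* )$, $\Gamma=\{\beta:h_\beta\ne0\}$, $V_\beta=\frac{h_\beta}{|h_\beta|}U_\beta$ and $\lambda=\sum_{\beta\in\Gamma}|h_\beta|$, so $H=\sum_{\beta\in\Gamma}|h_\beta|V_\beta$. Let $\mathcal H=(\mathbb C^K)^{\otimes n}$ be the system space, $(e_\beta)_{\beta\in\Gamma}$ the canonical basis of the index register $\ell_2(\Gamma)$ and $e_0\in\ell_2(\Gamma)$ a fixed unit vector. PREPARE is a unitary $P$ on $\ell_2(\Gamma)$ with $Pe_0=\sum_{\beta\in\Gamma}\sqrt{|h_\beta|/\lambda}\,e_\beta$; SELECT is the unitary $S=\sum_{\beta\in\Gamma}|e_\beta\rangle\langle e_\beta|\otimes V_\beta$ on $\ell_2(\Gamma)\otimes\mathcal H$. Query model (the standard one for linear combinations of unitaries/qubitization). A circuit acts on the system, the index register and finitely many further ancilla qubits; it is a product of queries, i.e. uses of $P$, $S$, their inverses, or controlled versions of these (each at unit cost), and of cost-free unitaries acting only on the index register and ancillas (these may depend on $t,\varepsilon,\lambda$ and $e_0$). It simulates $e^{-itH}$ to spectral-norm error $\varepsilon$ if, with the index register and ancillas initialized in and projected onto a fixed state, the resulting operator on the system space is within $\varepsilon$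 of $e^{-itH}$ in operator norm. *)

(* Defs.v *)
From HB Require Import structures.
From mathcomp Require Import all_boot all_order all_algebra.
From mathcomp Require Import complex mxtens.
From mathcomp Require Import all_classical all_reals all_analysis.

Set Implicit Arguments.
Unset Strict Implicit.
Unset Printing Implicit Defensive.

Import Order.TTheory GRing.Theory Num.Theory numFieldNormedType.Exports.

Local Open Scope classical_set_scope.
Local Open Scope ring_scope.
Local Open Scope complex_scope.
Local Open Scope sesquilinear_scope.

Section Matrices.
Context {R : realType}.
Local Notation C := R[i].

Definition l2norm {m} (v : 'cV[C]_m) : R :=
  Num.sqrt (\sum_i Normc.normc (v i 0) ^+ 2).

Definition opnorm {m} (A : 'M[C]_m) : R :=
  sup [set l2norm (A *m v) | v in [set v : 'cV[C]_m | l2norm v <= 1]].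

(* R[i] carries no topology in the library: the exponential series is summed
   entrywise, through real and imaginary parts. *)
Definition expmx {m} (A : 'M[C]_m) : 'M[C]_m :=
  let s N := \sum_(k < N) (k`!%:R)^-1 *: A ^+ k in
  \matrix_(i, j) (limn (fun N => complex.Re (s N i j))
                  +i* limn (fun N => complex.Im (s N i j))).

Definition evolution {m} (H : 'M[C]_m) (t : R) : 'M[C]_m :=
  expmx ((0 -i* t) *: H).

End Matrices.

(* The computational basis of (C^K)^{(x) n} is {ffun 'I_n -> 'I_K}, ranked by
   enum_val. *)
Definition sysdim (K n : nat) : nat := #|{ffun 'I_n -> 'I_K}|.

Section LocalBases.
Context {R : realType}.
Local Notation C := R[i].

Definition tensor {K n} (A : 'I_n -> 'M[C]_K) : 'M[C]_(sysdim K n) :=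
  \matrix_(x, y)
    \prod_(j < n) A j ((enum_val x : {ffun 'I_n -> 'I_K}) j)
                      ((enum_val y : {ffun 'I_n -> 'I_K}) j).

Definition normalized_unitary_local_basis {K}
    (U : 'I_(K ^ 2) -> 'M[C]_K) : Prop :=
  [/\ forall i : 'I_(K ^ 2), i = 0%N :> nat -> U i = 1%:M,
      forall i : 'I_(K ^ 2), U i \is unitarymx,
      forall i j : 'I_(K ^ 2), K%:R^-1 * \tr (U i *m (U j)^t*) = (i == j)%:R
    & basis_of fullv [seq U i | i : 'I_(K ^ 2)]].

Definition shift_mx (K : nat) : 'M[C]_K :=
  \matrix_(r, s) (r == s.+1 %% K :> nat)%N%:R.

Definition clock_mx (K : nat) : 'M[C]_K :=
  diag_mx (\row_(r < K) (cos (2 * pi * r%:R / K%:R)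
                         +i* sin (2 * pi * r%:R / K%:R))).

(* The pair (a, b) in Z_K x Z_K is encoded as the index a * K + b. *)
Definition heisenberg_weyl (K : nat) (i : 'I_(K ^ 2)) : 'M[C]_K :=
  shift_mx K ^+ (i %/ K)%N *m clock_mx K ^+ (i %% K)%N.

Definition in_HS {K n} (S : {set 'I_n}) (H : 'M[C]_(sysdim K n)) : Prop :=
  exists (m : nat) (A : 'I_m -> 'I_n -> 'M[C]_K),
    (forall k j, if j \in S then \tr (A k j) = 0 else is_scalar_mx (A k j)) /\
    H = \sum_(k < m) tensor (A k).

Definition in_Hle {K n} (d : nat) (H : 'M[C]_(sysdim K n)) : Prop :=
  exists F : {set 'I_n} -> 'M[C]_(sysdim K n),
    (forall S, in_HS S (F S)) /\ H = \sum_(S : {set 'I_n} | (#|S| <= d)%N) F S.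

End LocalBases.

Section Oracles.
Context {R : realType} {K n : nat}.
Local Notation C := R[i].
Variables (U : 'I_(K ^ 2) -> 'M[C]_K) (H : 'M[C]_(sysdim K n)).

Definition basis_tensor (b : {ffun 'I_n -> 'I_(K ^ 2)}) : 'M[C]_(sysdim K n) :=
  tensor (fun j => U (b j)).

Definition coef (b : {ffun 'I_n -> 'I_(K ^ 2)}) : C :=
  (K ^ n)%:R^-1 * \tr (H *m (basis_tensor b)^t*).

Definition supp : {set {ffun 'I_n -> 'I_(K ^ 2)}} := [set b | coef b != 0].

Definition lambda : R := \sum_(b in supp) Normc.normc (coef b).

Definition phased (b : {ffun 'I_n -> 'I_(K ^ 2)}) : 'M[C]_(sysdim K n) :=
  (coef b / `|coef b|) *: basis_tensor b.

(* The canonical basis vector of l2(supp) labelled by b is the coordinate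
   k : 'I_#|supp| with enum_val k = b. *)
Definition is_prepare (e0 : 'cV[C]_#|supp|) (P : 'M[C]_#|supp|) : Prop :=
  P \is unitarymx /\
  P *m e0 = \col_k (Num.sqrt (Normc.normc (coef (enum_val k)) / lambda))%:C.

Definition select : 'M[C]_(#|supp| * sysdim K n) :=
  \sum_(k < #|supp|) (delta_mx k k *t phased (enum_val k)).

End Oracles.

Variant oracle := Prepare | Select.

(* g is the dimension of the index register and m the number of ancilla
   qubits; the cost-free unitaries act on (C^2)^{(x) m} (x) C^g. *)
Variant gate (R : realType) (g m : nat) :=
| Free of 'M[R[i]]_(2 ^ m * g)
| Query (o : oracle) (inverse : bool) (control : option 'I_m).

Record circuit (R : realType) (g : nat) := Circuit {
  ancillas : nat;
  fixed_state : 'cV[R[i]]_(2 ^ ancillas * g);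
  gates : seq (gate R g ancillas) }.

(* The cost-free parts of a circuit (its length, its free unitaries, the number
   of ancillas, the fixed state) may depend only on the dimension g of the index
   register, on the reference vector e0 and on lambda, t and eps. *)
Definition protocol (R : realType) : Type :=
  forall (g : nat) (e0 : 'cV[R[i]]_g) (lam t eps : R), circuit R g.

Section Circuits.
Context {R : realType} {g : nat}.
Local Notation C := R[i].

Definition is_query {m} (x : gate R g m) : bool :=
  if x is Query _ _ _ then true else false.

Definition queries (c : circuit R g) : nat := count is_query (gates c).

Definition well_formed (c : circuit R g) : Prop :=
  l2norm (fixed_state c) = 1 /\
  forall i V, onth (gates c) i = Some (Free V) -> V \is unitarymx.

(* Projection onto the state |1> of the q-th qubit. *)
Definition qubit_proj {m} (q : 'I_m) : 'M[C]_(2 ^ m) :=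
  diag_mx (\row_k (odd (k %/ 2 ^ q)%N)%:R).

Context {N : nat} (P : 'M[C]_g) (S : 'M[C]_(g * N)).

Definition oracle_mx (o : oracle) : 'M[C]_(g * N) :=
  match o with Prepare => P *t 1%:M | Select => S end.

Definition query_mx {m} (o : oracle) (inverse : bool) (control : option 'I_m) :
    'M[C]_(2 ^ m * (g * N)) :=
  let Q := if inverse then invmx (oracle_mx o) else oracle_mx o in
  if control is Some q then
    qubit_proj q *t Q + (1%:M - qubit_proj q) *t 1%:M
  else 1%:M *t Q.

Definition gate_mx {m} (x : gate R g m) : 'M[C]_(2 ^ m * g * N) :=
  match x with
  | Free V => V *t 1%:M
  | Query o inverse control =>
      castmx (mulnA _ _ _, mulnA _ _ _) (query_mx o inverse control)
  end.

Definition circuit_mx (c : circuit R g) : 'M[C]_(2 ^ ancillas c * g * N) :=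
  foldr (fun x W => gate_mx x *m W) 1%:M (gates c).

(* The operator (<phi| (x) 1) W (|phi> (x) 1) on the system, for phi the fixed
   state. *)
Definition implemented (c : circuit R g) : 'M[C]_N :=
  castmx (mul1n _, mul1n _)
    (((fixed_state c)^t* *t 1%:M) *m circuit_mx c *m (fixed_state c *t 1%:M)).

End Circuits.

Definition simulates_within {R : realType} (Cu c : R) (pr : protocol R)
    {K : nat} (U : 'I_(K ^ 2) -> 'M[R[i]]_K) : Prop :=
  forall d n : nat, (1 <= d)%N -> (d <= n)%N ->
  forall H : 'M[R[i]]_(sysdim K n),
    H \is hermsymmx -> H != 0 -> in_Hle d H ->
  forall t eps : R, 0 <= t -> 0 < eps -> eps < 1 ->
  forall (e0 : 'cV[R[i]]_#|supp U H|) (P : 'M[R[i]]_#|supp U H|),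
    l2norm e0 = 1 -> is_prepare e0 P ->
  let circ := pr #|supp U H| e0 (lambda U H) t eps in
  [/\ well_formed circ,
      (queries circ)%:R <=
        Cu * (c ^+ d * (n%:R / d%:R) `^ ((d%:R - 1) / 2) * opnorm H * t
              + ln (1 / eps))
    & opnorm (implemented P (select U H) circ - evolution H t) <= eps].

(* Main.v *)
(* The number of queries of qubitization is governed by lambda, the l1 norm of
   the coefficients of H. To bound it, replace the U_b by their Hermitian and
   anti-Hermitian parts G_p. Product states whose factors are averages over p of
   1 + x_p G_p, with |x_p| <= 1, are positive. Pairing H with them shows that a
   real multilinear polynomial of degree d in the x_p, whose coefficients are
   those of H up to a factor c(K)^d, is bounded by ||H||. Hypercontractivity (the
   l2 norm of the coefficients is at most 3^d times the L1 norm) applied to its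
   first derivatives, together with a Markov-type estimate summing these
   derivatives over all variables, bounds the l1 norm of the coefficients of such
   a polynomial by C^d (n/d)^((d-1)/2) ||H||.

   For the simulation, PREPARE and SELECT yield a walk W and an isometry G with
   (H / lambda) G^* W^k = (G^* W^(k+1) + G^* W^(k-1)) / 2. A clock register of
   length L = O(lambda t + log (1/eps)), holding k, therefore lets the free
   unitary exp(-i lambda t A), with A half the adjacency matrix of a path of
   length L, act as exp(-itH), as long as the clock stays away from the ends of
   the path; the exponential series truncated at order M <= L/4 moves it by less
   than M. Starting uniformly on the second quarter of the clock and projecting
   on the uniform clock state costs an amplitude 1/2, which one round of
   amplitude amplification, B |-> 3 B - 4 B B^* B, turns into 1. *)

Require Import Defs.
From HB Require Import structures.
From mathcomp Require Import all_boot all_order all_algebra.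
From mathcomp Require Import complex mxtens.
From mathcomp Require Import all_classical all_reals all_analysis.
From mathcomp Require Import ring lra zify.

Set Implicit Arguments.
Unset Strict Implicit.
Unset Printing Implicit Defensive.

Import Order.TTheory GRing.Theory Num.Theory numFieldNormedType.Exports.

Local Open Scope ring_scope.
Local Open Scope complex_scope.
Local Open Scope sesquilinear_scope.

(** * Walsh polynomials of low degree *)

(** Cauchy-Schwarz over all monomials of degree d would give the exponent d/2. First derivatives
    have degree d - 1, which gives (d-1)/2, provided that summing over all variables costs no power
    of n; this is the role of the Markov-type estimate. The polynomial has one variable per site and
    label, all of them free in [-1, 1]. A sum 1 + sum_p x_p G_p need not be positive, whereas the
    average of the 1 + x_p G_p is; averaging costs a factor 2 K^2 per degree, one of the two sources
    of the dependence of c(K) on K (the other is the number of variables per site).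

    On the quantum side the count has to be additive in log (1/eps). Since unitaries on ancillas are
    free, no polynomial approximation has to be compiled into phase angles: the exponential of an
    explicit path matrix does the same work. Two obstacles shape the circuit. SELECT need not be an
    involution, which costs one more qubit next to the index register. And for lambda t + log
    (1/eps) close to 0 the bound does not allow a single query. *)

Section LinearCoefficient.
Variable R : realType.

(* Comparing p(s) with p(s/rho), rho = 1 + 1/d, removes the leading coefficient
   of p at a bounded cost; repeating this down to degree 1 isolates p`_1. *)
Lemma coef1_bound_step (d : nat) : (0 < d)%N -> forall (m : nat) (p : {poly R}) (M : R),
  (m < d)%N -> (size p <= m.+2)%N ->
  (forall s, 0 <= s -> s <= 1 -> `|p.[s]| <= M) ->
  `|p`_1| * (m`!%:R / d%:R ^+ m) <= 2 * M * (1 + expR 1) ^+ m.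
Proof.
move=> d_gt0; have dR : (0 : R) < d%:R by rewrite ltr0n.
elim=> [|m IHm] p M m_lt sp pM.
  rewrite fact0 !expr0 divr1 !mulr1.
  have -> : p`_1 = p.[1] - p.[0].
    rewrite !(horner_coef_wide _ sp) !big_ord_recl !big_ord0 /= !expr0 !expr1.
    by rewrite ?expr0n /=; ring.
  rewrite (le_trans (ler_normB _ _))// mulr2n mulrDl mul1r.
  by rewrite lerD ?pM.
pose rho : R := 1 + d%:R^-1.
have rho_ge1 : 1 <= rho by rewrite lerDl invr_ge0 ler0n.
have rho_gt0 : 0 < rho by apply: lt_le_trans rho_ge1.
have rho_pow k : (k <= d)%N -> rho ^+ k <= expR 1.
  move=> kd; apply: (@le_trans _ _ (rho ^+ d)); first exact: ler_weXn2l.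
  apply: (@le_trans _ _ (expR d%:R^-1 ^+ d)).
    by rewrite lerXn2r ?nnegrE ?expR_ge0 ?(ltW rho_gt0)// expR_ge1Dx.
  by rewrite -expRM_natl mulfV ?gt_eqF.
pose q := \poly_(k < m.+2) ((rho ^+ (m.+2 - k) - 1) * p`_k).
have qE s : q.[s] = rho ^+ m.+2 * p.[s / rho] - p.[s].
  rewrite horner_poly !(horner_coef_wide _ sp) mulr_sumr -sumrB [RHS]big_ord_recr /=.
  rewrite [X in _ = _ + X](_ : _ = 0) ?addr0; last first.
    rewrite expr_div_n; have : rho ^+ m.+2 != 0 by rewrite expf_neq0 ?gt_eqF.
    by move: (rho ^+ m.+2) => r r0; field.
  apply: eq_bigr => k _; rewrite expr_div_n.
  have kle : (k <= m.+2)%N by rewrite ltnW.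
  rewrite -[X in rho ^+ X * (_ * _)](subnK kle) exprD.
  have : rho ^+ k != 0 by rewrite expf_neq0 ?gt_eqF.
  by move: (rho ^+ k) => r r0; field.
have M_ge0 : 0 <= M by apply: le_trans (pM 0 _ _) => //; rewrite ler01.
have qM s : 0 <= s -> s <= 1 -> `|q.[s]| <= (1 + expR 1) * M.
  move=> s0 s1; rewrite qE (le_trans (ler_normB _ _))//.
  rewrite mulrDl mul1r addrC lerD ?pM//.
  rewrite normrM ger0_norm ?exprn_ge0 ?(ltW rho_gt0)//.
  rewrite ler_pM ?exprn_ge0 ?(ltW rho_gt0)// ?rho_pow// pM ?divr_ge0 ?(ltW rho_gt0)//.
  by rewrite ler_pdivrMr// mul1r (le_trans s1).
have := IHm q _ (ltnW m_lt) (size_poly _ _) qM.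
rewrite coef_poly /= => H.
(* Bernoulli's inequality. The linear coefficient of [q] is [rho ^+ m.+1 - 1] times that of [p], so
   a step loses at most a factor d/(m+1); over all steps this accumulates to d^m / m!. *)
have Hrho : m.+1%:R / d%:R <= rho ^+ m.+1 - 1.
  rewrite lerBrDr; elim: m.+1 => [|k IHk]; first by rewrite mul0r add0r.
  apply: (@le_trans _ _ ((k%:R / d%:R + 1) * rho)); last by rewrite exprSr ler_pM2r.
  rewrite -natr1 mulrDl mul1r /rho mulrDr mulr1 addrAC lerD2l mulrDl mul1r lerDr.
  by rewrite mulr_ge0 ?invr_ge0// divr_ge0.
have -> : 2 * M * (1 + expR 1) ^+ m.+1 = 2 * ((1 + expR 1) * M) * (1 + expR 1) ^+ m.
  by rewrite exprS; ring.
apply: le_trans H.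
rewrite subn1 /= normrM factS natrM exprS.
rewrite [X in X <= _](_ : _ = (m.+1%:R / d%:R) * `|p`_1| * (m`!%:R / d%:R ^+ m)); last first.
  have h : d%:R ^+ m != 0 :> R by rewrite expf_neq0 ?gt_eqF.
  by field; rewrite h gt_eqF.
rewrite ler_wpM2r ?divr_ge0 ?exprn_ge0 ?ler0n//.
by rewrite ler_wpM2r// (le_trans Hrho)// ler_norm.
Qed.

(** Markov's inequality at an end point of [0, 1] would give 2 d^2 M. A bound exponential in [d] is
    good enough, since it is absorbed by c(K)^d. The factor d^m / m! of the induction is at most a
    power of e by the exponential series. *)
Lemma coef1_bound (d : nat) (p : {poly R}) (M : R) : (0 < d)%N ->
  (size p <= d.+1)%N -> (forall s, 0 <= s -> s <= 1 -> `|p.[s]| <= M) ->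
  `|p`_1| <= 2 * ((1 + expR 1) * expR 1) ^+ d * M.
Proof.
case: d => // d _ sp pM.
have M_ge0 : 0 <= M by apply: le_trans (pM 0 _ _) => //; rewrite ler01.
have := coef1_bound_step (ltn0Sn d) (ltnSn d) sp pM.
have fact_gt0R : (0 : R) < d`!%:R by rewrite ltr0n fact_gt0.
rewrite -ler_pdivlMr ?divr_gt0 ?exprn_gt0// => /le_trans; apply.
rewrite invf_div exprMn exprS.
have e1 : 1 <= 1 + expR 1 :> R by rewrite lerDl expR_ge0.
have He : d.+1%:R ^+ d / d`!%:R <= expR 1 ^+ d.+1 :> R.
  rewrite -expRM_natl mulr1; case: (d) => [|k].
    by rewrite fact0 divr1 expr0 -expR0 ler_expR.
  by rewrite (le_trans _ (expR_ge1Dxn k _))// lerDr.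
rewrite [X in _ <= X](_ : _ = 2 * M * (1 + expR 1) ^+ d * ((1 + expR 1) * expR 1 ^+ d.+1)); last by ring.
apply: ler_wpM2l; first by rewrite !mulr_ge0 ?exprn_ge0// (le_trans ler01).
by rewrite (le_trans He)// ler_peMl ?exprn_ge0 ?expR_ge0.
Qed.
End LinearCoefficient.

Lemma cauchy_schwarz_sum (R : realFieldType) (I : finType) (P : pred I) (u v : I -> R) :
  (\sum_(i | P i) u i * v i) ^+ 2 <= (\sum_(i | P i) u i ^+ 2) * (\sum_(i | P i) v i ^+ 2).
Proof.
have : 0 <= \sum_(i | P i) \sum_(j | P j) (u i * v j - u j * v i) ^+ 2.
  by apply: sumr_ge0 => i _; apply: sumr_ge0 => j _; exact: sqr_ge0.
have -> : \sum_(i | P i) \sum_(j | P j) (u i * v j - u j * v i) ^+ 2 =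
  \sum_(i | P i) \sum_(j | P j) (u i ^+ 2 * v j ^+ 2) +
  \sum_(i | P i) \sum_(j | P j) (v i ^+ 2 * u j ^+ 2) -
  2 * \sum_(i | P i) \sum_(j | P j) ((u i * v i) * (u j * v j)).
  rewrite mulr_sumr -big_split -sumrB; apply: eq_bigr => i _.
  rewrite mulr_sumr -big_split -sumrB; apply: eq_bigr => j _ /=; ring.
rewrite -!big_distrlr /=; nra.
Qed.

(** * Multilinear polynomials on the cube and hypercontractivity *)

Section Walsh.
Variables (R : realType) (I : finType).
Implicit Types (a b c : {set I} -> R) (S X A : {set I}) (i : I) (x : I -> R).

Definition walsh a x : R := \sum_S a S * \prod_(i in S) x i.
Definition pm X i : R := (-1) ^+ (i \in X).
(** Coefficients of the partial derivative in the variable [i]; by multilinearity it no longer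
    involves that variable. *)
Definition dcoef i a S : R := if i \in S then 0 else a (i |: S).

Lemma big_setU1_split (V : nmodType) (F : {set I} -> V) i :
  \sum_S F S = \sum_(S : {set I} | i \notin S) (F S + F (i |: S)).
Proof.
rewrite (bigID (fun S : {set I} => i \notin S)) /= big_split; congr (_ + _).
rewrite (reindex_onto (fun S : {set I} => i |: S) (fun S : {set I} => S :\ i)) /=; last first.
  by move=> S; rewrite negbK => iS; rewrite finset.setD1K.
apply: eq_bigl => S; rewrite finset.setU11 /=; apply/eqP/idP => [<-|iS].
  by rewrite !finset.inE eqxx.
by rewrite finset.setU1K.
Qed.

Lemma walsh_split i a x :
  walsh a x = walsh (fun S => if i \in S then 0 else a S) x + x i * walsh (dcoef i a) x.
Proof.
rewrite /walsh !(big_setU1_split _ i) mulr_sumr -big_split; apply: eq_bigr => S iS /=.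
rewrite /dcoef (negbTE iS) finset.setU11 !mul0r !addr0 big_setU1 //=.
by rewrite mulrCA.
Qed.

Lemma walsh_indep i b x y : (forall S, i \in S -> b S = 0) ->
  (forall j, j != i -> x j = y j) -> walsh b x = walsh b y.
Proof.
move=> b0 xy; apply: eq_bigr => S _; case: (boolP (i \in S)) => iS.
  by rewrite b0// !mul0r.
by congr (_ * _); apply: eq_bigr => j jS; apply: xy; apply: contraNneq iS => <-.
Qed.

Lemma walsh_supp0 a x : (forall S, S != finset.set0 -> a S = 0) -> walsh a x = a finset.set0.
Proof.
move=> a0; rewrite /walsh (bigD1 finset.set0)//= big_set0 mulr1 big1 ?addr0//.
by move=> S S0; rewrite a0// mul0r.
Qed.

Lemma card_setI : (\sum_(X : {set I}) 1 : R) = 2 ^+ #|I|.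
Proof. have cardI : #|{: {set I}}| = (2 ^ #|[set: I]|)%N.
  by rewrite -[RHS]card_powerset finset.powersetT -cardsT.
by rewrite sumr_const cardI natrX cardsT. Qed.

(** The two vertices that differ in the coordinate [i] are summed together: [b] and [c] take the
    same values at both, so only the part of [F] even in its second argument survives. *)
Lemma sum_even_part i b c (F E : R -> R -> R) :
  (forall S, i \in S -> b S = 0) -> (forall S, i \in S -> c S = 0) ->
  (forall B C, F B C + F B (- C) = E B C *+ 2) ->
  \sum_X F (walsh b (pm X)) (pm X i * walsh c (pm X)) =
  \sum_X E (walsh b (pm X)) (walsh c (pm X)).
Proof.
move=> b0 c0 FE; rewrite !(big_setU1_split _ i); apply: eq_bigr => X iX.
have pmX j : j != i -> pm (i |: X) j = pm X j by rewrite /pm !finset.inE => /negbTE->.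
rewrite (walsh_indep b0 pmX) (walsh_indep c0 pmX).
by rewrite /pm finset.setU11 (negbTE iX) expr0 expr1 mul1r mulN1r FE mulr2n.
Qed.

(** Induction over the variables that occur, shared by Parseval and Bonami: in a = b + x_i c, the
    polynomial [b] has the same degree bound in fewer variables, and [c] loses both a variable and a
    degree. Constants are the base case for every degree. *)
Lemma coef_induction (P : nat -> ({set I} -> R) -> Prop) :
  (forall d a, (forall S, S != finset.set0 -> a S = 0) -> P d a) ->
  (forall d i a b c, b = (fun S => if i \in S then 0 else a S) -> c = dcoef i a ->
     P d.+1 b -> P d c -> P d.+1 a) ->
  forall d a, (forall S, (d < #|S|)%N -> a S = 0) -> P d a.
Proof.
move=> P0 PS d a ad.
suff : forall m A d a, (#|A| <= m)%N -> (forall S, ~~ (S \subset A) -> a S = 0) ->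
  (forall S, (d < #|S|)%N -> a S = 0) -> P d a.
  by move=> /(_ #|I| finset.setT d a); apply=> //; [exact: max_card | move=> S; rewrite finset.subsetT].
elim=> [|m IHm] A {}d {}a Am aA {}ad.
  apply: P0 => S S0; apply: aA; move: Am; rewrite leqn0 cards_eq0 => /eqP->.
  by rewrite finset.subset0.
have [A0|[i iA]] := finset.set_0Vmem A; last first.
  case: d ad => [|d] ad; first by apply: P0 => S S0; apply: ad; rewrite card_gt0.
  apply: (PS d i a _ _ erefl erefl); apply: (IHm (A :\ i)).
  - by move: Am; rewrite (cardsD1 i) iA.
  - move=> S; case: ifPn => // iS SA; apply: aA; apply: contraNN SA => SA.
    by rewrite finset.subsetD1 SA.
  - by move=> S dS; case: ifP => // _; exact: ad.
  - by move: Am; rewrite (cardsD1 i) iA.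
  - move=> S; rewrite /dcoef; case: ifPn => // iS SA; apply: aA.
    apply: contraNN SA => SA; rewrite finset.subsetD1 iS andbT.
    exact: fintype.subset_trans (finset.subsetUr _ _) SA.
  - by move=> S dS; rewrite /dcoef; case: ifPn => // iS; apply: ad; rewrite cardsU1 iS.
by apply: P0 => S S0; apply: aA; rewrite A0 finset.subset0.
Qed.

Lemma sum_sqr_coef_split i a b c :
  b = (fun S => if i \in S then 0 else a S) -> c = dcoef i a ->
  \sum_S a S ^+ 2 = \sum_S b S ^+ 2 + \sum_S c S ^+ 2.
Proof.
move=> -> ->; rewrite !(big_setU1_split _ i) -big_split; apply: eq_bigr => S iS /=.
by rewrite /dcoef (negbTE iS) finset.setU11 expr0n /= !addr0.
Qed.

Lemma parseval a : \sum_X walsh a (pm X) ^+ 2 = 2 ^+ #|I| * \sum_S a S ^+ 2.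
Proof.
suff : forall d a, (forall S, (d < #|S|)%N -> a S = 0) ->
  \sum_X walsh a (pm X) ^+ 2 = 2 ^+ #|I| * \sum_S a S ^+ 2.
  by move=> /(_ #|I| a); apply=> S; rewrite ltnNge max_card.
apply: coef_induction => [_ {}a a0|_ i {}a b c bE cE IHb IHc].
  under eq_bigr do rewrite walsh_supp0//.
  rewrite [X in _ = _ * X](bigD1 finset.set0)//= [X in _ + X]big1 ?addr0.
    by rewrite -card_setI mulr_suml; apply: eq_bigr => ? _; rewrite mul1r.
  by move=> S S0; rewrite a0// expr0n.
rewrite (sum_sqr_coef_split bE cE) mulrDr -IHb -IHc -big_split /=.
under eq_bigr do rewrite (walsh_split i) -bE -cE.
apply: (sum_even_part (F := fun B C => (B + C) ^+ 2)
                      (E := fun B C => B ^+ 2 + C ^+ 2)) => [S|S|B C].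
- by rewrite bE => ->.
- by rewrite cE /dcoef => ->.
- by ring.
Qed.

(** The average of (b + x_i c)^4 over the sign x_i is b^4 + 6 b^2 c^2 + c^4. Cauchy-Schwarz and the
    two induction hypotheses bound the middle term with the constant 6 . 3 . 9^d = 2 . 9^(d+1),
    which is exactly that of the cross term of 9^(d+1) (s + t)^2. *)
Lemma bonami d a : (forall S, (d < #|S|)%N -> a S = 0) ->
  \sum_X walsh a (pm X) ^+ 4 <= 2 ^+ #|I| * 9 ^+ d * (\sum_S a S ^+ 2) ^+ 2.
Proof.
move: d a; apply: coef_induction => [d a a0|d i a b c bE cE IHb IHc].
  under eq_bigr do rewrite walsh_supp0//.
  rewrite [X in _ <= _ * X ^+ 2](bigD1 finset.set0)//= [X in _ + X]big1 ?addr0; last first.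
    by move=> S S0; rewrite a0// expr0n.
  under eq_bigr do rewrite -[_ ^+ 4]mul1r.
  rewrite -mulr_suml card_setI -exprM -mulrA ler_wpM2l ?exprn_ge0//.
  by rewrite ler_peMl ?exprn_ege1 ?exprn_even_ge0// ler1n.
rewrite (sum_sqr_coef_split bE cE).
under eq_bigr do rewrite (walsh_split i) -bE -cE.
rewrite (sum_even_part (F := fun B C => (B + C) ^+ 4)
   (E := fun B C => B ^+ 4 + 6 * (B ^+ 2 * C ^+ 2) + C ^+ 4)); first last.
- by move=> B C; ring.
- by move=> S; rewrite cE /dcoef => ->.
- by move=> S; rewrite bE => ->.
rewrite !big_split /= -mulr_sumr.
have CS := cauchy_schwarz_sum xpredT (fun X => walsh b (pm X) ^+ 2) (fun X => walsh c (pm X) ^+ 2).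
move: CS IHb IHc; under [X in _ <= X * _]eq_bigr do rewrite -exprM.
under [X in _ <= _ * X]eq_bigr do rewrite -exprM.
set X := \sum_X _ ^+ 2 * _; set B4 := \sum_X walsh b _ ^+ 4; set C4 := \sum_X walsh c _ ^+ 4.
set s := \sum_S b S ^+ 2; set t := \sum_S c S ^+ 2.
have s0 : 0 <= s by apply: sumr_ge0 => ? _; exact: sqr_ge0.
have t0 : 0 <= t by apply: sumr_ge0 => ? _; exact: sqr_ge0.
have C40 : 0 <= C4 by apply: sumr_ge0 => ? _; exact: exprn_even_ge0.
rewrite [9 ^+ d.+1]exprS.
have : 0 < 9 ^+ d :> R by rewrite exprn_gt0.
have : 0 < 2 ^+ #|I| :> R by rewrite exprn_gt0.
move: (2 ^+ #|I|) (9 ^+ d) => T N T0 N0 CS HB HC.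
have XN : X <= 3 * T * N * s * t.
  rewrite -(@ler_sqr _ X) ?nnegrE; first last.
  - by rewrite !mulr_ge0// ltW.
  - by apply: sumr_ge0 => ? _; rewrite mulr_ge0// sqr_ge0.
  apply: (le_trans CS); apply: (le_trans (ler_wpM2r C40 HB)).
  apply: (@le_trans _ _ (T * (9 * N) * s ^+ 2 * (T * N * t ^+ 2))); last by nra.
  by rewrite ler_wpM2l// !mulr_ge0 ?sqr_ge0// ltW.
nra.
Qed.

(** Instead of Hölder's inequality between L1, L2 and L4, the pointwise inequality u (u - Ns)^2 (u +
    2Ns) >= 0 with N = 3^d is summed over the cube: it bounds 3 (Ns)^2 u^2 - u^4 by 2 (Ns)^3 u, and
    Parseval and Bonami evaluate the left-hand side. *)
Lemma l2_le_l1 d a : (forall S, (d < #|S|)%N -> a S = 0) ->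
  2 ^+ #|I| * Num.sqrt (\sum_S a S ^+ 2) <= 3 ^+ d * \sum_X `|walsh a (pm X)|.
Proof.
move=> ad; set s := Num.sqrt _.
have s2 : \sum_S a S ^+ 2 = s ^+ 2 by rewrite sqr_sqrtr// sumr_ge0// => ? _; exact: sqr_ge0.
have s0 : 0 <= s by exact: sqrtr_ge0.
have L0 : 0 <= \sum_X `|walsh a (pm X)| by exact: sumr_ge0.
have [->|sn0] := eqVneq s 0; first by rewrite mulr0 mulr_ge0 ?exprn_ge0.
have sp : 0 < s by rewrite lt_def sn0.
have N0 : 0 < 3 ^+ d :> R by rewrite exprn_gt0.
have T0 : 0 < 2 ^+ #|I| :> R by rewrite exprn_gt0.
have := bonami ad; have := parseval a; rewrite s2.
rewrite [9 ^+ d](_ : _ = (3 ^+ d) ^+ 2); last by rewrite -exprM mulnC exprM; congr (_ ^+ d); ring.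
move: {ad} (3 ^+ d) N0 (2 ^+ _) T0 => N N0 T T0 P B.
have : 3 * (N * s) ^+ 2 * (\sum_X walsh a (pm X) ^+ 2) - \sum_X walsh a (pm X) ^+ 4
   <= 2 * (N * s) ^+ 3 * \sum_X `|walsh a (pm X)|.
  rewrite !mulr_sumr -sumrB; apply: ler_sum => X _.
  rewrite [_ ^+ 4](_ : _ = `|walsh a (pm X)| ^+ 4); last by rewrite -normrX ger0_norm ?exprn_even_ge0.
  rewrite -(real_normK (num_real (walsh a (pm X)))).
  move: `|_| (normr_ge0 (walsh a (pm X))) => u u0.
  have : 0 <= u * (u - N * s) ^+ 2 * (u + 2 * (N * s)).
    have Ns0 : 0 <= N * s by rewrite mulr_ge0// ltW.
    apply: mulr_ge0; first by apply: mulr_ge0 => //; exact: sqr_ge0.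
    by apply: addr_ge0 => //; apply: mulr_ge0.
  by move=> ?; nra.
rewrite P => H; have {H} := le_trans (lerB (lexx _) B) H.
move: L0; set L := \sum_X _ => L0 H.
have k0 : 0 < 2 * N ^+ 2 * s ^+ 3 by rewrite !mulr_gt0 ?exprn_gt0.
rewrite -(ler_pM2l k0); nra.
Qed.
End Walsh.

(** * The l1 norm of the coefficients of a bounded polynomial *)

Section Sidon.
Variables (R : realType) (I : finType).
Implicit Types (a : {set I} -> R) (S T X : {set I}) (i : I) (x : I -> R).

Lemma mul_walsh_dcoef i a x :
  x i * walsh (dcoef i a) x = \sum_(S : {set I} | i \in S) a S * \prod_(j in S) x j.
Proof.
apply: (@addrI _ (walsh (fun S => if i \in S then 0 else a S) x)).
rewrite -walsh_split /walsh [LHS](bigID (fun S : {set I} => i \in S)) /= addrC; congr (_ + _).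
rewrite [RHS](bigID (fun S : {set I} => i \in S)) /= [X in _ = X + _]big1 ?add0r.
  by apply: eq_bigr => S /negbTE->.
by move=> S ->; rewrite mul0r.
Qed.

Lemma sum_le_double_partial (F : I -> R) (D : R) :
  (forall T, `|\sum_(i in T) F i| <= D) -> \sum_i `|F i| <= 2 * D.
Proof.
move=> FD; rewrite (bigID (fun i => i \in [set i | 0 <= F i]%SET)) /= mulr2n mulrDl mul1r.
apply: lerD.
  apply: le_trans (FD [set i | 0 <= F i]%SET); apply: le_trans (ler_norm _).
  by apply: ler_sum => i; rewrite finset.inE => /ger0_norm->.
apply: le_trans (FD [set i | ~~ (0 <= F i)]%SET); rewrite -normrN; apply: le_trans (ler_norm _).
rewrite -sumrN; under [leRHS]eq_bigl do rewrite finset.inE.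
under [leLHS]eq_bigl do rewrite finset.inE.
by apply: ler_sum => i; rewrite -ltNge => /ltr0_norm->.
Qed.

(** Multiplying the variables of [T] by 1 - s, for s in [0, 1], stays inside the cube and gives a
    polynomial in s of degree at most [d], bounded by [M]; its linear coefficient is minus the sum
    in question. *)
Lemma sum_dcoef_partial_bound (d : nat) a (M : R) x T : (0 < d)%N ->
  (forall S, (d < #|S|)%N -> a S = 0) ->
  (forall x, (forall i, `|x i| <= 1) -> `|walsh a x| <= M) ->
  (forall i, `|x i| <= 1) ->
  `|\sum_(i in T) x i * walsh (dcoef i a) x| <= 2 * ((1 + expR 1) * expR 1) ^+ d * M.
Proof.
move=> d0 ad aM x1.
pose p : {poly R} := \sum_S (a S * \prod_(i in S) x i) *: (1 - 'X) ^+ #|S :&: T|.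
have pE s : p.[s] = walsh a (fun i => if i \in T then (1 - s) * x i else x i).
  rewrite horner_sum; apply: eq_bigr => S _; rewrite !hornerE -mulrA; congr (_ * _).
  rewrite [RHS](eq_bigr (fun i => x i * (if i \in T then 1 - s else 1))).
    rewrite big_split; congr (_ * _); rewrite -big_mkcondr prodr_const.
    by congr (_ ^+ _); apply: eq_card => i; rewrite finset.in_setI.
  by move=> i _; case: ifP => _; rewrite ?mulr1 // mulrC.
have sp : (size p <= d.+1)%N.
  rewrite (leq_trans (size_sum _ _ _))//; apply/bigmax_leqP => S _.
  have [dS|Sd] := ltnP d #|S|; first by rewrite ad// mul0r scale0r size_poly0.
  rewrite (leq_trans (size_scale_leq _ _))// (leq_trans (size_poly_exp_leq _ _))// ltnS.
  rewrite (leq_trans _ Sd)// (leq_trans _ (subset_leq_card (finset.subsetIl S T)))//.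
  have : (size (1 - 'X : {poly R})%R <= 2)%N.
    by rewrite (leq_trans (size_polyD _ _))// size_polyN size_polyX size_poly1.
  by case: (size (1 - 'X : {poly R})%R) => [|[|[|?]]]//= _; rewrite ?mul0n ?mul1n.
have p1 : p`_1 = - \sum_(i in T) x i * walsh (dcoef i a) x.
  transitivity (p^`().[0]); first by rewrite horner_coef0 coef_deriv mulr1n.
  rewrite /p raddf_sum horner_sum.
  under [in RHS]eq_bigr do rewrite mul_walsh_dcoef.
  rewrite (exchange_big_dep xpredT)//= -sumrN; apply: eq_bigr => S _.
  rewrite derivZ deriv_exp derivB derivX derivC !hornerE hornerMn !hornerE.
  rewrite subr0 expr1n mulr1 mulNrn mulrN sumr_const mulr_natr; congr (- (_ *+ _)).
  by apply: eq_card => i; rewrite finset.in_setI andbC.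
rewrite -[X in X <= _]normrN -p1; apply: coef1_bound => // s s0 s1; rewrite pE; apply: aM => i.
case: ifP => // _; rewrite normrM -[leRHS]mul1r ler_pM//.
by rewrite ger0_norm ?subr_ge0// gerBl.
Qed.

(** Since [T] was arbitrary, it can collect the terms of one sign: absolute values inside the sum
    cost a factor 2 only, and the bound does not depend on the number of variables. *)
Lemma sum_dcoef_bound (d : nat) a (M : R) X : (0 < d)%N ->
  (forall S, (d < #|S|)%N -> a S = 0) ->
  (forall x, (forall i, `|x i| <= 1) -> `|walsh a x| <= M) ->
  \sum_i `|walsh (dcoef i a) (pm R X)| <= 4 * ((1 + expR 1) * expR 1) ^+ d * M.
Proof.
move=> d0 ad aM; have pm1 i : `|pm R X i| = 1 by rewrite /pm normrX normrN1 expr1n.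
rewrite (eq_bigr (fun i => `|pm R X i * walsh (dcoef i a) (pm R X)|)); last first.
  by move=> i _; rewrite normrM pm1 mul1r.
have x1 i : `|pm R X i| <= 1 by rewrite pm1.
apply: le_trans (sum_le_double_partial
  (fun T => sum_dcoef_partial_bound T d0 ad aM x1)) _.
by rewrite !mulrA -natrM.
Qed.

Lemma sum_small_sets_le (d : nat) : (0 < d)%N -> (d <= #|I|)%N ->
  \sum_(S : {set I} | (#|S| < d)%N) 1 <= (#|I|%:R / d%:R) ^+ d.-1 * expR 1 ^+ d :> R.
Proof.
move=> d0 dm; have dR : (0 : R) < d%:R by rewrite ltr0n.
have mR : (0 : R) < #|I|%:R by rewrite ltr0n (leq_trans d0).
(* Weighting each set by y^|S| with y <= 1 bounds y^(d-1) times the count by (1 + y)^|I| <= e^(y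
   |I|), which equals e^d for this choice of [y]. *)
pose y : R := d%:R / #|I|%:R.
have y0 : 0 < y by rewrite divr_gt0.
have y1 : y <= 1 by rewrite ler_pdivrMr// mul1r ler_nat.
have sumy : \sum_(S : {set I}) y ^+ #|S| = (1 + y) ^+ #|I|.
  transitivity (\prod_(i : I) (y + 1)); last by rewrite prodr_const addrC.
  rewrite bigA_distr; apply: eq_big => // S _.
  by rewrite -big_mkcond prodr_const.
apply: (@le_trans _ _ (y ^- d.-1 * \sum_(S : {set I}) y ^+ #|S|)).
  rewrite mulr_sumr big_mkcond /=; apply: ler_sum => S _; case: ifP => Sd.
    rewrite mulrC ler_pdivlMr ?exprn_gt0// mul1r ler_wiXn2l ?(ltW y0)//.
    by rewrite -ltnS prednK.
  by rewrite mulr_ge0// ?invr_ge0 exprn_ge0 ?(ltW y0).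
rewrite -exprVn invf_div ler_wpM2l ?exprn_ge0 ?divr_ge0//.
rewrite sumy -expRM_natl mulr1.
apply: (@le_trans _ _ (expR y ^+ #|I|)).
  by rewrite lerXn2r ?nnegrE ?expR_ge0 ?addr_ge0 ?(ltW y0)// expR_ge1Dx.
by rewrite -expRM_natl mulrC divfK ?gt_eqF.
Qed.

Lemma sum_norm_le_dcoef a :
  \sum_S `|a S| <= `|a finset.set0| + \sum_i \sum_S `|dcoef i a S|.
Proof.
rewrite (bigD1 finset.set0)//= lerD2l.
rewrite [leRHS](eq_bigr (fun i => \sum_(S : {set I} | i \in S) `|a S|)); last first.
  move=> i _; rewrite (big_setU1_split _ i) [RHS]big_mkcond (big_setU1_split _ i).
  apply: eq_bigr => S iS.
  by rewrite /dcoef (negbTE iS) finset.setU11 normr0 addr0 add0r.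
rewrite (exchange_big_dep xpredT)//= big_mkcond; apply: ler_sum => S _.
rewrite sumr_const; case: ifP => [S0|_]; last exact: mulrn_wge0.
by rewrite -mulr_natr ler_peMr// ler1n card_gt0.
Qed.

(** The product of 3 (hypercontractivity), e (count of the small sets), (1 + e) e (Markov-type
    estimate) and 5. The last factor absorbs the constant term and the 4 of [sum_dcoef_bound]: 1 + 4
    y <= 5 y for y >= 1. *)
Definition sidon_const : R := 15 * (1 + expR 1) * expR 1 ^+ 2.

(* The l1 norm of the coefficients is at most the sum over i of those of the
   i-th derivative, which Cauchy-Schwarz and hypercontractivity bound by its L1
   norm; on the cube the derivatives are summable in i by the Markov-type
   estimate [sum_dcoef_bound]. *)
Lemma walsh_sidon (d : nat) a (M : R) : (0 < d)%N -> (d <= #|I|)%N ->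
  (forall S, (d < #|S|)%N -> a S = 0) ->
  (forall x, (forall i, `|x i| <= 1) -> `|walsh a x| <= M) ->
  \sum_S `|a S| <= sidon_const ^+ d * Num.sqrt ((#|I|%:R / d%:R) ^+ d.-1) * M.
Proof.
move=> d0 dm ad aM; apply: le_trans (sum_norm_le_dcoef a) _.
have dR : (0 : R) < d%:R by rewrite ltr0n.
set s := Num.sqrt _.
have s2 : s ^+ 2 = (#|I|%:R / d%:R) ^+ d.-1 by rewrite sqr_sqrtr ?exprn_ge0 ?divr_ge0.
have s1 : 1 <= s.
  by rewrite -sqrtr1 ler_wsqrtr// exprn_ege1// ler_pdivlMr// mul1r ler_nat.
have e1 : 1 <= expR 1 :> R by rewrite -expR0 ler_expR.
have a0M : `|a finset.set0| <= M.
  have -> : a finset.set0 = walsh a (fun=> 0).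
    rewrite /walsh (bigD1 finset.set0)//= big_set0 mulr1 big1 ?addr0// => S S0.
    by rewrite prodr_const expr0n cards_eq0 (negbTE S0) mulr0.
  by apply: aM => i; rewrite normr0.
have M0 : 0 <= M by apply: le_trans a0M.
set K0 := ((1 + expR 1) * expR 1 : R).
have K00 : 0 <= K0 by rewrite mulr_ge0 ?addr_ge0 ?expR_ge0.
have dcd i S : (d.-1 < #|S|)%N -> dcoef i a S = 0.
  rewrite prednK// /dcoef => dS; case: ifPn => // iS; apply: ad.
  by rewrite cardsU1 iS.
have Hi i : \sum_S `|dcoef i a S| <= s * expR 1 ^+ d * Num.sqrt (\sum_S dcoef i a S ^+ 2).
  rewrite -(@ler_sqr _ (\sum_S _)) ?nnegrE; first last.
  - by rewrite !mulr_ge0 ?sqrtr_ge0 ?exprn_ge0 ?expR_ge0.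
  - exact: sumr_ge0.
  rewrite exprMn sqr_sqrtr; last by apply: sumr_ge0 => S _; exact: sqr_ge0.
  rewrite [X in X ^+ 2 <= _](_ : _ =
    \sum_(S : {set I} | (#|S| < d)%N) 1 * `|dcoef i a S|); last first.
    rewrite (bigID (fun S : {set I} => (#|S| < d)%N)) /= [X in _ + X]big1 ?addr0.
      by apply: eq_bigr => S _; rewrite mul1r.
    by move=> S; rewrite -leqNgt => dS; rewrite dcd ?normr0 ?prednK.
  apply: le_trans (cauchy_schwarz_sum _ _ _) _.
  apply: ler_pM; [by apply: sumr_ge0 => ? _; exact: sqr_ge0 | by apply: sumr_ge0 => ? _; exact: sqr_ge0 | |].
    under eq_bigr do rewrite expr1n.
    apply: le_trans (sum_small_sets_le d0 dm) _.
    rewrite [leRHS]exprMn s2 ler_wpM2l ?exprn_ge0 ?divr_ge0//.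
    by rewrite -exprM ler_weXn2l// leq_pmulr.
  under eq_bigr do rewrite real_normK ?num_real//.
  rewrite [leRHS](bigID (fun S : {set I} => (#|S| < d)%N)) /= lerDl.
  by apply: sumr_ge0 => ? _; exact: sqr_ge0.
have HS : \sum_i Num.sqrt (\sum_S dcoef i a S ^+ 2) <= 3 ^+ d.-1 * (4 * K0 ^+ d * M).
  have T0 : 0 < 2 ^+ #|I| :> R by rewrite exprn_gt0.
  rewrite -(ler_pM2l T0) mulr_sumr.
  apply: (@le_trans _ _ (\sum_i 3 ^+ d.-1 * \sum_X `|walsh (dcoef i a) (pm R X)|)).
    by apply: ler_sum => i _; exact: l2_le_l1 (dcd i).
  rewrite -mulr_sumr exchange_big /= mulrCA ler_wpM2l ?exprn_ge0//.
  rewrite -card_setI mulr_suml; apply: ler_sum => X _; rewrite mul1r.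
  exact: sum_dcoef_bound.
apply: (@le_trans _ _ (M + s * expR 1 ^+ d * (3 ^+ d.-1 * (4 * K0 ^+ d * M)))).
  apply: lerD => //; apply: le_trans (ler_sum _ (fun i _ => Hi i)) _.
  by rewrite -mulr_sumr ler_wpM2l// mulr_ge0 ?exprn_ge0 ?expR_ge0// (le_trans ler01).
have KK : 1 <= (3 * expR 1 * K0) ^+ d.
  rewrite exprn_ege1//; move: (expR 1) e1 @K0 {K00 Hi HS} => e e1 /=; nra.
have -> : sidon_const = 5 * (3 * expR 1 * K0) by rewrite /sidon_const /K0; ring.
have H5 : 1 + 4 * (3 * expR 1 * K0) ^+ d <= (5 * (3 * expR 1 * K0)) ^+ d.
  rewrite [leRHS]exprMn; apply: (@le_trans _ _ (5 * (3 * expR 1 * K0) ^+ d)); first by lra.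
  apply: ler_wpM2r; first by rewrite (le_trans ler01).
  by rewrite -[X in X <= _]expr1 ler_weXn2l// ler1n.
apply: (@le_trans _ _ (s * M * (1 + 4 * (3 * expR 1 * K0) ^+ d))); last first.
  rewrite [leRHS](_ : _ = s * M * (5 * (3 * expR 1 * K0)) ^+ d); last by ring.
  by rewrite ler_wpM2l// mulr_ge0// (le_trans ler01).
rewrite mulrDr mulr1; apply: lerD; first by rewrite ler_peMl.
rewrite [leRHS](_ : _ = s * expR 1 ^+ d * (3 ^+ d * (4 * K0 ^+ d * M))); last first.
  by rewrite !exprMn; ring.
rewrite ler_wpM2l ?mulr_ge0 ?exprn_ge0 ?expR_ge0 ?sqrtr_ge0// ler_wpM2r//.
  by rewrite !mulr_ge0 ?exprn_ge0.
by rewrite ler_weXn2l ?ler1n// leq_pred.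
Qed.
End Sidon.

(** * Operator norms, tensors and local bases *)

Section Norms.
Variable R : realType.
Local Notation C := R[i].
Local Notation normc := Normc.normc.

Lemma normcC (z : C) : (normc z)%:C = `|z|. Proof. by []. Qed.

Lemma normc_ge0 (z : C) : 0 <= normc z.
Proof. by rewrite -ler0c normcC. Qed.

Lemma normc_le_add (x y : C) : normc (x + y) <= normc x + normc y.
Proof. by rewrite -lecR rmorphD /= !normcC ler_normD. Qed.

Lemma normc_le_sum (I : Type) (r : seq I) (P : pred I) (F : I -> C) :
  normc (\sum_(i <- r | P i) F i) <= \sum_(i <- r | P i) normc (F i).
Proof.
elim/big_rec2: _ => [|i y x _ H]; first by rewrite Normc.normc0.
by apply: le_trans (normc_le_add _ _) _; rewrite lerD2l.
Qed.

Lemma normcJ (z : C) : normc (z^* )%R = normc z.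
Proof. by apply: complexI; rewrite !normcC norm_conjC. Qed.

Lemma normcN' (z : C) : normc (- z) = normc z.
Proof. by apply: complexI; rewrite !normcC normrN. Qed.

Lemma normc_real (x : R) : 0 <= x -> normc x%:C = x.
Proof. by move=> x0; apply: complexI; rewrite normcC ger0_norm ?ler0c. Qed.

Lemma sqr_normc_conj (z : C) : ((normc z) ^+ 2)%:C = z * (z^* )%R.
Proof. by rewrite rmorphXn /= normcC normCK. Qed.

Lemma l2norm_ge0 m (v : 'cV[C]_m) : 0 <= l2norm v.
Proof. exact: sqrtr_ge0. Qed.

Lemma l2norm_sqr m (v : 'cV[C]_m) : l2norm v ^+ 2 = \sum_i normc (v i 0) ^+ 2.
Proof. by rewrite sqr_sqrtr// sumr_ge0// => i _; exact: sqr_ge0. Qed.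

Lemma l2norm_sqrC m (v : 'cV[C]_m) : (l2norm v ^+ 2)%:C = (v^t* *m v) 0 0.
Proof.
rewrite l2norm_sqr rmorph_sum /= mxE; apply: eq_bigr => i _.
by rewrite sqr_normc_conj !mxE mulrC.
Qed.

Lemma l2norm0 m : l2norm (0 : 'cV[C]_m) = 0.
Proof.
by rewrite /l2norm big1 ?sqrtr0// => i _; rewrite mxE Normc.normc0 expr0n.
Qed.

Lemma l2norm_eq0 m (v : 'cV[C]_m) : l2norm v = 0 -> v = 0.
Proof.
move=> v0; have : l2norm v ^+ 2 = 0 by rewrite v0 expr0n.
rewrite l2norm_sqr => /eqP; rewrite psumr_eq0; last by move=> i _; exact: sqr_ge0.
move=> /allP v0'; apply/matrixP => i j; rewrite ord1 mxE.
have := v0' i (mem_index_enum i); rewrite sqrf_eq0 => /eqP; exact: Normc.eq0_normc.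
Qed.

Lemma l2normZ m (a : C) (v : 'cV[C]_m) : l2norm (a *: v) = normc a * l2norm v.
Proof.
apply/eqP; rewrite -(@eqrXn2 _ 2) ?mulr_ge0 ?l2norm_ge0 ?normc_ge0//; apply/eqP.
rewrite exprMn !l2norm_sqr mulr_sumr; apply: eq_bigr => i _.
by rewrite mxE Normc.normcM exprMn.
Qed.

Lemma l2norm_dot m (u v : 'cV[C]_m) : normc ((u^t* *m v) 0 0) <= l2norm u * l2norm v.
Proof.
apply: (@le_trans _ _ (\sum_i normc (u i 0) * normc (v i 0))).
  rewrite mxE; apply: le_trans (normc_le_sum _ _ _) _.
  by apply: ler_sum => i _; rewrite !mxE Normc.normcM normcJ.
rewrite -(@ler_sqr _ (\sum_i _)) ?nnegrE ?mulr_ge0 ?l2norm_ge0//; last first.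
  by apply: sumr_ge0 => i _; rewrite mulr_ge0 ?normc_ge0.
by rewrite exprMn !l2norm_sqr; exact: cauchy_schwarz_sum.
Qed.

Lemma l2normD m (u v : 'cV[C]_m) : l2norm (u + v) <= l2norm u + l2norm v.
Proof.
rewrite -(@ler_sqr _ (l2norm (u + v))) ?nnegrE ?addr_ge0 ?l2norm_ge0//.
rewrite -lecR l2norm_sqrC sqrrD mulr2n !rmorphD /= !l2norm_sqrC.
rewrite [(u + v)^t*](_ : _ = u^t* + v^t*); last first.
  by apply/matrixP => i j; rewrite !mxE rmorphD.
rewrite mulmxDl !mulmxDr; have mxD (A B : 'M[C]_1) : (A + B) 0 0 = A 0 0 + B 0 0 by rewrite mxE.
rewrite !mxD -!addrA lerD2l !addrA lerD2r.
set a := (u^t* *m v) 0 0; set b := (v^t* *m u) 0 0.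
have -> : b = (a^* )%R.
  rewrite /a /b !mxE rmorph_sum; apply: eq_bigr => i _.
  by rewrite !mxE rmorphM /= conjCK mulrC.
rewrite -rmorphD /=.
have H : normc a <= l2norm u * l2norm v := l2norm_dot u v.
apply: (@le_trans _ _ ((normc a + normc a)%:C)); last by rewrite lecR lerD.
have : a + (a^* )%R \is Num.real by apply/CrealP; rewrite rmorphD /= conjCK addrC.
move=> /real_ler_norm /le_trans; apply.
by rewrite -normcC lecR (le_trans (normc_le_add _ _))// normcJ.
Qed.

(** Upper bounds on the operator norm, in a form that also covers rectangular matrices and avoids
    the supremum; [opnorm_le] and [bnd_opnorm] translate. *)
Definition bnd {m n} (A : 'M[C]_(m, n)) (c : R) := forall v, l2norm (A *m v) <= c * l2norm v.

Lemma bndM m n p (A : 'M[C]_(m, n)) (B : 'M[C]_(n, p)) a b :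
  0 <= a -> bnd A a -> bnd B b -> bnd (A *m B) (a * b).
Proof.
move=> a0 HA HB v; rewrite -mulmxA; apply: le_trans (HA _) _.
by rewrite -mulrA ler_wpM2l.
Qed.

Lemma bndD m n (A B : 'M[C]_(m, n)) a b : bnd A a -> bnd B b -> bnd (A + B) (a + b).
Proof.
move=> HA HB v; rewrite mulmxDl mulrDl; apply: le_trans (l2normD _ _) _.
exact: lerD.
Qed.

Lemma bndZ m n (A : 'M[C]_(m, n)) a c : bnd A a -> bnd (c *: A) (normc c * a).
Proof.
by move=> HA v; rewrite -scalemxAl l2normZ -mulrA ler_wpM2l ?normc_ge0.
Qed.

Lemma bndN m n (A : 'M[C]_(m, n)) a : bnd A a -> bnd (- A) a.
Proof.
by move=> HA; rewrite -scaleN1r -[a]mul1r -Normc.normc1 -(normcN' 1); exact: bndZ.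
Qed.

Lemma bndB m n (A B : 'M[C]_(m, n)) a b : bnd A a -> bnd B b -> bnd (A - B) (a + b).
Proof. by move=> HA /bndN; exact: bndD. Qed.

Lemma bnd_le m n (A : 'M[C]_(m, n)) a b : a <= b -> bnd A a -> bnd A b.
Proof. by move=> ab HA v; rewrite (le_trans (HA v))// ler_wpM2r ?l2norm_ge0. Qed.

Lemma l2norm_isometry m n (A : 'M[C]_(m, n)) v : A^t* *m A = 1%:M -> l2norm (A *m v) = l2norm v.
Proof.
move=> AA; apply/eqP; rewrite -(@eqrXn2 _ 2) ?l2norm_ge0//; apply/eqP.
apply: complexI; rewrite !l2norm_sqrC trmx_mul map_mxM mulmxA -[_ *m A^t* *m A]mulmxA.
by rewrite AA mulmx1.
Qed.

Lemma bnd_isometry m n (A : 'M[C]_(m, n)) : A^t* *m A = 1%:M -> bnd A 1.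
Proof. by move=> AA v; rewrite l2norm_isometry// mul1r. Qed.

Lemma unitarymxC m (A : 'M[C]_m) : A \is unitarymx -> A^t* *m A = 1%:M.
Proof. by move=> /unitarymxP /mulmx1C. Qed.

Lemma bnd_unitary m (A : 'M[C]_m) : A \is unitarymx -> bnd A 1.
Proof. by move=> /unitarymxC; exact: bnd_isometry. Qed.

Lemma bnd_adj m n (A : 'M[C]_(m, n)) c : 0 <= c -> bnd A c -> bnd (A^t*) c.
Proof.
move=> c0 HA v; set w := A^t* *m v.
have [/eqP w0|w0] := eqVneq (l2norm w) 0.
  by rewrite (eqP w0) mulr_ge0 ?l2norm_ge0.
have wp : 0 < l2norm w by rewrite lt_def w0 l2norm_ge0.
rewrite -(ler_pM2r wp) -expr2.
have -> : l2norm w ^+ 2 = normc ((v^t* *m (A *m w)) 0 0).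
  rewrite mulmxA [X in X *m w](_ : _ = w^t*); last first.
    by rewrite /w trmx_mul map_mxM /= trmxCK.
  by rewrite -l2norm_sqrC normc_real ?sqr_ge0.
apply: le_trans (l2norm_dot _ _) _.
by rewrite mulrC mulrAC ler_wpM2r ?l2norm_ge0.
Qed.

(** Any finite bound will do: it makes the set in [opnorm] bounded above, so that its supremum can
    be used as one. *)
Lemma bnd_frobenius m n (A : 'M[C]_(m, n)) : exists c, 0 <= c /\ bnd A c.
Proof.
have E0 (i : 'I_m) (j : 'I_n) (c : C) : exists c', 0 <= c' /\ bnd (c *: delta_mx i j : 'M[C]_(m, n)) c'.
  exists (normc c * 1); split; first by rewrite mulr1 normc_ge0.
  apply: bndZ => v; rewrite mul1r.
  rewrite -(@ler_sqr _ (l2norm (delta_mx i j *m v))) ?nnegrE ?l2norm_ge0// !l2norm_sqr.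
  rewrite (bigD1 i)//= [X in _ + X]big1 ?addr0 => [|k ki].
    rewrite (bigD1 j)//= mxE (bigD1 j)//= [X in _ + X]big1 ?addr0.
      by rewrite mxE !eqxx mul1r lerDl sumr_ge0// => ? _; exact: sqr_ge0.
    by move=> l lj; rewrite mxE eqxx (negbTE lj) mul0r.
  rewrite mxE big1 ?Normc.normc0 ?expr0n// => l _.
  by rewrite mxE (negbTE ki) mul0r.
rewrite (matrix_sum_delta A).
elim/big_rec: _ => [|i B _ [c [c0 HB]]].
  by exists 0; split => // v; rewrite mul0mx l2norm0 mul0r.
suff [c' [c'0 H]] : exists c', 0 <= c' /\ bnd (\sum_j A i j *: delta_mx i j) c'.
  by exists (c' + c); split; [exact: addr_ge0 | exact: bndD].
elim/big_rec: _ => [|j B' _ [c' [c'0 HB']]].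
  by exists 0; split => // v; rewrite mul0mx l2norm0 mul0r.
have [e [e0 He]] := E0 i j (A i j).
by exists (e + c'); split; [exact: addr_ge0 | exact: bndD].
Qed.

Lemma opnorm_le m (A : 'M[C]_m) c : 0 <= c -> bnd A c -> opnorm A <= c.
Proof.
move=> c0 HA; apply: ge_sup; first by exists (l2norm (A *m 0)); exists 0 => //=; rewrite l2norm0.
move=> _ [v /= v1 <-]; apply: le_trans (HA v) _.
by rewrite -[leRHS]mulr1 ler_wpM2l.
Qed.

Lemma opnorm_ub m (A : 'M[C]_m) v : l2norm v <= 1 -> l2norm (A *m v) <= opnorm A.
Proof.
move=> v1; apply: ub_le_sup; last by exists v.
have [c [c0 HA]] := bnd_frobenius A; exists c => _ [w /= w1 <-].
by apply: le_trans (HA w) _; rewrite -[leRHS]mulr1 ler_wpM2l.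
Qed.

Lemma opnorm_ge0 m (A : 'M[C]_m) : 0 <= opnorm A.
Proof. by apply: le_trans (opnorm_ub A (v := 0) _); rewrite ?mulmx0 l2norm0. Qed.

Lemma bnd_opnorm m (A : 'M[C]_m) : bnd A (opnorm A).
Proof.
move=> v; have [/eqP v0|v0] := eqVneq (l2norm v) 0.
  by rewrite (l2norm_eq0 (eqP v0)) mulmx0 l2norm0 mulr0.
have vp : 0 < l2norm v by rewrite lt_def v0 l2norm_ge0.
have nv : normc ((l2norm v)^-1)%:C = (l2norm v)^-1 by rewrite normc_real ?invr_ge0 ?l2norm_ge0.
have := @opnorm_ub _ A (((l2norm v)^-1)%:C *: v).
rewrite -scalemxAr !l2normZ nv mulVf// => /(_ (lexx _)).
by rewrite mulrC ler_pdivrMr.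
Qed.

End Norms.

(** * Tensor products over the sites *)

Section Tensors.
Variables (R : realType) (K n : nat).
Local Notation C := R[i].
Implicit Types A B : 'I_n -> 'M[C]_K.

Lemma sum_sysdim (F : {ffun 'I_n -> 'I_K} -> C) :
  \sum_(x < sysdim K n) F (enum_val x) = \sum_f F f.
Proof. by rewrite /sysdim -(big_enum_val F); apply: eq_bigl. Qed.

Lemma mul_tensor A B : tensor A *m tensor B = tensor (fun j => A j *m B j).
Proof.
apply/matrixP => x y; rewrite !mxE.
under eq_bigr do rewrite !mxE -big_split /=.
rewrite (sum_sysdim (fun f => \prod_j (A j _ (f j) * B j (f j) _))).
rewrite -(bigA_distr_bigA (fun j l => A j (enum_val x j) l * B j l (enum_val y j))).
by apply: eq_bigr => j _; rewrite mxE.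
Qed.

Lemma adj_tensor A : (tensor A)^t* = tensor (fun j => (A j)^t*).
Proof.
by apply/matrixP => x y; rewrite !mxE rmorph_prod; apply: eq_bigr => j _; rewrite !mxE.
Qed.

Lemma tensor1 : tensor (fun _ : 'I_n => 1%:M : 'M[C]_K) = 1%:M.
Proof.
apply/matrixP => x y; rewrite !mxE; case: (eqVneq x y) => [->|xy].
  by rewrite big1// => j _; rewrite mxE eqxx.
case: (pickP (fun j => (enum_val x : {ffun _ -> _}) j != (enum_val y : {ffun _ -> _}) j)) => [j jxy|xyE].
  by rewrite (bigD1 j)//= mxE (negbTE jxy) mul0r.
case/eqP: xy; apply: enum_val_inj; apply/ffunP => j.
by have /negbFE/eqP := xyE j.
Qed.

Lemma trace_tensor A : \tr (tensor A) = \prod_j \tr (A j).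
Proof.
rewrite /mxtrace; under [LHS]eq_bigr do rewrite mxE.
by rewrite (sum_sysdim (fun f => \prod_j A j (f j) (f j))) -(bigA_distr_bigA (fun j l => A j l l)).
Qed.

Lemma tensor_sum (L : finType) (Q : 'I_n -> pred L) (w : 'I_n -> L -> C) (B : 'I_n -> L -> 'M[C]_K) :
  tensor (fun j => \sum_(l | Q j l) w j l *: B j l) =
  \sum_(f in family Q) (\prod_j w j (f j)) *: tensor (fun j => B j (f j)).
Proof.
apply/matrixP => x y; rewrite !mxE summxE.
rewrite (eq_bigr (fun j => \sum_(l | Q j l) w j l * B j l
   ((enum_val x : {ffun _ -> _}) j) ((enum_val y : {ffun _ -> _}) j))); last first.
  by move=> j _; rewrite summxE; apply: eq_bigr => l _; rewrite mxE.
rewrite bigA_distr_big_dep; apply: eq_bigr => f _.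
by rewrite !mxE -big_split.
Qed.

Lemma tensor_unitary A : (forall j, A j \is unitarymx) -> tensor A \is unitarymx.
Proof.
move=> Au; apply/unitarymxP; rewrite adj_tensor mul_tensor -tensor1.
by congr tensor; apply/funext => j; apply/unitarymxP.
Qed.

End Tensors.

Lemma trace_adj (R : realType) m (A : 'M[R[i]]_m) : \tr (A^t*) = ((\tr A)^* )%R.
Proof. by rewrite /mxtrace rmorph_sum; apply: eq_bigr => i _; rewrite !mxE. Qed.

Lemma hermsymmx_adj (R : realType) m (A : 'M[R[i]]_m) : A \is hermsymmx -> A^t* = A.
Proof. by move=> /is_hermitianmxP; rewrite expr0 scale1r. Qed.

(** A positive matrix is given by a Gram factor, so the trace is a sum of quadratic forms of [H] at
    the columns of [B], and no spectral theory is needed. *)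
Lemma trace_gram_bound (R : realType) m (H B : 'M[R[i]]_m) :
  Normc.normc (\tr (H *m (B *m B^t*))) <= opnorm H * complex.Re (\tr (B *m B^t*)).
Proof.
have trE (M : 'M[R[i]]_m) : \tr (M *m (B *m B^t*)) = \sum_k ((col k B)^t* *m (M *m col k B)) 0 0.
  rewrite mulmxA mxtrace_mulC /mxtrace; apply: eq_bigr => k _.
  rewrite !mxE; apply: eq_bigr => j _; rewrite !mxE; congr (_ * _).
  by apply: eq_bigr => l _; rewrite !mxE.
have := trE 1%:M; rewrite mul1mx => ->; rewrite trE.
have -> : \sum_k ((col k B)^t* *m (1%:M *m col k B)) 0 0 =
    (\sum_k l2norm (col k B) ^+ 2)%:C.
  by rewrite rmorph_sum; apply: eq_bigr => k _; rewrite mul1mx -l2norm_sqrC.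
rewrite [complex.Re _]/=.
apply: le_trans (normc_le_sum _ _ _) _; rewrite mulr_sumr; apply: ler_sum => k _.
apply: le_trans (l2norm_dot _ _) _; rewrite mulrC expr2 mulrA ler_wpM2r ?l2norm_ge0//.
exact: bnd_opnorm.
Qed.

(** * Expansion in a unitary local basis *)

Section LocalBasis.
Variables (R : realType) (K : nat) (U : 'I_(K ^ 2) -> 'M[R[i]]_K).
Local Notation C := R[i].
Hypotheses (K_gt0 : (0 < K)%N) (HU : normalized_unitary_local_basis U).

Lemma basis_orthonormal (i j : 'I_(K ^ 2)) :
  K%:R^-1 * \tr (U i *m (U j)^t*) = (i == j)%:R.
Proof. by case: HU. Qed.

Lemma basis_unitary i : U i \is unitarymx.
Proof. by case: HU. Qed.

Lemma basis_id (i : 'I_(K ^ 2)) : i = 0%N :> nat -> U i = 1%:M.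
Proof. by case: HU => H _ _ _; exact: H. Qed.

Lemma natr_neq0 (m : nat) : (0 < m)%N -> m%:R != 0 :> C.
Proof. by rewrite pnatr_eq0 -lt0n. Qed.

Lemma basis_traceless (i j : 'I_(K ^ 2)) : j = 0%N :> nat -> i != j -> \tr (U i) = 0.
Proof.
move=> j0 ij; have := basis_orthonormal i j.
rewrite (negbTE ij) (basis_id j0) trmx1 map_mx1 mulmx1 => /eqP.
by rewrite mulf_eq0 invr_eq0 (negbTE (natr_neq0 K_gt0)) => /eqP.
Qed.

(* u u^* = 1 for the square matrix u of all coefficients gives u^* u = 1. *)
Lemma basis_complete (r s r' s' : 'I_K) :
  \sum_b K%:R^-1 * (U b r s * ((U b r' s')^* )%R) = ((r == r') && (s == s'))%:R.
Proof.
pose u : 'M[C]_(K ^ 2, K * K) := \matrix_(b, k) U b (mxtens_unindex k).1 (mxtens_unindex k).2.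
pose v : 'M[C]_(K * K, K ^ 2) := K%:R^-1 *: u^t*.
have uv : u *m v = 1%:M.
  apply/matrixP => b b'; rewrite !mxE -basis_orthonormal.
  rewrite /mxtrace mulr_sumr.
  rewrite (eq_bigr (fun r : 'I_K => \sum_(s < K) K%:R^-1 * (U b r s * ((U b' r s)^* )%R))).
    rewrite pair_big /= (reindex (@mxtens_index K K)) /=; last first.
      by exists (@mxtens_unindex K K) => ? _; [exact: mxtens_indexK | exact: mxtens_unindexK].
    by apply: eq_bigr => -[i j] _; rewrite !mxE !mxtens_indexK /= mulrCA.
  by move=> i _; rewrite mxE mulr_sumr; apply: eq_bigr => k _; rewrite !mxE.
have e : (K ^ 2 = K * K)%N by rewrite expnS expn1.
have vu : v *m u = 1%:M.
  by move: u v uv => {}u v; case: _ / e in u v *; exact: mulmx1C.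
have := congr1 (fun M : 'M[C]_(K * K) => M (mxtens_index (r', s')) (mxtens_index (r, s))) vu.
rewrite !mxE => H; transitivity (\sum_j v (mxtens_index (r', s')) j * u j (mxtens_index (r, s))).
  by apply: eq_bigr => b _; rewrite !mxE !mxtens_indexK /= -mulrA [X in _ * X]mulrC.
rewrite H (can_eq (@mxtens_indexK K K)) xpair_eqE [r' == _]eq_sym [s' == _]eq_sym //.
Qed.

Variable n : nat.
Implicit Types (H : 'M[C]_(sysdim K n)) (b : {ffun 'I_n -> 'I_(K ^ 2)}).

Lemma basis_tensor_unitary b : basis_tensor U b \is unitarymx.
Proof. by apply: tensor_unitary => j; exact: basis_unitary. Qed.

Lemma basis_tensor_expansion H : H = \sum_b coef U H b *: basis_tensor U b.
Proof.
apply/matrixP => x y; rewrite summxE.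
transitivity (\sum_x' \sum_y' H x' y' * ((x == x') && (y == y'))%:R).
  rewrite (bigD1 x)//= [X in _ = _ + X]big1 ?addr0.
    rewrite (bigD1 y)//= [X in _ = _ + X]big1 ?addr0 ?eqxx ?mulr1// => y' /negbTE.
    by rewrite eq_sym => ->; rewrite andbF mulr0.
  by move=> x' /negbTE; rewrite eq_sym => xx'; rewrite big1// => y' _; rewrite xx' mulr0.
have complete (x' y' : 'I_(sysdim K n)) :
    \sum_b (K ^ n)%:R^-1 * (basis_tensor U b x y * ((basis_tensor U b x' y')^* )%R)
    = ((x == x') && (y == y'))%:R.
  transitivity (\prod_(j < n) \sum_b K%:R^-1 * (U b ((enum_val x : {ffun _ -> _}) j) ((enum_val y : {ffun _ -> _}) j)
      * ((U b ((enum_val x' : {ffun _ -> _}) j) ((enum_val y' : {ffun _ -> _}) j))^* )%R)).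
    rewrite bigA_distr_bigA; apply: eq_bigr => b _.
    rewrite big_split /= big_const_ord iter_mulr_1 exprVn natrX; congr (_ * _).
    by rewrite big_split /= !mxE rmorph_prod.
  under eq_bigr do rewrite basis_complete.
  case: (boolP (_ && _)) => [/andP[/eqP <- /eqP <-]|].
    by rewrite big1// => j _; rewrite !eqxx.
  move=> xy; apply/eqP; rewrite -(negbK (_ == _)) /=; apply/negP => p0; case/negP: xy.
  have {}p0 j : (enum_val x : {ffun _ -> _}) j = (enum_val x' : {ffun _ -> _}) j /\
    (enum_val y : {ffun _ -> _}) j = (enum_val y' : {ffun _ -> _}) j.
    move: p0; rewrite prodf_seq_neq0 => /allP /(_ j (mem_index_enum j)) /=.
    by case: (boolP (_ && _)) => [/andP[/eqP-> /eqP->]|] //=; rewrite eqxx.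
  apply/andP; split; apply/eqP; apply: enum_val_inj; apply/ffunP => j; by case: (p0 j).
under eq_bigr do under eq_bigr do rewrite -complete mulr_sumr.
under eq_bigr do rewrite exchange_big.
rewrite exchange_big /=; apply: eq_bigr => b _; rewrite [RHS]mxE /coef /mxtrace mulr_sumr mulr_suml; apply: eq_bigr => x' _.
rewrite [in RHS]mxE mulr_sumr mulr_suml; apply: eq_bigr => y' _.
rewrite [(_^t*) _ _]mxE [(_^T) _ _]mxE; ring.
Qed.

End LocalBasis.

(** * The l1 norm of the coefficients *)

Section HermitianFrame.
Variables (R : realType) (K : nat) (U : 'I_(K ^ 2) -> 'M[R[i]]_K).
Local Notation C := R[i].
Local Notation label := ('I_(K ^ 2) * bool)%type.
Hypotheses (K_gt0 : (0 < K)%N) (HU : normalized_unitary_local_basis U).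
Variable o0 : 'I_(K ^ 2).
Hypothesis o0E : o0 = 0%N :> nat.

(* The label (0, true) carries the zero matrix: it is kept so that the labels
   form a product type. *)
Definition frame (p : label) : 'M[C]_K :=
  if p.1 == o0 then (if p.2 then 0 else 1%:M)
  else if p.2 then ('i%C / 2) *: (U p.1 - (U p.1)^t*) else 2^-1 *: (U p.1 + (U p.1)^t*).

Definition frame_phase (p : label) : C := if p.2 then 'i%C else 1.

Lemma adjmxD m k (A B : 'M[C]_(m, k)) : (A + B)^t* = A^t* + B^t*.
Proof. by apply/matrixP => i j; rewrite !mxE rmorphD. Qed.

Lemma adjmxN m k (A : 'M[C]_(m, k)) : (- A)^t* = - A^t*.
Proof. by apply/matrixP => i j; rewrite !mxE rmorphN. Qed.

Lemma adjmxZ m k (c : C) (A : 'M[C]_(m, k)) : (c *: A)^t* = (c^* )%R *: A^t*.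
Proof. by apply/matrixP => i j; rewrite !mxE rmorphM. Qed.

Lemma adjmx1 m : (1%:M : 'M[C]_m)^t* = 1%:M.
Proof. by rewrite trmx1 map_mx1. Qed.

Lemma adjmxM m k l (A : 'M[C]_(m, k)) (B : 'M[C]_(k, l)) : (A *m B)^t* = B^t* *m A^t*.
Proof. by rewrite trmx_mul map_mxM. Qed.

Lemma conj_i : (('i%C : C)^* )%R = - 'i%C.
Proof. by apply/eqP; rewrite eq_complex /= oppr0 !eqxx. Qed.

Lemma conj_half : ((2^-1 : C)^* )%R = 2^-1.
Proof. by rewrite fmorphV rmorph_nat. Qed.

Lemma mul_ii : 'i%C * 'i%C = -1 :> C.
Proof. by rewrite -expr2 sqr_i. Qed.

Lemma frame_adj p : (frame p)^t* = frame p.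
Proof.
rewrite /frame; case: ifP => _; case: ifP => _.
- by apply/matrixP => i j; rewrite !mxE rmorph0.
- exact: adjmx1.
- rewrite adjmxZ adjmxD adjmxN trmxCK rmorphM /= conj_i conj_half mulNr scaleNr -scalerN.
  by rewrite opprB addrC.
- by rewrite adjmxZ adjmxD trmxCK conj_half addrC.
Qed.

(** This is U^* = (U/2 + U^*/2) + i . i (U/2 - U^*/2). Adjoints are expanded because [coef] pairs
    [H] with the adjoint of the basis element. *)
Lemma adj_basis_frame b :
  (U b)^t* = \sum_(p : label | p.1 == b) frame_phase p *: frame p.
Proof.
rewrite (eq_bigl (fun p : label => (p.1 == b) && predT p.2)); last by move=> p; rewrite andbT.
rewrite -(pair_big_dep (pred1 b) (fun _ => predT) (fun i s => frame_phase (i, s) *: frame (i, s))) /=.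
rewrite big_pred1_eq (bigD1 true)//= (bigD1 false)//= big1; last by case.
rewrite /frame_phase /frame /= scale1r addr0; case: eqP => [->|_].
  by rewrite scaler0 add0r (basis_id HU o0E) adjmx1.
rewrite scalerA mulrA mul_ii mulNr mul1r scaleNr -scalerN opprB -scalerDr.
rewrite addrA subrK -[X in X + X]scale1r -scalerDl scalerA.
by rewrite -(natrD _ 1 1) mulVf ?scale1r ?pnatr_eq0.
Qed.

Lemma frame_traceless p : p != (o0, false) -> \tr (frame p) = 0.
Proof.
rewrite /frame; case: p => b s /=; have [->|b0] := eqVneq b o0.
  by case: s => [_|]; rewrite ?mxtrace0 ?eqxx.
have trb : \tr (U b) = 0 by apply: basis_traceless HU _ _ o0E b0.
by move=> _; case: s; rewrite mxtraceZ raddfD ?raddfN /= trace_adj trb rmorph0 ?oppr0 addr0 mulr0.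
Qed.

(* 1 +- G is a Gram matrix: (1 + c U)(1 + c U)^* = 2 + c U + (c U)^* for |c| = 1. *)
Lemma frame_gram p (e : bool) : p != (o0, false) ->
  exists B : 'M[C]_K, 1%:M + (-1) ^+ e *: frame p = B *m B^t*.
Proof.
case: p => b s /= p0; have [b0|b0] := eqVneq b o0.
  move: p0; rewrite b0 xpair_eqE eqxx /=; case: s => //= _.
  by exists 1%:M; rewrite /frame /= eqxx scaler0 addr0 adjmx1 mulmx1.
pose c : C := (-1) ^+ e * frame_phase (b, s).
have cc : c * (c^* )%R = 1.
  rewrite /c /frame_phase /= rmorphM rmorphXn rmorphN1 mulrACA -exprMn mulrNN mulr1 expr1n mul1r.
  by case: (s); rewrite /= ?conj_i ?mulrN ?mul_ii ?opprK ?rmorph1 ?mulr1.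
have UU : U b *m (U b)^t* = 1%:M by apply/unitarymxP; exact: basis_unitary.
exists (sqrtC 2^-1 *: (1%:M + c *: U b)).
have s2 : sqrtC (2^-1 : C) * ((sqrtC (2^-1 : C))^* )%R = 2^-1.
  by rewrite -normCK ger0_norm ?sqrtC_ge0 ?invr_ge0// sqrtCK.
rewrite adjmxZ -scalemxAl -scalemxAr scalerA s2 adjmxD adjmxZ adjmx1.
rewrite mulmxDl !mulmxDr !mul1mx mulmx1 -scalemxAl -scalemxAr UU scalerA cc scale1r.
rewrite [in LHS](_ : 1%:M = 2^-1 *: (1%:M + 1%:M) :> 'M[C]_K); last first.
  by rewrite -[X in _ *: (X + X)]scale1r -scalerDl scalerA -(natrD _ 1 1) mulVf ?scale1r ?pnatr_eq0.
have -> : (-1) ^+ e *: frame (b, s) = 2^-1 *: (c *: U b + (c^* )%R *: (U b)^t*).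
  rewrite /frame /= (negbTE b0) /c /frame_phase /=; case: (s).
    have -> : (((-1) ^+ e * 'i%C : C)^* )%R = - ((-1) ^+ e * 'i%C).
      by rewrite rmorphM rmorph_sign /= conj_i mulrN.
    rewrite scaleNr -scalerBr !scalerA; congr (_ *: _). ring.
  rewrite mulr1 rmorph_sign -scalerDr !scalerA. congr (_ *: _). ring.
rewrite -scalerDr; congr (_ *: _).
by rewrite [c *: _ + _]addrC addrACA [1%:M + c *: _]addrC.
Qed.

End HermitianFrame.

(** * Pairing a Hermitian matrix with product states *)

Section CoefficientBound.
Variables (R : realType) (K : nat) (U : 'I_(K ^ 2) -> 'M[R[i]]_K).
Local Notation C := R[i].
Local Notation label := ('I_(K ^ 2) * bool)%type.
Hypotheses (K_gt0 : (0 < K)%N) (HU : normalized_unitary_local_basis U).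
Variable o0 : 'I_(K ^ 2).
Hypothesis o0E : o0 = 0%N :> nat.
Variables (n d : nat) (H : 'M[C]_(sysdim K n)).
Hypotheses (Hherm : H \is hermsymmx) (Hdeg : in_Hle d H).
Local Notation frame := (frame U o0).
Local Notation frame_tensor f := (tensor (fun j => frame (f j))).
Implicit Type f : {ffun 'I_n -> label}.

Definition frame_coef f : R := complex.Re ((K ^ n)%:R^-1 * \tr (H *m frame_tensor f)).

(** The monomial attached to [f]: one variable for each site whose label is not the identity label
    [(o0, false)]. It determines [f], and its degree is the number of such sites. *)
Definition frame_supp f : {set 'I_n * label} :=
  [set p : 'I_n * label | (p.2 != (o0, false)) && (f p.1 == p.2)]%SET.

Lemma realC_Re (z : C) : (z^* )%R = z -> (complex.Re z)%:C = z.
Proof. by move=> /CrealP/RRe_real. Qed.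

Lemma frame_coefE f : (frame_coef f)%:C = (K ^ n)%:R^-1 * \tr (H *m frame_tensor f).
Proof.
apply: realC_Re; rewrite rmorphM /= fmorphV rmorph_nat -trace_adj adjmxM (hermsymmx_adj Hherm).
rewrite adj_tensor mxtrace_mulC; congr (_ * \tr (_ *m _)).
by congr tensor; apply/funext => j; rewrite frame_adj.
Qed.

Lemma frame_suppE f :
  frame_supp f = [set (j, f j) | j in [set j | f j != (o0, false)]%SET]%SET.
Proof.
apply/finset.setP => -[j p]; rewrite !finset.inE /=; apply/andP/imsetP => /= [[p0 /eqP fj]|[k]].
  by exists j; rewrite ?finset.inE fj.
by rewrite finset.inE => k0 [-> ->].
Qed.

Lemma frame_supp_card f : #|frame_supp f| = #|[set j | f j != (o0, false)]%SET|.
Proof. by rewrite frame_suppE card_in_imset// => j k _ _ []. Qed.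

(** If more than [d] sites carry a label other than the identity one, each component of [H] on a set
    S with |S| <= d leaves such a site outside S. There the local factor is a scalar times a
    traceless matrix, and the whole trace vanishes. *)
Lemma frame_coef_eq0 f : (d < #|frame_supp f|)%N -> frame_coef f = 0.
Proof.
rewrite frame_supp_card => df.
have [F [FS HE]] := Hdeg.
rewrite /frame_coef HE mulmx_suml raddf_sum big1 ?mulr0// => S Sd.
have [m [A [HA ->]]] := FS S.
rewrite mulmx_suml raddf_sum big1// => k _ /=.
rewrite mul_tensor trace_tensor.
have /fintype.subsetPn[j] : ~~ ([set j | f j != (o0, false)]%SET \subset S).
  by apply: contraL df => /subset_leq_card /leq_trans /(_ Sd); rewrite -leqNgt.
rewrite finset.inE => fj jS; have := HA k j; rewrite (negbTE jS) => /is_scalar_mxP[a Aa].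
by rewrite (bigD1 j)//= Aa mul_scalar_mx mxtraceZ (frame_traceless K_gt0 HU o0E fj) mulr0 mul0r.
Qed.

Lemma normc_coef_le (b : {ffun 'I_n -> 'I_(K ^ 2)}) :
  Normc.normc (coef U H b) <=
  \sum_(f in family (fun j (p : label) => p.1 == b j)) `|frame_coef f|.
Proof.
have -> : coef U H b = \sum_(f in family (fun j (p : label) => p.1 == b j))
    (\prod_j frame_phase R (f j)) * (frame_coef f)%:C.
  rewrite /coef adj_tensor.
  rewrite (_ : (fun j => _) = fun j => \sum_(p : label | p.1 == b j) frame_phase R p *: frame p).
    rewrite tensor_sum mulmx_sumr raddf_sum mulr_sumr; apply: eq_bigr => f _.
    by rewrite -scalemxAr /= mxtraceZ frame_coefE mulrCA.
  by apply/funext => j; exact: adj_basis_frame.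
apply: le_trans (normc_le_sum _ _ _) _; apply: ler_sum => f _.
rewrite Normc.normcM -[leRHS]mul1r ler_pM ?normc_ge0//.
  rewrite -lecR rmorph1 normcC normr_prod big1// => j _.
  by rewrite /frame_phase; case: ifP => _; rewrite ?normr1// -normcC /= expr0n expr1n /= add0r sqrtr1.
by rewrite -lecR normcC normc_def /= expr0n addr0 sqrtr_sqr.
Qed.

(** The weight of each label in the uniform average of the 1 + x_p G_p. *)
Definition kappa : R := (#|{: label}|)%:R^-1.

Lemma card_label : #|{: label}| = (2 * K ^ 2)%N.
Proof. by rewrite card_prod card_ord card_bool mulnC. Qed.

Lemma kappa_gt0 : 0 < kappa.
Proof. by rewrite invr_gt0 ltr0n card_label muln_gt0 expn_gt0 K_gt0. Qed.

Lemma kappa_le1 : kappa <= 1.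
Proof. by rewrite invf_le1 ?ltr0n ?ler1n card_label muln_gt0 expn_gt0 K_gt0. Qed.

Definition frame_weight (x : 'I_n * label -> R) (j : 'I_n) (p : label) : R :=
  if p == (o0, false) then 1 else kappa * x (j, p).

Definition product_state (x : 'I_n * label -> R) : 'M[C]_(sysdim K n) :=
  tensor (fun j => \sum_p (frame_weight x j p)%:C *: frame p).

Lemma trace_product_state x : \tr (product_state x) = (K ^ n)%:R.
Proof.
rewrite trace_tensor (eq_bigr (fun=> K%:R)); first by rewrite prodr_const card_ord natrX.
move=> j _; rewrite raddf_sum (bigD1 (o0, false))//= big1 ?addr0.
  by rewrite /frame_weight eqxx rmorph1 scale1r /frame /= eqxx mxtrace1.
by move=> p p0; rewrite mxtraceZ (frame_traceless K_gt0 HU o0E p0) mulr0.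
Qed.

(** The sum has at most one term, as [frame_supp] is injective; writing a sum avoids choosing an
    inverse. *)
Definition frame_walsh (S : {set 'I_n * label}) : R :=
  kappa ^+ #|S| * \sum_(f | frame_supp f == S) frame_coef f.

Lemma prod_frame_weight x f :
  \prod_j frame_weight x j (f j) = kappa ^+ #|frame_supp f| * \prod_(p in frame_supp f) x p.
Proof.
rewrite frame_supp_card frame_suppE big_imset /=; last by move=> j k _ _ [].
rewrite -prodr_const -big_split /= [RHS]big_mkcond /=; apply: eq_bigr => j _.
by rewrite finset.inE /frame_weight; case: eqP.
Qed.

Lemma walsh_frame x : (walsh frame_walsh x)%:C =
  (K ^ n)%:R^-1 * \tr (H *m product_state x).
Proof.
transitivity (\sum_(f : {ffun 'I_n -> label}) ((\prod_j frame_weight x j (f j)) * frame_coef f)%:C).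
  rewrite -rmorph_sum /=; congr (_%:C).
  rewrite [RHS](partition_big frame_supp xpredT)//=; apply: eq_bigr => S _.
  rewrite /frame_walsh mulrAC mulr_sumr; apply: eq_bigr => f /eqP <-.
  by rewrite prod_frame_weight.
rewrite /product_state tensor_sum mulmx_sumr raddf_sum mulr_sumr.
apply: eq_big => [f|f _]; first by apply/esym/familyP.
by rewrite -scalemxAr /= mxtraceZ rmorphM /= frame_coefE mulrCA rmorph_prod.
Qed.

(** For |x| <= 1, 1 + x G is the convex combination of 1 + G and 1 - G with weights (1 + x)/2 and (1
    - x)/2, and both are Gram matrices. Expanding the tensor product yields a nonnegative
    combination of tensors of Gram matrices, to which [trace_gram_bound] applies term by term; the
    traces add up to that of the state. *)
Lemma product_state_bound x : (forall p, `|x p| <= 1) ->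
  Normc.normc (\tr (H *m product_state x)) <= opnorm H * (K ^ n)%:R.
Proof.
move=> x1.
pose E (q : label * bool) : 'M[C]_K :=
  if q.1 == (o0, false) then 1%:M else 1%:M + (-1) ^+ q.2 *: frame q.1.
have EB q : exists B : 'M[C]_K, E q = B *m B^t*.
  rewrite /E; case: eqP => [_|/eqP q0]; first by exists 1%:M; rewrite adjmx1 mulmx1.
  exact: (frame_gram HU).
have {EB} /choice[B EB] := EB.
pose w j (q : label * bool) : R :=
  if q.1 == (o0, false) then kappa / 2 else kappa * (1 + (-1) ^+ q.2 * x (j, q.1)) / 2.
have w0 j q : 0 <= w j q.
  rewrite /w; case: ifP => _; first by rewrite divr_ge0// ltW// kappa_gt0.
  rewrite divr_ge0// mulr_ge0 ?(ltW kappa_gt0)//.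
  have := x1 (j, q.1); rewrite ler_norml => /andP[? ?].
  by case: (q.2); rewrite ?expr0 ?expr1; lra.
have rhoE : product_state x = \sum_(g in family (fun (j : 'I_n) (q : label * bool) => true))
   ((\prod_j w j (g j))%:C : C) *: tensor (fun j => E (g j)).
  rewrite /product_state.
  rewrite (_ : (fun j => _) = fun j => \sum_(q : label * bool | true) (w j q)%:C *: E q).
    by rewrite tensor_sum; apply: eq_bigr => g _; rewrite rmorph_prod.
  apply/funext => j.
  rewrite -(pair_big_dep predT (fun _ => predT) (fun p e => (w j (p, e))%:C *: E (p, e))) /=.
  transitivity (\sum_p (kappa%:C *: 1%:M + if p == (o0, false) then 0 else (kappa * x (j, p))%:C *: frame p)).
    rewrite big_split /= sumr_const -scaler_nat scalerA.
    have -> : (#|{: label}|%:R : C) * kappa%:C = 1.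
      rewrite /kappa fmorphV rmorph_nat mulfV// pnatr_eq0 card_label -lt0n.
      by rewrite muln_gt0 expn_gt0 K_gt0.
    rewrite scale1r (bigD1 (o0, false))//= [X in _ = _ + X](bigD1 (o0, false))//= eqxx add0r.
    rewrite /frame_weight eqxx rmorph1 scale1r {1}/frame /= eqxx; congr (_ + _).
    by apply: eq_bigr => p /negbTE ->.
  apply: eq_bigr => p _; rewrite big_bool /=.
  have wE b : w j (p, b) =
      if p == (o0, false) then kappa / 2 else kappa * (1 + (-1) ^+ b * x (j, p)) / 2 by [].
  have EE b : E (p, b) = if p == (o0, false) then 1%:M else 1%:M + (-1) ^+ b *: frame p by [].
  rewrite !wE !EE; case: ifP => p0.
    by rewrite addr0 -scalerDl -rmorphD /=; congr (_%:C *: _); field.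
  rewrite expr0 expr1 scale1r scaleN1r scalerDr scalerDr scalerN addrACA -scalerDl -scaleNr -scalerDl.
  rewrite -rmorphD -rmorphN -rmorphD /=.
  by congr (_%:C *: _ + _%:C *: _); field.
have -> : (K ^ n)%:R = complex.Re (\tr (product_state x)).
  by rewrite trace_product_state -(rmorph_nat (real_complex R)).
have ReZ (c : R) (z : C) : complex.Re (c%:C * z) = c * complex.Re z.
  by case: z => u v /=; rewrite mul0r subr0.
have ReD (z z' : C) : complex.Re (z + z') = complex.Re z + complex.Re z'.
  by case: z; case: z'.
have -> : \tr (product_state x) = \sum_(g in family (fun (j : 'I_n) (q : label * bool) => true))
    \tr ((\prod_j w j (g j))%:C *: tensor (fun j => E (g j))) by rewrite rhoE raddf_sum.
rewrite rhoE mulmx_sumr raddf_sum /=; apply: le_trans (normc_le_sum _ _ _) _.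
rewrite (big_morph (@complex.Re R) ReD (erefl : complex.Re (0 : C) = 0)) mulr_sumr; apply: ler_sum => g _.
rewrite -scalemxAr !mxtraceZ Normc.normcM ReZ mulrCA.
rewrite normc_real ?prodr_ge0// ler_wpM2l ?prodr_ge0//.
have -> : tensor (fun j => E (g j)) =
    tensor (fun j : 'I_n => B (g j)) *m (tensor (fun j : 'I_n => B (g j)))^t*.
  by rewrite adj_tensor mul_tensor; congr tensor; apply/funext => j; exact: EB.
exact: trace_gram_bound.
Qed.

(** Each monomial carries the weight kappa^|S|, and those with |S| > d have coefficient 0; as kappa
    <= 1, the loss is at most kappa^d throughout. *)
Lemma lambda_le_walsh : kappa ^+ d * lambda U H <= \sum_S `|frame_walsh S|.
Proof.
have inj : injective frame_supp.
  move=> f g fg; apply/ffunP => j.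
  have fgj p : (p != (o0, false)) -> (f j == p) = (g j == p).
    by move=> p0; have := congr1 (fun S : {set _} => (j, p) \in S) fg; rewrite !finset.inE /= p0.
  have [fj|fj] := eqVneq (f j) (o0, false); last by apply/esym/eqP; rewrite -(fgj _ fj).
  have [gj|gj] := eqVneq (g j) (o0, false); first by rewrite fj gj.
  by apply/eqP; rewrite (fgj _ gj).
apply: (@le_trans _ _ (kappa ^+ d * \sum_f `|frame_coef f|)).
  rewrite ler_wpM2l ?exprn_ge0 ?(ltW kappa_gt0)//.
  apply: (@le_trans _ _ (\sum_b Normc.normc (coef U H b))).
    rewrite /lambda [leRHS](bigID (fun b => b \in supp U H)) /= lerDl.
    by apply: sumr_ge0 => b _; exact: normc_ge0.
  apply: le_trans (ler_sum _ (fun b _ => normc_coef_le b)) _.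
  rewrite (partition_big (fun f => [ffun j => (f j).1] : {ffun 'I_n -> 'I_(K ^ 2)}) xpredT)//=.
  apply: ler_sum => b _; rewrite le_eqVlt; apply/orP; left; apply/eqP; apply: eq_bigl => f.
  apply/familyP/eqP => [fb|<- j]; last by rewrite ffunE; apply/eqP.
  by apply/ffunP => j; rewrite ffunE; apply/eqP; exact: fb.
rewrite mulr_sumr [leLHS](partition_big frame_supp xpredT)//=; apply: ler_sum => S _.
rewrite /frame_walsh normrM ger0_norm ?exprn_ge0 ?(ltW kappa_gt0)//.
case: (pickP (fun f => frame_supp f == S)) => [f0 /eqP f0S|noS]; last first.
  by rewrite big_pred0// mulr_ge0 ?exprn_ge0 ?(ltW kappa_gt0).
have E : (fun f => frame_supp f == S) =1 pred1 f0.
  by move=> f; rewrite -f0S /= (inj_eq inj).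
rewrite !(eq_bigl _ _ E) !big_pred1_eq; have [dS|Sd] := ltnP d #|S|.
  by rewrite frame_coef_eq0 ?f0S// normr0 !mulr0.
by rewrite ler_wpM2r// ler_wiXn2l ?kappa_le1 ?(ltW kappa_gt0).
Qed.
End CoefficientBound.

Lemma sqrt_exprn_powR (R : realType) (x : R) (m : nat) : 0 <= x ->
  Num.sqrt (x ^+ m) = x `^ (m%:R / 2).
Proof.
move=> x0; rewrite powRrM powR_mulrn// -powR12_sqrt ?exprn_ge0// div1r.
Qed.

(** One factor 2 K^2 undoes [kappa ^+ d]; the other pays for the polynomial having 2 K^2 variables
    per site. *)
Definition local_const (R : realType) (K : nat) : R := sidon_const R * (2 * K ^ 2)%:R ^+ 2.

Lemma sidon_const_ge1 (R : realType) : 1 <= sidon_const R.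
Proof.
have e1 : 1 <= expR 1 :> R by rewrite -expR0 ler_expR.
by rewrite /sidon_const; move: (expR 1) e1 => e e1; nra.
Qed.

Lemma local_const_ge1 (R : realType) (K : nat) : (0 < K)%N -> 1 <= local_const R K.
Proof.
move=> K0; rewrite /local_const -[leLHS]mulr1 ler_pM ?sidon_const_ge1// exprn_ege1//.
by rewrite ler1n muln_gt0 expn_gt0 K0.
Qed.

Lemma lambda_bound (R : realType) (K : nat) (U : 'I_(K ^ 2) -> 'M[R[i]]_K) (n d : nat)
    (H : 'M[R[i]]_(sysdim K n)) :
  (0 < K)%N -> normalized_unitary_local_basis U -> (0 < d)%N -> (d <= n)%N ->
  H \is hermsymmx -> in_Hle d H ->
  lambda U H <= local_const R K ^+ d * (n%:R / d%:R) `^ ((d%:R - 1) / 2) * opnorm H.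
Proof.
move=> K0 HU d0 dn Hherm Hdeg.
have o0P : (0 < K ^ 2)%N by rewrite expn_gt0 K0.
pose o0 := Ordinal o0P; have o0E : o0 = 0%N :> nat by [].
have aE x := walsh_frame U o0 Hherm x.
set a := frame_walsh U o0 H.
have cardI : #|{: 'I_n * ('I_(K ^ 2) * bool)}| = (n * (2 * K ^ 2))%N.
  by rewrite card_prod card_ord card_label.
have K2 : (0 < 2 * K ^ 2)%N by rewrite muln_gt0.
have K2R : (1 : R) <= (2 * K ^ 2)%:R by rewrite ler1n.
have dR : (0 : R) < d%:R by rewrite ltr0n.
have := @walsh_sidon R _ d a (opnorm H) d0.
rewrite cardI => /(_ _ _ _) Sid.
have {Sid} : \sum_S `|a S| <= sidon_const R ^+ d *
    Num.sqrt (((n * (2 * K ^ 2))%:R / d%:R) ^+ d.-1) * opnorm H.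
  apply: Sid; first by rewrite (leq_trans dn)// leq_pmulr.
  - move=> S dS; rewrite /a /frame_walsh big1 ?mulr0// => f /eqP fS.
    by rewrite (frame_coef_eq0 K0 HU o0E Hdeg)// fS.
  move=> x x1; have -> : `|walsh a x| = Normc.normc (walsh a x)%:C.
    by rewrite /= expr0n addr0 sqrtr_sqr.
  rewrite aE Normc.normcM -(rmorph_nat (real_complex R)) -fmorphV normc_real ?invr_ge0//.
  rewrite mulrC ler_pdivrMr ?ltr0n ?expn_gt0 ?K0//.
  exact: product_state_bound.
move=> Sid; have := le_trans (lambda_le_walsh K0 HU o0E Hherm Hdeg) Sid.
rewrite /kappa card_label exprVn mulrC ler_pdivrMr ?exprn_gt0 ?ltr0n// => /le_trans; apply.
have -> : (n * (2 * K ^ 2))%:R / d%:R = (2 * K ^ 2)%:R * (n%:R / d%:R) :> R.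
  by rewrite natrM mulrAC mulrC.
have d1 : d%:R - 1 = d.-1%:R :> R by rewrite -[in LHS](prednK d0) -natr1 addrK.
rewrite d1 -sqrt_exprn_powR ?divr_ge0// [((2 * K ^ 2)%:R * _) ^+ _]exprMn sqrtrM ?exprn_ge0// /local_const.
set s := Num.sqrt ((_ / _) ^+ _); set k := (_ * _)%:R.
rewrite [leRHS](_ : _ = sidon_const R ^+ d * (k ^+ d * s) * opnorm H * k ^+ d); last first.
  by rewrite exprMn -exprM mulnC exprM expr2 -/k; ring.
rewrite ler_wpM2r ?exprn_ge0// ler_wpM2r ?opnorm_ge0// ler_wpM2l ?exprn_ge0//.
  by rewrite (le_trans ler01)// sidon_const_ge1.
rewrite ler_wpM2r ?sqrtr_ge0//.
apply: (@le_trans _ _ (k ^+ d.-1)); last by rewrite ler_weXn2l// leq_pred.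
rewrite -(@ler_sqr _ (Num.sqrt _)) ?nnegrE ?sqrtr_ge0 ?exprn_ge0// sqr_sqrtr ?exprn_ge0//.
by rewrite -exprM ler_weXn2l// leq_pmulr.
Qed.

(** * Exponentials of Hermitian matrices *)

Section ScalarExponential.
Variable R : realType.
Local Notation C := R[i].
Local Notation normc := Normc.normc.
Implicit Types (y tau r : R) (N M : nat).

(** This is exp(-i y), with the sign of the time evolution. *)
Definition expi y : C := cos y -i* sin y.

Definition expi_trunc N y : C := \sum_(k < N) (k`!%:R)^-1 * (0 -i* y) ^+ k.

Lemma complexD (a b c e : R) : (a +i* b) + (c +i* e) = (a + c) +i* (b + e).
Proof. by []. Qed.

Lemma expr_Niy y (m : nat) : (0 -i* y) ^+ m.*2 = ((-1) ^+ m * y ^+ m.*2)%:C.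
Proof.
rewrite -!muln2 mulnC !exprM -exprMn rmorphXn /=; congr (_ ^+ m).
by rewrite expr2; apply/eqP; rewrite eq_complex /=; apply/andP; split; apply/eqP; ring.
Qed.

Lemma expi_term y k :
  (k`!%:R)^-1 * (0 -i* y) ^+ k = cos_coeff y k -i* sin_coeff y k :> C.
Proof.
have -> : (k`!%:R)^-1 = ((k`!%:R : R)^-1)%:C by rewrite fmorphV rmorph_nat.
rewrite /cos_coeff /sin_coeff /= -{2}(odd_double_half k); case: (boolP (odd k)) => ok /=.
  rewrite add1n exprS expr_Niy -[in RHS](odd_double_half k) ok add1n /= doubleK.
  rewrite -[in (_`!)](odd_double_half k) ok add1n /=.
  by apply/eqP; rewrite eq_complex /= -!exprnP exprS; apply/andP; split; apply/eqP; ring.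
rewrite add0n expr_Niy -[in y ^+ k](odd_double_half k) (negbTE ok) add0n.
by apply/eqP; rewrite eq_complex /= -!exprnP; apply/andP; split; apply/eqP; ring.
Qed.

Lemma expi_truncE N y :
  expi_trunc N y = series (cos_coeff y) N -i* series (sin_coeff y) N.
Proof.
rewrite /expi_trunc /series /= !big_mkord.
elim: N => [|N IH]; first by rewrite !big_ord0 oppr0.
by rewrite !big_ord_recr /= IH expi_term complexD opprD.
Qed.

Lemma expi_trunc_cvg y :
  ((fun N => complex.Re (expi_trunc N y)) @ \oo --> cos y)%classic /\
  ((fun N => complex.Im (expi_trunc N y)) @ \oo --> - sin y)%classic.
Proof.
split.
  rewrite (_ : (fun _ => _) = series (cos_coeff y)); last by apply/funext => N; rewrite expi_truncE.
  by rewrite trigo.cos.unlock; exact: is_cvg_series_cos_coeff.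
rewrite (_ : (fun _ => _) = - series (sin_coeff y)); last by apply/funext => N; rewrite expi_truncE.
by apply: cvgN; rewrite trigo.sin.unlock; exact: is_cvg_series_sin_coeff.
Qed.

Lemma exp_series_le_expR (x : R) N : 0 <= x -> \sum_(k < N) x ^+ k / k`!%:R <= expR x.
Proof.
move=> x0; rewrite -(big_mkord xpredT (fun k => x ^+ k / k`!%:R)).
apply: (@nondecreasing_cvgn_le _ (series (exp_coeff x))).
  apply/nondecreasing_seqP => k; rewrite /series /= big_nat_recr//= lerDl.
  exact: exp_coeff_ge0.
exact: is_cvg_series_exp_coeff.
Qed.

(** Chernoff's argument: for k >= N, tau^k <= r^-N (r tau)^k. The parameter [r] stays free because
    the circuit proper uses r = e and the empty circuit r = 4 e. *)
Lemma exp_tail_le tau r N M : 0 <= tau -> 1 <= r ->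
  \sum_(N <= k < M) tau ^+ k / k`!%:R <= r ^- N * expR (r * tau).
Proof.
move=> tau0 r1; have r0 : 0 < r by rewrite (lt_le_trans ltr01).
apply: (@le_trans _ _ (r ^- N * \sum_(k < M) (r * tau) ^+ k / k`!%:R)); last first.
  by rewrite ler_wpM2l ?invr_ge0 ?exprn_ge0 ?(ltW r0)// exp_series_le_expR ?mulr_ge0 ?(ltW r0).
rewrite -(big_mkord xpredT (fun k => (r * tau) ^+ k / k`!%:R)) mulr_sumr.
apply: (@le_trans _ _ (\sum_(N <= k < M) r ^- N * ((r * tau) ^+ k / k`!%:R))).
  rewrite big_seq [leRHS]big_seq; apply: ler_sum => k; rewrite mem_index_iota => /andP[Nk _].
  rewrite [leRHS](_ : _ = r ^+ k / r ^+ N * (tau ^+ k / k`!%:R)); last by rewrite exprMn; ring.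
  rewrite ler_peMl ?divr_ge0 ?exprn_ge0//.
  by rewrite ler_pdivlMr ?exprn_gt0// mul1r ler_weXn2l.
have [NM|MN] := leqP N M; last first.
  rewrite [leLHS]big_geq ?(ltnW MN)//; apply: sumr_ge0 => k _.
  by rewrite mulr_ge0 ?invr_ge0 ?divr_ge0 ?exprn_ge0 ?mulr_ge0 ?(ltW r0).
rewrite (@big_cat_nat _ _ _ N 0 M)//= lerDr; apply: sumr_ge0 => k _.
by rewrite mulr_ge0 ?invr_ge0 ?divr_ge0 ?exprn_ge0 ?mulr_ge0 ?(ltW r0).
Qed.

Lemma normc_Re (z : C) : `|complex.Re z| <= normc z.
Proof. by rewrite -lecR normcC normc_ge_Re. Qed.

Lemma normc_Im (z : C) : `|complex.Im z| <= normc z.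
Proof.
by case: z => a b /=; rewrite -sqrtr_sqr ler_wsqrtr// lerDr sqr_ge0.
Qed.

Lemma normc_le_ReIm (z : C) : normc z <= `|complex.Re z| + `|complex.Im z|.
Proof.
case: z => a b /=; rewrite -(@ler_sqr _ (Num.sqrt _)) ?nnegrE ?sqrtr_ge0 ?addr_ge0//.
rewrite sqr_sqrtr ?addr_ge0 ?sqr_ge0// sqrrD !real_normK ?num_real//.
by rewrite addrAC lerDl mulrn_wge0// mulr_ge0.
Qed.

Lemma expi_trunc_tail y tau r N M : `|y| <= tau -> 1 <= r -> (N <= M)%N ->
  normc (expi_trunc M y - expi_trunc N y) <= r ^- N * expR (r * tau).
Proof.
move=> yt r1 NM; apply: le_trans (exp_tail_le N M (le_trans (normr_ge0 y) yt) r1).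
rewrite /expi_trunc -!(big_mkord xpredT (fun k => (k`!%:R)^-1 * (0 -i* y) ^+ k)).
rewrite (@big_cat_nat _ _ _ N 0 M)//= addrAC subrr add0r.
apply: le_trans (normc_le_sum _ _ _) _; apply: ler_sum => k _.
rewrite Normc.normcM mulrC -[(_%:R)^-1]/((k`!%:R : C)^-1).
have -> : normc (k`!%:R^-1 : C) = k`!%:R^-1.
  by rewrite -(rmorph_nat (real_complex R)) -fmorphV normc_real ?invr_ge0.
rewrite ler_wpM2r ?invr_ge0//.
have -> : normc ((0 -i* y) ^+ k) = `|y| ^+ k.
  elim: k => [|k IH]; first by rewrite !expr0 -Normc.normc1.
  by rewrite !exprS Normc.normcM IH /= sqrrN expr0n add0r sqrtr_sqr.
by rewrite lerXn2r ?nnegrE ?(le_trans (normr_ge0 y)).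
Qed.

Lemma cvg_dist_le (u : nat -> R) (l a T : R) N : (u @ \oo --> l)%classic ->
  (forall M, (N <= M)%N -> `|u M - a| <= T) -> `|l - a| <= T.
Proof.
move=> ul uT; have H : ((fun M => `|u M - a|) @ \oo --> `|l - a|)%classic.
  by apply: cvg_norm; apply: cvgB => //; exact: cvg_cst.
rewrite -(cvg_lim _ H)//; apply: limr_le; first by apply/cvg_ex; exists `|l - a|.
by exists N.
Qed.

(** The factor 2 comes from passing to the limit separately in the real and imaginary parts, as
    [expmx] does. *)
Lemma expi_trunc_dist y tau r N : `|y| <= tau -> 1 <= r ->
  normc (expi y - expi_trunc N y) <= 2 * (r ^- N * expR (r * tau)).
Proof.
move=> yt r1; apply: le_trans (normc_le_ReIm _) _; rewrite mulr2n mulrDl mul1r.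
have [cR cI] := expi_trunc_cvg y.
have ReB (a b : C) : complex.Re (a - b) = complex.Re a - complex.Re b by case: a; case: b.
have ImB (a b : C) : complex.Im (a - b) = complex.Im a - complex.Im b by case: a; case: b.
rewrite ReB ImB; apply: lerD.
  apply: (cvg_dist_le (N := N) cR) => M NM; rewrite -ReB.
  by apply: le_trans (normc_Re _) _; exact: expi_trunc_tail.
apply: (cvg_dist_le (N := N) cI) => M NM; rewrite -ImB.
by apply: le_trans (normc_Im _) _; exact: expi_trunc_tail.
Qed.

Lemma expi_mul_conj y : expi y * ((expi y)^* )%R = 1.
Proof.
rewrite -sqr_normc_conj /= sqr_sqrtr ?addr_ge0 ?sqr_ge0//.
by rewrite sqrrN cos2Dsin2.
Qed.

End ScalarExponential.

(** * Functional calculus and truncation of the matrix exponential *)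

Section MatrixExponential.
Variable R : realType.
Local Notation C := R[i].
Local Notation normc := Normc.normc.

Definition expmx_trunc m N (A : 'M[C]_m) : 'M[C]_m := \sum_(k < N) (k`!%:R)^-1 *: A ^+ k.

(** The functional calculus of a Hermitian matrix with eigenbasis [Q]: for [Q] unitary, products,
    powers, adjoints and norm bounds reduce to those of the scalars [z j]. *)
Definition conj_diag m (Q : 'M[C]_m) (z : 'I_m -> C) : 'M[C]_m :=
  Q^t* *m diag_mx (\row_j z j) *m Q.

Lemma conj_diag_mul m (Q : 'M[C]_m) (z w : 'I_m -> C) : Q \is unitarymx ->
  conj_diag Q z *m conj_diag Q w = conj_diag Q (fun j => z j * w j).
Proof.
move=> /unitarymxP QQ; rewrite /conj_diag -!mulmxA; congr (_ *m _).
rewrite [Q *m (Q^t* *m _)]mulmxA QQ mul1mx [LHS]mulmxA mulmx_diag; congr (diag_mx _ *m _).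
by apply/rowP => j; rewrite !mxE.
Qed.

Lemma conj_diagE m (Q : 'M[C]_m) (z : 'I_m -> C) i j :
  conj_diag Q z i j = \sum_l (Q^t* i l * Q l j) * z l.
Proof.
rewrite /conj_diag mxE; apply: eq_bigr => l _.
rewrite mul_mx_diag !mxE; ring.
Qed.

Lemma conj_diag1 m (Q : 'M[C]_m) : Q \is unitarymx -> conj_diag Q (fun=> 1) = 1%:M.
Proof.
move=> Qu; rewrite /conj_diag (_ : diag_mx _ = 1%:M) ?mulmx1 ?unitarymxC//.
by apply/matrixP => i j; rewrite !mxE.
Qed.

Lemma conj_diagX m (Q : 'M[C]_m) (z : 'I_m -> C) k : Q \is unitarymx ->
  conj_diag Q z ^+ k = conj_diag Q (fun j => z j ^+ k).
Proof.
move=> Qu; elim: k => [|k IH]; first by rewrite expr0; apply: esym; exact: conj_diag1.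
rewrite exprS IH; apply: etrans (conj_diag_mul _ _ Qu) _.
by congr conj_diag; apply/funext => j; rewrite exprS.
Qed.

Lemma conj_diagZ m (Q : 'M[C]_m) (z : 'I_m -> C) c :
  c *: conj_diag Q z = conj_diag Q (fun j => c * z j).
Proof.
apply/matrixP => i j; rewrite mxE !conj_diagE mulr_sumr.
by apply: eq_bigr => l _; rewrite mulrCA.
Qed.

Lemma conj_diag_sum m (Q : 'M[C]_m) N (z : 'I_N -> 'I_m -> C) :
  \sum_k conj_diag Q (z k) = conj_diag Q (fun j => \sum_k z k j).
Proof.
apply/matrixP => i j; rewrite summxE conj_diagE.
under eq_bigr do rewrite conj_diagE.
by rewrite exchange_big; apply: eq_bigr => l _; rewrite mulr_sumr.
Qed.

Lemma conj_diag_adj m (Q : 'M[C]_m) z :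
  (conj_diag Q z)^t* = conj_diag Q (fun j => ((z j)^* )%R).
Proof.
rewrite /conj_diag !adjmxM trmxCK mulmxA; congr (_ *m _ *m _).
by apply/matrixP => i j; rewrite !mxE rmorphMn eq_sym; case: eqP => [->|]; rewrite ?mulr1n ?mulr0n.
Qed.

Lemma conj_diag_unitary m (Q : 'M[C]_m) z : Q \is unitarymx ->
  (forall j, z j * ((z j)^* )%R = 1) -> conj_diag Q z \is unitarymx.
Proof.
move=> Qu z1; apply/unitarymxP; rewrite conj_diag_adj conj_diag_mul// -(conj_diag1 Qu).
by congr conj_diag; apply/funext.
Qed.

Lemma bnd_conj_diag m (Q : 'M[C]_m) z c : Q \is unitarymx -> 0 <= c ->
  (forall j, normc (z j) <= c) -> bnd (conj_diag Q z) c.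
Proof.
move=> Qu c0 zc; rewrite /conj_diag -mulmxA -[c]mul1r; apply: bndM => //.
  by apply: bnd_unitary; rewrite trmxC_unitary.
rewrite -[c]mulr1; apply: bndM => //; last exact: bnd_unitary.
move=> v; rewrite -(@ler_sqr _ (l2norm _)) ?nnegrE ?mulr_ge0 ?l2norm_ge0//.
rewrite exprMn !l2norm_sqr mulr_sumr; apply: ler_sum => j _.
by rewrite mul_diag_mx !mxE Normc.normcM exprMn ler_wpM2r ?sqr_ge0// lerXn2r ?nnegrE ?normc_ge0.
Qed.

Lemma conj_diag_eigen_bnd m (Q : 'M[C]_m) z c : Q \is unitarymx ->
  bnd (conj_diag Q z) c -> forall j, normc (z j) <= c.
Proof.
move=> Qu zc j; pose e : 'cV[C]_m := delta_mx j 0.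
have e1 : l2norm e = 1.
  apply/eqP; rewrite -(@eqrXn2 _ 2) ?l2norm_ge0// l2norm_sqr (bigD1 j)//= big1.
    by rewrite mxE !eqxx addr0 /= expr0n expr1n addr0 sqrtr1 expr1n.
  by move=> k kj; rewrite mxE (negbTE kj) Normc.normc0 expr0n.
have := zc (Q^t* *m e).
have Qi : Q *m Q^t* = 1%:M by apply/unitarymxP.
rewrite /conj_diag -!mulmxA [Q *m _]mulmxA Qi mul1mx.
rewrite !(@l2norm_isometry _ _ _ (Q^t*)) ?trmxCK// e1 mulr1; apply: le_trans.
rewrite (_ : diag_mx _ *m e = z j *: e); first by rewrite l2normZ e1 mulr1.
by rewrite /e mul_diag_mx; apply/matrixP => i k; rewrite !mxE; case: eqP => [->|]; rewrite ?mulr0.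
Qed.

Lemma hermitian_conj_diag m (H : 'M[C]_m) : H \is hermsymmx ->
  exists Q, exists h : 'I_m -> R, Q \is unitarymx /\ H = conj_diag Q (fun j => (h j)%:C).
Proof.
move=> Hh; exists (spectralmx H), (fun j => complex.Re (spectral_diag H 0 j)).
split; first exact: spectral_unitarymx.
have /orthomx_spectralP {1}-> := hermitian_normalmx Hh.
rewrite (invmx_unitary (spectral_unitarymx H)) /conj_diag.
congr (_ *m _); congr (_ *m _); congr diag_mx.
apply/rowP => j; rewrite mxE RRe_real//.
by have /mxOverP := hermitian_spectral_diag_real Hh.
Qed.

Lemma expmx_trunc_conj_diag m (Q : 'M[C]_m) (h : 'I_m -> R) N (t : R) : Q \is unitarymx ->
  expmx_trunc N ((0 -i* t) *: conj_diag Q (fun j => (h j)%:C)) =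
  conj_diag Q (fun j => expi_trunc N (t * h j)).
Proof.
move=> Qu; rewrite /expmx_trunc conj_diagZ.
under eq_bigr do rewrite conj_diagX// conj_diagZ.
rewrite conj_diag_sum; congr conj_diag; apply/funext => j; apply: eq_bigr => k _.
by congr (_ * _ ^+ k); apply/eqP; rewrite eq_complex /= !mul0r !mulr0 subr0 add0r mulNr !eqxx.
Qed.

Lemma cvg_sumr (I : Type) (s : seq I) (u : I -> nat -> R) (l : I -> R) :
  (forall i, (u i @ \oo --> l i)%classic) ->
  ((fun N => \sum_(i <- s) u i N) @ \oo --> \sum_(i <- s) l i)%classic.
Proof.
move=> ul; elim: s => [|a s IH].
  rewrite big_nil (_ : (fun _ => _) = cst 0); first exact: cvg_cst.
  by apply/funext => N; rewrite big_nil.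
rewrite big_cons (_ : (fun _ => _) = u a \+ (fun N => \sum_(i <- s) u i N)); first exact: cvgD.
by apply/funext => N; rewrite big_cons.
Qed.

Lemma evolution_conj_diag m (Q : 'M[C]_m) (h : 'I_m -> R) (t : R) : Q \is unitarymx ->
  evolution (conj_diag Q (fun j => (h j)%:C)) t = conj_diag Q (fun j => expi (t * h j)).
Proof.
move=> Qu; apply/matrixP => i j; rewrite /evolution /expmx mxE.
set X := _ *: _; have trE N := expmx_trunc_conj_diag h N t Qu.
rewrite -/X /expmx_trunc in trE; rewrite conj_diagE.
have ReM (a b : C) : complex.Re (a * b) = complex.Re a * complex.Re b - complex.Im a * complex.Im b.
  by case: a; case: b.
have ImM (a b : C) : complex.Im (a * b) = complex.Re a * complex.Im b + complex.Im a * complex.Re b.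
  by case: a; case: b.
have ReS (F : 'I_m -> C) : complex.Re (\sum_l F l) = \sum_l complex.Re (F l).
  by apply: (big_morph (@complex.Re R)) => //; case=> ? ?; case.
have ImS (F : 'I_m -> C) : complex.Im (\sum_l F l) = \sum_l complex.Im (F l).
  by apply: (big_morph (@complex.Im R)) => //; case=> ? ?; case.
have cZ (a l : R) (u : nat -> R) : (u @ \oo --> l)%classic -> ((fun N => a * u N) @ \oo --> a * l)%classic.
  by move=> ul; apply: (@cvgM _ _ _ _ (cst a) u _ _ (cvg_cst a) ul).
set S := \sum_l _; apply/eqP; rewrite eq_complex /=; apply/andP; split; apply/eqP; apply: cvg_lim => //.
  rewrite (_ : (fun N => _) = fun N => \sum_l (complex.Re (Q^t* i l * Q l j) * complex.Re (expi_trunc N (t * h l)) - complex.Im (Q^t* i l * Q l j) * complex.Im (expi_trunc N (t * h l)))); last first.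
    by apply/funext => N; rewrite trE conj_diagE ReS; apply: eq_bigr => l _; rewrite ReM.
  rewrite /S ReS; apply: cvg_sumr => l; move: (Q^t* i l * Q l j) => a; rewrite ReM.
  have [cR cI] := expi_trunc_cvg (t * h l).
  exact: (cvgB (cZ _ _ _ cR) (cZ _ _ _ cI)).
rewrite (_ : (fun N => _) = fun N => \sum_l (complex.Re (Q^t* i l * Q l j) * complex.Im (expi_trunc N (t * h l)) + complex.Im (Q^t* i l * Q l j) * complex.Re (expi_trunc N (t * h l)))); last first.
  by apply/funext => N; rewrite trE conj_diagE ImS; apply: eq_bigr => l _; rewrite ImM.
rewrite /S ImS; apply: cvg_sumr => l; move: (Q^t* i l * Q l j) => a; rewrite ImM.
have [cR cI] := expi_trunc_cvg (t * h l); exact: (cvgD (cZ _ _ _ cI) (cZ _ _ _ cR)).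
Qed.

Lemma evolution_unitary m (H : 'M[C]_m) t : H \is hermsymmx -> evolution H t \is unitarymx.
Proof.
move=> /hermitian_conj_diag[Q [h [Qu ->]]]; rewrite (evolution_conj_diag h t Qu).
by apply: (conj_diag_unitary Qu) => j; exact: expi_mul_conj.
Qed.

Lemma evolution_trunc_bnd m (H : 'M[C]_m) (t c tau r : R) N : H \is hermsymmx ->
  bnd H c -> `|t| * c <= tau -> 1 <= r ->
  bnd (evolution H t - expmx_trunc N ((0 -i* t) *: H)) (2 * (r ^- N * expR (r * tau))).
Proof.
move=> /hermitian_conj_diag[Q [h [Qu ->]]] Hc tc r1.
have hc := conj_diag_eigen_bnd Qu Hc.
rewrite (evolution_conj_diag h t Qu) (expmx_trunc_conj_diag _ _ _ Qu).
rewrite [X in bnd X _](_ : _ = conj_diag Q (fun j => expi (t * h j) - expi_trunc N (t * h j))); last first.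
  apply/matrixP => i j; rewrite mxE [in X in _ + X]mxE !conj_diagE -sumrB.
  by apply: eq_bigr => l _; rewrite mulrBr.
apply: bnd_conj_diag => //.
  by rewrite !mulr_ge0 ?invr_ge0 ?exprn_ge0 ?expR_ge0// (le_trans ler01).
move=> j; apply: expi_trunc_dist => //; apply: le_trans tc; rewrite normrM ler_wpM2l//.
by apply: le_trans (hc j); rewrite /= expr0n addr0 sqrtr_sqr.
Qed.

End MatrixExponential.

(** * The walk and its clock *)

Section Walk.
Variables (R : realType) (q N : nat).
Local Notation C := R[i].
Variables (G : 'M[C]_(q, N)) (Sw : 'M[C]_q).
Hypotheses (G_iso : G^t* *m G = 1%:M) (Sw_adj : Sw^t* = Sw) (Sw_inv : Sw *m Sw = 1%:M).

Definition reflection : 'M[C]_q := 2 *: (G *m G^t*) - 1%:M.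
Definition walk : 'M[C]_q := reflection *m Sw.
Definition walk_inv : 'M[C]_q := Sw *m reflection.
Definition encoded : 'M[C]_N := G^t* *m Sw *m G.

Lemma reflection_fix : G^t* *m reflection = G^t*.
Proof.
rewrite /reflection mulmxBr -scalemxAr mulmxA G_iso mul1mx mulmx1.
by rewrite scaler_nat mulr2n addrK.
Qed.

Lemma reflection_inv : reflection *m reflection = 1%:M.
Proof.
rewrite {1}/reflection mulmxBl -scalemxAl -mulmxA reflection_fix mul1mx.
by rewrite /reflection opprB addrC subrK.
Qed.

Lemma walkK : walk *m walk_inv = 1%:M.
Proof.
by rewrite /walk /walk_inv mulmxA -[_ *m Sw *m Sw]mulmxA Sw_inv mulmx1 reflection_inv.
Qed.

Lemma walk_invK : walk_inv *m walk = 1%:M.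
Proof. exact: mulmx1C walkK. Qed.

Lemma reflection_adj : reflection^t* = reflection.
Proof.
rewrite /reflection adjmxD adjmxN adjmx1 adjmxZ adjmxM trmxCK.
by congr (_ *: _ - _); rewrite rmorph_nat.
Qed.

Lemma walk_adj : walk^t* = walk_inv.
Proof. by rewrite /walk adjmxM Sw_adj reflection_adj. Qed.

Lemma walk_expK k : walk ^+ k *m walk_inv ^+ k = 1%:M.
Proof.
elim: k => [|k IH]; first by rewrite !expr0 mulmx1.
rewrite exprSr exprS -[_ * walk]/(_ *m walk) -[walk_inv * _]/(walk_inv *m _).
by rewrite mulmxA -[_ *m walk *m walk_inv]mulmxA walkK mulmx1.
Qed.

Lemma walk_exp_adj k : (walk_inv ^+ k *m G)^t* = G^t* *m walk ^+ k.
Proof.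
rewrite adjmxM; congr (_ *m _); elim: k => [|k IH]; first by rewrite !expr0 adjmx1.
rewrite exprS exprSr -[walk_inv * _]/(walk_inv *m _) adjmxM IH; congr (_ *m _).
by rewrite -walk_adj trmxCK.
Qed.

(** G^* absorbs the reflection R, so G^* W = G^* Sw, while W^-1 = Sw R gives G^* W^-1 = 2 x G^* -
    G^* Sw with x the encoded operator. The sum is 2 x G^*. *)
Lemma walk_recurrence k :
  G^t* *m walk ^+ k.+2 + G^t* *m walk ^+ k = 2 *: (encoded *m (G^t* *m walk ^+ k.+1)).
Proof.
have W2 : walk ^+ k.+2 = walk *m walk ^+ k.+1 by rewrite exprS.
have W0 : walk ^+ k = walk_inv *m walk ^+ k.+1.
  by rewrite exprS -[walk * _]/(walk *m _) mulmxA walk_invK mul1mx.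
rewrite W2 {1}W0 !mulmxA -mulmxDl scalemxAl; congr (_ *m _).
rewrite reflection_fix /encoded [in X in _ + X]/reflection.
by rewrite mulmxBr mulmx1 -scalemxAr !mulmxA addrC subrK.
Qed.

Definition path_mx L : 'M[C]_L :=
  \matrix_(k, j) (if (k.+1 == j :> nat) || (j.+1 == k :> nat) then 2^-1 else 0).

(* The Chebyshev recurrence turns multiplication by the encoded operator into
   the path matrix acting on the exponent of the walk. *)
Lemma path_mx_walk L (j : 'I_L) : (0 < j)%N -> (j.+1 < L)%N ->
  \sum_k path_mx L k j *: (G^t* *m walk ^+ k) = encoded *m (G^t* *m walk ^+ j).
Proof.
move=> j0 jL; have jpL : (j.-1 < L)%N by rewrite (leq_ltn_trans (leq_pred _)).
have jE : j = j.-1.+1 :> nat by rewrite prednK.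
rewrite (bigD1 (Ordinal jL))//= (bigD1 (Ordinal jpL))/=; last first.
  by rewrite -val_eqE /= jE; lia.
rewrite big1 ?addr0 => [|k /andP[kj kj']]; last first.
  rewrite mxE ifF ?scale0r//; apply/negbTE; move: kj kj'; rewrite -!val_eqE /=; lia.
rewrite !mxE /= eqxx orbT -jE eqxx /=.
rewrite -scalerDr {1 3}jE walk_recurrence scalerA mulVf ?scale1r ?pnatr_eq0//.
Qed.

(** Each power of the path matrix moves the exponent by one. The hypotheses keep every intermediate
    site where [path_mx_walk] is applied away from the two ends, which lack a neighbour. *)
Lemma path_mx_exp_walk L n (l : 'I_L) : (n <= l)%N -> (l + n < L)%N ->
  \sum_k (path_mx L ^+ n) k l *: (G^t* *m walk ^+ k) = encoded ^+ n *m (G^t* *m walk ^+ l).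
Proof.
elim: n l => [|n IH] l nl lL.
  rewrite !expr0 mul1mx (bigD1 l)//= big1 ?addr0; first by rewrite mxE eqxx scale1r.
  by move=> k /negbTE kl; rewrite mxE kl scale0r.
rewrite exprSr [encoded ^+ n.+1]exprSr.
transitivity (\sum_j path_mx L j l *: \sum_k (path_mx L ^+ n) k j *: (G^t* *m walk ^+ k)).
  under [RHS]eq_bigr do rewrite scaler_sumr.
  rewrite exchange_big; apply: eq_bigr => k _ /=.
  by rewrite mxE scaler_suml; apply: eq_bigr => j _; rewrite scalerA mulrC.
transitivity (\sum_j path_mx L j l *: (encoded ^+ n *m (G^t* *m walk ^+ j))).
  apply: eq_bigr => j _; rewrite mxE; case: ifP => [jl|_]; last by rewrite !scale0r.
  by rewrite IH//; move: jl; lia.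
under eq_bigr do rewrite scalemxAr.
rewrite -mulmx_sumr path_mx_walk ?mulmxA//; lia.
Qed.

(** The highest power in the truncated series is M - 1, hence the shift by one in the hypotheses. *)
Lemma path_mx_trunc_walk L M (c : C) (l : 'I_L) : (M <= l.+1)%N -> (l + M <= L)%N ->
  \sum_k (expmx_trunc M (c *: path_mx L)) k l *: (G^t* *m walk ^+ k) =
  expmx_trunc M (c *: encoded) *m (G^t* *m walk ^+ l).
Proof.
move=> Ml lM; rewrite /expmx_trunc mulmx_suml.
under eq_bigr do rewrite summxE scaler_suml.
rewrite exchange_big; apply: eq_bigr => n _ /=.
have scX m (A : 'M[C]_m) (k : nat) : (c *: A) ^+ k = c ^+ k *: A ^+ k.
  elim: k => [|k IH]; first by rewrite !expr0 scale1r.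
  rewrite !exprS IH -[(c *: A) * _]/((c *: A) *m _) -scalemxAl -scalemxAr scalerA.
  by [].
rewrite !scX !scalerA -scalemxAl -path_mx_exp_walk; first last.
- by have := ltn_ord n; lia.
- by have := ltn_ord n; lia.
by rewrite scaler_sumr; apply: eq_bigr => k _; rewrite scalerA [in LHS]mxE.
Qed.

Lemma path_mx_herm L : path_mx L \is hermsymmx.
Proof.
apply/is_hermitianmxP; rewrite expr0 scale1r; apply/matrixP => k j; rewrite !mxE orbC.
by case: ifP => _; rewrite ?rmorph0 //= fmorphV rmorph_nat.
Qed.

End Walk.

(** * Operators on the clock and on the register *)

Section ClockSpace.
Variables (R : realType) (l h : nat).
Local Notation C := R[i].
Local Notation clock := 'I_(2 ^ l).
Local Notation dim := (2 ^ l.+1 * h)%N.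
Implicit Types (u v : 'I_dim) (k : clock) (s : 'I_(h + h)).

(* A basis state of the ancillas and of a register of dimension h is a clock
   value, the qubit 0 (the parity) and a register state; the last two are
   merged into an index of the doubled register. *)
Lemma clock_of_subproof (z : 'I_(2 ^ l.+1)) : (z./2 < 2 ^ l)%N.
Proof. by have := ltn_ord z; have := expnS 2 l; lia. Qed.

Definition clock_of u : clock := Ordinal (clock_of_subproof (mxtens_unindex u).1).

Definition side_of (b : bool) (x : 'I_h) : 'I_(h + h) := if b then rshift h x else lshift h x.

Definition reg_of u : 'I_(h + h) := side_of (odd (mxtens_unindex u).1) (mxtens_unindex u).2.

Lemma side_of_inj b b' x x' : side_of b x = side_of b' x' -> b = b' /\ x = x'.
Proof.
move=> /(congr1 (@nat_of_ord _)); case: b b' => [] [] /= H; split => //; try (apply: val_inj => /=);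
  by have := ltn_ord x; have := ltn_ord x'; lia.
Qed.

Definition split_index u := (clock_of u, reg_of u).

Lemma split_index_bij : bijective split_index.
Proof.
apply: inj_card_bij => [u v uv|]; last by rewrite card_prod !card_ord expnS; lia.
have := congr1 snd uv; have /(congr1 (@nat_of_ord _)) := congr1 fst uv.
rewrite -[(split_index u).1]/(clock_of u) -[(split_index v).1]/(clock_of v).
have valE w : nat_of_ord (clock_of w) = ((mxtens_unindex w).1)./2 by [].
rewrite !valE -[(split_index u).2]/(reg_of u) -[(split_index v).2]/(reg_of v) /reg_of {uv}.
move: (mxtens_unindex u) (mxtens_unindex v) (mxtens_unindexK u) (mxtens_unindexK v).
move=> [z x] [z' x'] <- <- zz'.
move=> /side_of_inj[/= oz ->]; congr (mxtens_index (_, _)); apply: val_inj.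
by rewrite /= -[LHS]odd_double_half oz zz' odd_double_half.
Qed.

Lemma sum_split_index (F : clock -> 'I_(h + h) -> C) :
  \sum_u F (clock_of u) (reg_of u) = \sum_k \sum_s F k s.
Proof.
rewrite pair_bigA /= [RHS](reindex split_index) //=.
exact: onW_bij split_index_bij.
Qed.

Lemma sum_split_indexR (F : clock -> 'I_(h + h) -> R) :
  \sum_u F (clock_of u) (reg_of u) = \sum_k \sum_s F k s.
Proof.
rewrite pair_bigA /= [RHS](reindex split_index) //=.
exact: onW_bij split_index_bij.
Qed.

(** [dmx] acts on the doubled register under the control of the clock, [kmx] on the clock alone, and
    [pack] stacks one block per clock value. Blocks may have several columns, so that isometries
    from the system are treated like vectors; [dmx_pack], [kmx_pack] and [pack_adj_mul] then replace
    computations with indices. *)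
Definition dmx (A : clock -> 'M[C]_(h + h)) : 'M[C]_dim :=
  \matrix_(u, v) ((clock_of u == clock_of v)%:R * A (clock_of u) (reg_of u) (reg_of v)).

Definition kmx (M : 'M[C]_(2 ^ l)) : 'M[C]_dim :=
  \matrix_(u, v) (M (clock_of u) (clock_of v) * (reg_of u == reg_of v)%:R).

Definition pack p (Psi : clock -> 'M[C]_(h + h, p)) : 'M[C]_(dim, p) :=
  \matrix_(u, j) Psi (clock_of u) (reg_of u) j.

Lemma sum_delta (I : finType) (i : I) (F : I -> C) : \sum_j (i == j)%:R * F j = F i.
Proof.
rewrite (bigD1 i)//= eqxx mul1r big1 ?addr0// => j; rewrite eq_sym => /negbTE->.
by rewrite mul0r.
Qed.

Lemma dmx_pack p A (Psi : clock -> 'M[C]_(h + h, p)) :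
  dmx A *m pack Psi = pack (fun k => A k *m Psi k).
Proof.
apply/matrixP => u j; rewrite !mxE.
under eq_bigr do rewrite !mxE -mulrA.
rewrite (sum_split_index (fun k s => (clock_of u == k)%:R * (A (clock_of u) (reg_of u) s * Psi k s j))).
under eq_bigr do rewrite -mulr_sumr.
by rewrite sum_delta.
Qed.

Lemma kmx_pack p M (Psi : clock -> 'M[C]_(h + h, p)) :
  kmx M *m pack Psi = pack (fun k => \sum_k' M k k' *: Psi k').
Proof.
apply/matrixP => u j; rewrite !mxE summxE.
under eq_bigr do rewrite !mxE.
rewrite (sum_split_index (fun k s => M (clock_of u) k * (reg_of u == s)%:R * Psi k s j)).
apply: eq_bigr => k _; rewrite mxE; under eq_bigr do rewrite -mulrA.
by rewrite -mulr_sumr sum_delta.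
Qed.

Lemma pack_adj_mul p p' (Phi : clock -> 'M[C]_(h + h, p)) (Psi : clock -> 'M[C]_(h + h, p')) :
  (pack Phi)^t* *m pack Psi = \sum_k (Phi k)^t* *m Psi k.
Proof.
apply/matrixP => i j; rewrite !mxE summxE.
under eq_bigr do rewrite !mxE.
rewrite (sum_split_index (fun k s => ((Phi k s i)^* )%R * Psi k s j)).
by apply: eq_bigr => k _; rewrite mxE; apply: eq_bigr => s _; rewrite !mxE.
Qed.

Lemma pack_surj p (V : 'M[C]_(dim, p)) : exists Psi, V = pack Psi.
Proof.
have [f fK Kf] := split_index_bij.
exists (fun k => \matrix_(s, j) V (f (k, s)) j).
by apply/matrixP => u j; rewrite !mxE -[(_, _)]/(split_index u) fK.
Qed.

Lemma mulmx_inj_pack (A B : 'M[C]_dim) :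
  (forall Psi : clock -> 'M[C]_(h + h, dim), A *m pack Psi = B *m pack Psi) -> A = B.
Proof.
move=> AB; have [Psi P1] := pack_surj 1%:M.
by rewrite -[A]mulmx1 -[B]mulmx1 P1.
Qed.

Lemma pack_id p (Psi : clock -> 'M[C]_(h + h, p)) Phi : (forall k, Psi k = Phi k) -> pack Psi = pack Phi.
Proof. by move=> H; congr pack; apply/funext. Qed.

Lemma dmx_mul A B : dmx A *m dmx B = dmx (fun k => A k *m B k).
Proof.
apply: mulmx_inj_pack => Psi; rewrite -mulmxA !dmx_pack.
by apply: pack_id => k; rewrite mulmxA.
Qed.

Lemma dmx1 : dmx (fun=> 1%:M) = 1%:M.
Proof.
apply: mulmx_inj_pack => Psi; rewrite dmx_pack mul1mx.
by apply: pack_id => k; rewrite mul1mx.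
Qed.

Lemma kmx_mul M M' : kmx M *m kmx M' = kmx (M *m M').
Proof.
apply: mulmx_inj_pack => Psi; rewrite -mulmxA !kmx_pack; apply: pack_id => k.
under eq_bigr do rewrite scaler_sumr.
rewrite exchange_big; apply: eq_bigr => k' _ /=; rewrite mxE scaler_suml.
by apply: eq_bigr => k'' _; rewrite scalerA.
Qed.

Lemma kmx1 : kmx 1%:M = 1%:M.
Proof.
apply: mulmx_inj_pack => Psi; rewrite kmx_pack mul1mx; apply: pack_id => k.
rewrite (bigD1 k)//= big1 ?addr0; first by rewrite mxE eqxx scale1r.
by move=> k' /negbTE kk'; rewrite mxE eq_sym kk' scale0r.
Qed.

Lemma kmxB M M' : kmx M - kmx M' = kmx (M - M').
Proof. by apply/matrixP => u v; rewrite !mxE mulrBl. Qed.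

Lemma dmx_adj A : (dmx A)^t* = dmx (fun k => (A k)^t*).
Proof.
apply/matrixP => u v; rewrite !mxE rmorphM rmorph_nat eq_sym; case: eqP => [->//|].
by rewrite !mul0r.
Qed.

Lemma kmx_adj M : (kmx M)^t* = kmx (M^t*).
Proof. by apply/matrixP => u v; rewrite !mxE rmorphM rmorph_nat eq_sym. Qed.

Lemma dmx_unitary A : (forall k, A k \is unitarymx) -> dmx A \is unitarymx.
Proof.
move=> Au; apply/unitarymxP; rewrite dmx_adj dmx_mul -dmx1; congr dmx.
by apply/funext => k; apply/unitarymxP.
Qed.

Lemma kmx_unitary M : M \is unitarymx -> kmx M \is unitarymx.
Proof. by move=> /unitarymxP Mu; apply/unitarymxP; rewrite kmx_adj kmx_mul Mu kmx1. Qed.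

(** For each fixed register state the operator acts as [M] on the clock amplitudes, and squared
    norms add up over register states. *)
Lemma bnd_kmx M c : 0 <= c -> bnd M c -> bnd (kmx M) c.
Proof.
move=> c0 Mc v; have [Psi ->] := pack_surj v; rewrite kmx_pack.
rewrite -(@ler_sqr _ (l2norm _)) ?nnegrE ?mulr_ge0 ?l2norm_ge0//.
have normE (Phi : clock -> 'cV[C]_(h + h)) : l2norm (pack Phi) ^+ 2 =
    \sum_s l2norm (\col_k Phi k s 0) ^+ 2.
  rewrite l2norm_sqr; under eq_bigr do rewrite mxE.
  rewrite (sum_split_indexR (fun k s => Normc.normc (Phi k s 0) ^+ 2)) exchange_big.
  apply: eq_bigr => s _; rewrite l2norm_sqr; apply: eq_bigr => k _ /=; by rewrite mxE.
rewrite exprMn !normE mulr_sumr; apply: ler_sum => s _.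
rewrite -exprMn lerXn2r ?nnegrE ?mulr_ge0 ?l2norm_ge0//.
rewrite [X in l2norm X <= _](_ : _ = M *m \col_k Psi k s 0); first exact: Mc.
apply/matrixP => k j; rewrite !mxE ord1 summxE; apply: eq_bigr => k' _; by rewrite !mxE.
Qed.

End ClockSpace.

Lemma sum_deltaC (R : pzRingType) (I : finType) (i : I) (F : I -> R) :
  \sum_j F j * (j == i)%:R = F i.
Proof.
rewrite (bigD1 i)//= eqxx mulr1 big1 ?addr0// => j /negbTE->.
by rewrite mulr0.
Qed.

(** * Extending register operators to the system *)

Section Registers.
Variables (R : realType) (g N : nat).
Local Notation C := R[i].

Lemma sum_mxtens (F : 'I_g -> 'I_N -> C) :
  \sum_(i < g * N) F (mxtens_unindex i).1 (mxtens_unindex i).2 = \sum_x \sum_y F x y.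
Proof.
rewrite pair_bigA /= [RHS](reindex (@mxtens_unindex g N)) //=.
by exists (@mxtens_index g N) => ? _; [exact: mxtens_unindexK | exact: mxtens_indexK].
Qed.

(** The map psi |-> v (x) psi, with columns indexed by 'I_N rather than by 'I_(1 * N) as for
    [v *t 1%:M]. *)
Definition ketmx (v : 'cV[C]_g) : 'M[C]_(g * N, N) :=
  \matrix_(i, j) (v (mxtens_unindex i).1 0 * ((mxtens_unindex i).2 == j)%:R).

Lemma tensmx_ketmx (A : 'M[C]_g) v : (A *t 1%:M) *m ketmx v = ketmx (A *m v).
Proof.
apply/matrixP => i j; rewrite !mxE; under eq_bigr do rewrite !mxE.
rewrite (sum_mxtens (fun x y => A (mxtens_unindex i).1 x * ((mxtens_unindex i).2 == y)%:R * (v x 0 * (y == j)%:R))).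
rewrite mulr_suml; apply: eq_bigr => x _.

rewrite -(sum_deltaC j (fun y => A (mxtens_unindex i).1 x * v x 0 * ((mxtens_unindex i).2 == y)%:R)).
by apply: eq_bigr => y _; ring.
Qed.

Lemma ketmx_sandwich (A : 'M[C]_g) (B : 'M[C]_N) u v :
  (ketmx u)^t* *m (A *t B) *m ketmx v = ((u^t* *m A *m v) 0 0) *: B.
Proof.
apply/matrixP => i j; rewrite !mxE.
transitivity (\sum_x \sum_x' ((u x' 0)^* )%R * A x' x * v x 0 * B i j); last first.
  rewrite mulr_suml; apply: eq_bigr => x _; rewrite mxE !mulr_suml.
  by apply: eq_bigr => x' _; rewrite !mxE.
transitivity (\sum_x \sum_y (\sum_x' ((u x' 0)^* )%R * A x' x * B i y) * (v x 0 * (y == j)%:R)).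
  rewrite -(sum_mxtens (fun x y => (\sum_x' ((u x' 0)^* )%R * A x' x * B i y) * (v x 0 * (y == j)%:R))).
  apply: eq_bigr => w _; rewrite !mxE; congr (_ * _).
  under eq_bigr do rewrite !mxE rmorphM rmorph_nat.
  rewrite (sum_mxtens (fun x y => ((u x 0)^* )%R * (y == i)%:R * (A x (mxtens_unindex w).1 * B y (mxtens_unindex w).2))).
  apply: eq_bigr => x _.
  rewrite -(sum_deltaC i (fun y => ((u x 0)^* )%R * A x (mxtens_unindex w).1 * B y (mxtens_unindex w).2)).
  by apply: eq_bigr => y _; ring.
apply: eq_bigr => x _.
transitivity (\sum_x' ((u x' 0)^* )%R * A x' x * B i j * v x 0); last first.
  by apply: eq_bigr => x' _; ring.
rewrite -mulr_suml -(sum_deltaC j (fun y => (\sum_x' ((u x' 0)^* )%R * A x' x * B i y) * v x 0)).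
by apply: eq_bigr => y _; rewrite mulrA.
Qed.

Lemma ketmx_adj_mul u v : (ketmx u)^t* *m ketmx v = ((u^t* *m v) 0 0)%:M.
Proof.
rewrite -[ketmx v]mul1mx -(_ : 1%:M *t 1%:M = 1%:M) ?mulmxA ?ketmx_sandwich ?mulmx1 ?scalemx1//.
apply/matrixP => i j; rewrite !mxE -natrM mulnb -xpair_eqE.
rewrite -(can_eq (@mxtens_unindexK g N) i j).
by case: (mxtens_unindex i) => ? ?; case: (mxtens_unindex j).
Qed.

(** A (x) 1, taken block by block: the parity is kept outermost so that the result lives on g * N +
    g * N, where each half is the space of the oracles. *)
Definition lift_mx (A : 'M[C]_(g + g)) : 'M[C]_(g * N + g * N) :=
  block_mx (ulsubmx A *t 1%:M) (ursubmx A *t 1%:M) (dlsubmx A *t 1%:M) (drsubmx A *t 1%:M).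

Lemma lift_mxE A b b' x x' y y' :
  lift_mx A (side_of b (mxtens_index (x, y))) (side_of b' (mxtens_index (x', y'))) =
  A (side_of b x) (side_of b' x') * (y == y')%:R.
Proof.
rewrite /lift_mx; case: b; case: b'; rewrite /side_of.
- by rewrite block_mxEdr tensmxE !mxE.
- by rewrite block_mxEdl tensmxE !mxE.
- by rewrite block_mxEur tensmxE !mxE.
- by rewrite block_mxEul tensmxE !mxE.
Qed.

Lemma side_ofP h (s : 'I_(h + h)) : exists b x, s = side_of b x.
Proof.
by case: (split_ordP s) => x ->; [exists false, x | exists true, x].
Qed.

Definition lift_ket (e : 'cV[C]_(g + g)) : 'M[C]_(g * N + g * N, N) :=
  col_mx (ketmx (usubmx e)) (ketmx (dsubmx e)).

Lemma lift_ketE e b x y j :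
  lift_ket e (side_of b (mxtens_index (x, y))) j = e (side_of b x) 0 * (y == j)%:R.
Proof.
by rewrite /lift_ket; case: b; rewrite /side_of ?col_mxEu ?col_mxEd !mxE !mxtens_indexK.
Qed.

Lemma lift_mx_ext (A B : 'M[C]_(g * N + g * N)) :
  (forall b b' x x' y y',
    A (side_of b (mxtens_index (x, y))) (side_of b' (mxtens_index (x', y'))) =
    B (side_of b (mxtens_index (x, y))) (side_of b' (mxtens_index (x', y')))) -> A = B.
Proof.
move=> AB; apply/matrixP => s s'.
have [b [w ->]] := side_ofP s; have [b' [w' ->]] := side_ofP s'.
rewrite -[w]mxtens_unindexK -[w']mxtens_unindexK.
by case: (mxtens_unindex w) (mxtens_unindex w') => x y [x' y']; exact: AB.
Qed.

Lemma lift_mx1 : lift_mx 1%:M = 1%:M.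
Proof.
apply: lift_mx_ext => b b' x x' y y'; rewrite lift_mxE !mxE -natrM mulnb; congr (nat_of_bool _)%:R.
apply/andP/eqP => [[/eqP/side_of_inj[-> ->] /eqP->]//|/side_of_inj[->]].
by move/(can_inj (@mxtens_indexK g N)) => [-> ->]; rewrite !eqxx.
Qed.

(** A reflection about a known register state is thus a free gate; conjugated by PREPARE it becomes
    the reflection of the walk. *)
Lemma lift_mx_reflection e : lift_mx (reflection e) = reflection (lift_ket e).
Proof.
rewrite /reflection -lift_mx1; apply: lift_mx_ext => b b' x x' y y'.
have subE n (A B : 'M[C]_n) i j : (2 *: A - B) i j = 2 * A i j - B i j by rewrite !mxE.
have outE n p (f : 'M[C]_(n, p)) i j : (f *m f^t*) i j = \sum_k f i k * ((f j k)^* )%R.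
  by rewrite !mxE; apply: eq_bigr => k _; rewrite !mxE.
rewrite lift_mxE !subE !outE lift_mxE; under [in RHS]eq_bigr do rewrite !lift_ketE.
have -> : \sum_j e (side_of b x) 0 * (y == j)%:R * ((e (side_of b' x') 0 * (y' == j)%:R)^* )%R
   = e (side_of b x) 0 * ((e (side_of b' x') 0)^* )%R * (y == y')%:R.
  transitivity (\sum_j (y == j)%:R * (e (side_of b x) 0 * ((e (side_of b' x') 0)^* )%R * (y' == j)%:R)).
    by apply: eq_bigr => j _; rewrite rmorphM rmorph_nat; ring.
  by rewrite (sum_delta y) [y' == y]eq_sym.
rewrite big_ord_recl big_ord0 addr0; ring.
Qed.

End Registers.

(** * Circuits *)

Section CircuitAlgebra.
Variables (R : realType) (g N m : nat).
Local Notation C := R[i].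
Variables (P : 'M[C]_g) (S : 'M[C]_(g * N)).
Hypotheses (Pu : P \is unitarymx) (Su : S \is unitarymx).

(** Queries are defined on 2^m * (g * N) and free gates on (2^m * g) * N. All computations take
    place on the former, where the oracles are plain tensor factors. *)
Definition reassoc (A : 'M[C]_(2 ^ m * (g * N))) : 'M[C]_(2 ^ m * g * N) :=
  castmx (mulnA _ _ _, mulnA _ _ _) A.

Definition gates_mx (s : seq (gate R g m)) : 'M[C]_(2 ^ m * g * N) :=
  foldr (fun x W => gate_mx P S x *m W) 1%:M s.

Lemma gates_mx_cat s1 s2 : gates_mx (s1 ++ s2) = gates_mx s1 *m gates_mx s2.
Proof.
elim: s1 => [|x s1 IH] /=; first by rewrite mul1mx.
by rewrite IH mulmxA.
Qed.

Definition inv_gate (x : gate R g m) : gate R g m :=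
  match x with
  | Free V => Free (V^t*)
  | Query o b c => Query _ _ o (~~ b) c
  end.

Definition inv_gates (s : seq (gate R g m)) := rev (map inv_gate s).

Definition good_gate (x : gate R g m) : Prop := if x is Free V then V \is unitarymx else True.

Lemma castmx_mulmx n n' (e : n = n') (A B : 'M[C]_n) :
  castmx (e, e) A *m castmx (e, e) B = castmx (e, e) (A *m B).
Proof. by case: _ / e; rewrite !castmx_id. Qed.

Lemma castmx_unit n n' (e : n = n') : castmx (e, e) (1%:M : 'M[C]_n) = 1%:M.
Proof. by case: _ / e; rewrite castmx_id. Qed.

Lemma castmx_adj n n' (e : n = n') (A : 'M[C]_n) : (castmx (e, e) A)^t* = castmx (e, e) (A^t*).
Proof. by case: _ / e; rewrite !castmx_id. Qed.

Lemma reassoc_mul A B : reassoc A *m reassoc B = reassoc (A *m B).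
Proof. exact: castmx_mulmx. Qed.

Lemma reassoc1 : reassoc 1%:M = 1%:M.
Proof. exact: castmx_unit. Qed.

Lemma reassoc_adj A : (reassoc A)^t* = reassoc (A^t*).
Proof. exact: castmx_adj. Qed.

Lemma adj_tensmx a b c d (A : 'M[C]_(a, b)) (B : 'M[C]_(c, d)) :
  (A *t B)^t* = A^t* *t B^t*.
Proof. by apply/matrixP => i j; rewrite !mxE rmorphM. Qed.

Lemma tensmx_id a b : (1%:M : 'M[C]_a) *t (1%:M : 'M[C]_b) = 1%:M.
Proof.
apply/matrixP => i j; rewrite !mxE -natrM mulnb -(can_eq (@mxtens_unindexK a b) i j).
by rewrite -xpair_eqE; case: (mxtens_unindex i) => ? ?; case: (mxtens_unindex j).
Qed.

Lemma tensmx_unitary a b (A : 'M[C]_a) (B : 'M[C]_b) :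
  A \is unitarymx -> B \is unitarymx -> A *t B \is unitarymx.
Proof.
move=> /unitarymxP Au /unitarymxP Bu; apply/unitarymxP.
by rewrite adj_tensmx tensmx_mul Au Bu tensmx_id.
Qed.

Lemma unitary1 a : (1%:M : 'M[C]_a) \is unitarymx.
Proof. by apply/unitarymxP; rewrite adjmx1 mulmx1. Qed.

Lemma oracle_unitary o : oracle_mx P S o \is unitarymx.
Proof. by case: o => /=; [exact: (tensmx_unitary Pu (unitary1 N)) | exact: Su]. Qed.

Lemma qubit_proj_adj (c : 'I_m) : (qubit_proj c : 'M[C]_(2 ^ m))^t* = qubit_proj c.
Proof.
apply/matrixP => i j; rewrite !mxE rmorphMn rmorph_nat eq_sym; case: eqP => [->//|].
by rewrite !mulr0n.
Qed.

Lemma gate_mx_inv x : gate_mx P S (inv_gate x) = (gate_mx P S x)^t*.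
Proof.
case: x => [V|o b c] /=; first by rewrite adj_tensmx adjmx1.
have invE b' : (if b' then invmx (oracle_mx P S o) else oracle_mx P S o) =
    if b' then (oracle_mx P S o)^t* else oracle_mx P S o.
  by case: b' => //; rewrite invmx_unitary ?oracle_unitary.
rewrite castmx_adj /query_mx !invE; congr castmx; case: c => [c|].
  rewrite adjmxD !adj_tensmx adjmxD adjmxN !adjmx1 qubit_proj_adj.
  by case: b => //=; rewrite trmxCK.
by rewrite adj_tensmx adjmx1; case: b => //=; rewrite trmxCK.
Qed.

Lemma gates_mx_inv s : gates_mx (inv_gates s) = (gates_mx s)^t*.
Proof.
elim: s => [|x s IH]; first by rewrite /= adjmx1.
rewrite /inv_gates /= rev_cons -cats1 gates_mx_cat IH /= gate_mx_inv mulmx1.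
by rewrite adjmxM.
Qed.

Lemma queries_inv s : count (@is_query R g m) (inv_gates s) = count (@is_query R g m) s.
Proof.
by rewrite /inv_gates count_rev count_map; apply: eq_count; case.
Qed.
End CircuitAlgebra.

(** * Gates as operators on clock and register *)

Section ClockCircuits.
Variables (R : realType) (g N l : nat).
Local Notation C := R[i].
Local Notation m := l.+1.
Local Notation clock := 'I_(2 ^ l).
Local Notation re := (@reassoc R g N l.+1).
Implicit Types (A : clock -> 'M[C]_(g + g)).

Lemma unindex_assoc (i : 'I_(2 ^ m * g * N)) (j : 'I_(2 ^ m * (g * N))) : i = j :> nat ->
  mxtens_unindex j = ((mxtens_unindex (mxtens_unindex i).1).1,
    mxtens_index ((mxtens_unindex (mxtens_unindex i).1).2, (mxtens_unindex i).2)).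
Proof.
move=> ij; apply: (can_inj (@mxtens_indexK _ _)); rewrite mxtens_unindexK; apply: val_inj.
by rewrite /= -ij addnA mulnA -mulnDl -!divn_eq.
Qed.

Lemma reassocE (B : 'M[C]_(2 ^ m * (g * N))) i j :
  re B i j = B (cast_ord (esym (mulnA _ _ _)) i) (cast_ord (esym (mulnA _ _ _)) j).
Proof. by rewrite /reassoc castmxE. Qed.

Lemma clock_of_assoc (i : 'I_(2 ^ m * g * N)) :
  clock_of (cast_ord (esym (mulnA (2 ^ m)%N g N)) i) = clock_of (mxtens_unindex i).1.
Proof.
have valE h (w : 'I_(2 ^ m * h)) : nat_of_ord (clock_of w) = ((mxtens_unindex w).1)./2 by [].
by apply: val_inj; rewrite [LHS]valE (@unindex_assoc i).
Qed.

Lemma reg_of_assoc (i : 'I_(2 ^ m * g * N)) :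
  reg_of (cast_ord (esym (mulnA (2 ^ m)%N g N)) i) =
  side_of (odd (mxtens_unindex (mxtens_unindex i).1).1)
    (mxtens_index ((mxtens_unindex (mxtens_unindex i).1).2, (mxtens_unindex i).2)).
Proof. by rewrite /reg_of (@unindex_assoc i). Qed.

Lemma tensmxE' a b c d (A : 'M[C]_(a, b)) (B : 'M[C]_(c, d)) i j :
  (A *t B) i j = A (mxtens_unindex i).1 (mxtens_unindex j).1 * B (mxtens_unindex i).2 (mxtens_unindex j).2.
Proof. by rewrite mxE. Qed.

Lemma dmxE h (A : clock -> 'M[C]_(h + h)) (u v : 'I_(2 ^ m * h)) :
  dmx A u v = (clock_of u == clock_of v)%:R * A (clock_of u) (reg_of u) (reg_of v).
Proof. by rewrite mxE. Qed.

Lemma kmxE h M (u v : 'I_(2 ^ m * h)) : kmx h M u v = M (clock_of u) (clock_of v) * (reg_of u == reg_of v)%:R :> C.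
Proof. by rewrite mxE. Qed.

Lemma scalar1E h (i j : 'I_h) : (1%:M : 'M[C]_h) i j = (i == j)%:R.
Proof. by rewrite mxE. Qed.

Lemma gate_dmx (P : 'M[C]_g) (S : 'M[C]_(g * N)) A :
  gate_mx P S (Free (dmx A) : gate R g m) = re (dmx (fun k => lift_mx N (A k))).
Proof.
apply/matrixP => i j; rewrite reassocE [gate_mx _ _ _]/= tensmxE' !dmxE scalar1E.
by rewrite !clock_of_assoc !reg_of_assoc lift_mxE mulrA.
Qed.

Lemma gate_kmx (P : 'M[C]_g) (S : 'M[C]_(g * N)) M :
  gate_mx P S (Free (kmx g M) : gate R g m) = re (kmx (g * N) M).
Proof.
apply/matrixP => i j; rewrite reassocE [gate_mx _ _ _]/= tensmxE' !kmxE scalar1E !clock_of_assoc !reg_of_assoc -mulrA -natrM mulnb.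
congr (_ * (nat_of_bool _)%:R); rewrite /reg_of.
apply/andP/eqP => [[/eqP/side_of_inj[-> ->] /eqP->]//|/side_of_inj[->]].
by move/(can_inj (@mxtens_indexK g N))/eqP; rewrite xpair_eqE => /andP[/eqP-> ->]; rewrite eqxx.
Qed.

Lemma clock_side_tens h (u v : 'I_(2 ^ m * h)) :
  ((mxtens_unindex u).1 == (mxtens_unindex v).1) =
  (clock_of u == clock_of v) && (odd (mxtens_unindex u).1 == odd (mxtens_unindex v).1).
Proof.
have valE (w : 'I_(2 ^ m * h)) : nat_of_ord (clock_of w) = ((mxtens_unindex w).1)./2 by [].
apply/eqP/andP => [uv|[/eqP/(congr1 (@nat_of_ord _)) uv /eqP o]].
  by split; apply/eqP; [apply: val_inj; rewrite [LHS]valE [RHS]valE uv | rewrite uv].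
by apply: val_inj; rewrite -[LHS]odd_double_half -[RHS]odd_double_half o -!valE uv.
Qed.

Lemma tensmx_dmx h (Q : 'M[C]_h) : (1%:M : 'M[C]_(2 ^ m)) *t Q = dmx (fun=> block_mx Q 0 0 Q).
Proof.
apply/matrixP => u v; rewrite tensmxE' dmxE scalar1E clock_side_tens /reg_of /side_of.
case: eqP => _; rewrite /= ?mul0r // mul1r.
case: (odd _); case: (odd _); rewrite /= ?mul1r ?mul0r.
- by rewrite block_mxEdr.
- by rewrite block_mxEdl mxE.
- by rewrite block_mxEur mxE.
- by rewrite block_mxEul.
Qed.

(** Qubit 0 is the parity bit that [reg_of] merges into the register, so a query controlled by it is
    block diagonal on the doubled register. *)
Lemma control_dmx h (Q : 'M[C]_h) :
  (qubit_proj (ord0 : 'I_m) : 'M[C]_(2 ^ m)) *t Q + (1%:M - qubit_proj (ord0 : 'I_m)) *t 1%:M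
  = dmx (fun=> block_mx 1%:M 0 0 Q).
Proof.
apply/matrixP => u v; rewrite dmxE mxE !tensmxE' scalar1E.
have qE i j : (qubit_proj (ord0 : 'I_m) : 'M[C]_(2 ^ m)) i j = ((i == j) && odd i)%:R.
  by rewrite !mxE expn0 divn1; case: eqP => [->|] /=; rewrite ?mulr1n ?mulr0n.
have -> i j : (1%:M - qubit_proj (ord0 : 'I_m) : 'M[C]_(2 ^ m)) i j = ((i == j) && ~~ odd i)%:R.
  by rewrite mxE [in X in _ + X]mxE qE scalar1E; case: eqP => _; case: odd; rewrite ?subrr ?subr0.
rewrite qE clock_side_tens /reg_of /side_of.
case: eqP => _; rewrite /= ?mul0r ?addr0 // mul1r.
case: (odd _); case: (odd _); rewrite /= ?mul1r ?mul0r ?addr0 ?add0r.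
- by rewrite block_mxEdr.
- by rewrite block_mxEdl mxE.
- by rewrite block_mxEur mxE.
- by rewrite block_mxEul mxE.
Qed.

Variables (P : 'M[C]_g) (S : 'M[C]_(g * N)).
Hypotheses (Pu : P \is unitarymx) (Su : S \is unitarymx).

Definition prep2 : 'M[C]_(g * N + g * N) := block_mx (P *t 1%:M) 0 0 (P *t 1%:M).
Definition csel : 'M[C]_(g * N + g * N) := block_mx 1%:M 0 0 S.

Lemma adj_block a b c d (A : 'M[C]_(a, c)) (B : 'M[C]_(a, d)) (E : 'M[C]_(b, c)) (F : 'M[C]_(b, d)) :
  (block_mx A B E F)^t* = block_mx (A^t*) (E^t*) (B^t*) (F^t*).
Proof. by rewrite tr_block_mx map_block_mx. Qed.

Lemma adj0 a b : (0 : 'M[C]_(a, b))^t* = 0.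
Proof. by apply/matrixP => i j; rewrite !mxE rmorph0. Qed.

Lemma block_diag_unitary h (A B : 'M[C]_h) : A \is unitarymx -> B \is unitarymx ->
  block_mx A 0 0 B \is unitarymx.
Proof.
move=> /unitarymxP Au /unitarymxP Bu; apply/unitarymxP.
rewrite adj_block !adj0 mulmx_block !(mul0mx, mulmx0, addr0, add0r) Au Bu.
by rewrite -scalar_mx_block.
Qed.

Lemma prep2_unitary : prep2 \is unitarymx.
Proof. by apply: block_diag_unitary; exact: (tensmx_unitary Pu (unitary1 _ N)). Qed.

Lemma csel_unitary : csel \is unitarymx.
Proof. exact: block_diag_unitary (unitary1 _ _) Su. Qed.

Definition prepare_gate : gate R g m := Query R g Prepare false None.
Definition select_gate : gate R g m := Query R g Select false (Some ord0).

Lemma gate_prepare : gate_mx P S prepare_gate = re (dmx (fun=> prep2)).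
Proof. by rewrite /= tensmx_dmx. Qed.

Lemma gate_select : gate_mx P S select_gate = re (dmx (fun=> csel)).
Proof. by rewrite /= control_dmx. Qed.

Lemma gate_prepare_inv : gate_mx P S (inv_gate prepare_gate) = re (dmx (fun=> prep2^t*)).
Proof. by rewrite gate_mx_inv// gate_prepare reassoc_adj dmx_adj. Qed.

Lemma gate_select_inv : gate_mx P S (inv_gate select_gate) = re (dmx (fun=> csel^t*)).
Proof. by rewrite gate_mx_inv// gate_select reassoc_adj dmx_adj. Qed.

Definition swap_mx h : 'M[C]_(h + h) := block_mx 0 1%:M 1%:M 0.

Lemma lift_swap : lift_mx N (swap_mx g) = swap_mx (g * N).
Proof.
rewrite /lift_mx /swap_mx block_mxKul block_mxKur block_mxKdl block_mxKdr tensmx_id.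
by rewrite tens0mx.
Qed.

Lemma swap_unitary h : swap_mx h \is unitarymx.
Proof.
apply/unitarymxP; rewrite adj_block adj0 adjmx1 mulmx_block !(mul0mx, mulmx1, mulmx0, addr0, add0r).
by rewrite -scalar_mx_block.
Qed.

Lemma swap_adj h : (swap_mx h)^t* = swap_mx h.
Proof. by rewrite adj_block adj0 adjmx1. Qed.

Lemma tensmx_pack (v : 'cV[C]_(2 ^ l)) (e : 'cV[C]_(g + g)) :
  castmx (esym (mulnA (2 ^ m)%N g N), mul1n N) (pack (fun k => v k 0 *: e) *t 1%:M) =
  pack (fun k => v k 0 *: lift_ket N e).
Proof.
apply/matrixP => i j; rewrite castmxE tensmxE' scalar1E.
pose i' := cast_ord (mulnA (2 ^ m)%N g N) i.
rewrite (_ : cast_ord _ i = i'); last exact: val_inj.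
rewrite (_ : (mxtens_unindex (cast_ord _ j)).2 = j); last first.
  by apply: val_inj; rewrite /= modn_small.
rewrite (_ : i = cast_ord (esym (mulnA (2 ^ m)%N g N)) i'); last exact: val_inj.
rewrite [pack _ _ _]mxE [RHS]mxE [RHS]mxE [(_ *: e) _ _]mxE.
by rewrite clock_of_assoc reg_of_assoc lift_ketE mulrA !ord1.
Qed.

Lemma castmx_adjoint n1 n2 n3 n4 (e1 : n1 = n2) (e2 : n3 = n4) (X : 'M[C]_(n1, n3)) :
  (castmx (e1, e2) X)^t* = castmx (e2, e1) (X^t*).
Proof. by case: _ / e1; case: _ / e2; rewrite !castmx_id. Qed.

Lemma implemented_pack (v : 'cV[C]_(2 ^ l)) (e : 'cV[C]_(g + g)) (s : seq (gate R g m)) W :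
  gates_mx P S s = re W ->
  implemented P S (Circuit (pack (fun k => v k 0 *: e)) s) =
  (pack (fun k => v k 0 *: lift_ket N e))^t* *m W *m pack (fun k => v k 0 *: lift_ket N e).
Proof.
move=> sW; rewrite /implemented /= [circuit_mx _ _ _]sW /reassoc.
have sandwich n1 n2 n3 n4 (e1 : n2 = n1) (e2 : n4 = n3) (X : 'M[C]_(n4, n1)) (Z : 'M[C]_n2) (Y : 'M[C]_(n1, n4)) :
  castmx (e2, e2) (X *m castmx (e1, e1) Z *m Y) =
  castmx (e2, esym e1) X *m Z *m castmx (esym e1, e2) Y.
  by case: _ / e1 X Y; case: _ / e2 => X Y; rewrite !castmx_id.
rewrite sandwich -tensmx_pack; congr (_ *m _ *m _).
by rewrite castmx_adjoint adj_tensmx adjmx1.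
Qed.

Lemma gate_pack_proj (v : 'cV[C]_(2 ^ l)) (e : 'cV[C]_(g + g)) (a : C) :
  let phi := pack (fun k => v k 0 *: e) in
  let J := pack (fun k => v k 0 *: lift_ket N e) in
  gate_mx P S (Free (1%:M - a *: (phi *m phi^t*)) : gate R g m) = re (1%:M - a *: (J *m J^t*)).
Proof.
move=> phi J; rewrite /= /J -tensmx_pack -/phi castmx_adjoint adj_tensmx adjmx1.
have E n1 n2 n3 n4 (e1 : n2 = n1) (e2 : n3 = n4) (X : 'M[C]_(n1, n3)) (Y : 'M[C]_(n3, n1)) :
  castmx (e1, e1) (1%:M - a *: (castmx (esym e1, e2) X *m castmx (e2, esym e1) Y)) =
  1%:M - a *: (X *m Y).
  by case: _ / e1 X Y; case: _ / e2 => X Y; rewrite !castmx_id.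
have linE a1 b1 (X Y : 'M[C]_a1) (D : 'M[C]_b1) : (X - a *: Y) *t D = X *t D - a *: (Y *t D).
  by apply/matrixP => i j; rewrite !mxE; ring.
by rewrite /reassoc E tensmx_mul mulmx1 linE tensmx_id.
Qed.

Lemma gate_scalar (a : C) : gate_mx P S (Free a%:M : gate R g m) = re a%:M.
Proof.
have E n1 n2 (e1 : n2 = n1) : castmx (e1, e1) (a%:M : 'M[C]_n2) = a%:M.
  by case: _ / e1; rewrite castmx_id.
rewrite /= /reassoc E -[RHS]scalemx1 -(tensmx_id R (2 ^ m * g) N).
apply/matrixP => i j; rewrite [RHS]mxE !tensmxE' mulrA; congr (_ * _).
by rewrite !mxE -mulr_natr.
Qed.

End ClockCircuits.

(** * The circuit of the walk *)

Section WalkCircuit.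
Variables (R : realType) (g l : nat).
Local Notation C := R[i].
Local Notation m := l.+1.
Variable e0 : 'cV[C]_g.

Definition plus_state : 'cV[C]_(g + g) := (Num.sqrt 2^-1)%:C *: col_mx e0 e0.

(** Only the free gates are conditioned on the clock. For k <= j they are the identity and the
    queries around them cancel in pairs, so no oracle has to be controlled by the clock; for k > j
    the step is one power of the walk. The steps 0, ..., n - 1 together apply W^min(k, n). *)
Definition walk_step (j : nat) : seq (gate R g m) :=
  [:: prepare_gate R g l;
      Free (dmx (fun k : 'I_(2 ^ l) => if (j < k)%N then reflection plus_state else 1%:M));
      inv_gate (prepare_gate R g l);
      select_gate R g l;
      Free (dmx (fun k : 'I_(2 ^ l) => if (j < k)%N then swap_mx R g else 1%:M));
      inv_gate (select_gate R g l)].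

Fixpoint walk_steps (n : nat) : seq (gate R g m) :=
  if n is n'.+1 then walk_steps n' ++ walk_step n' else [::].

(* Clock value k undergoes W^(-k), then the clock evolves under M, then k
   undergoes W^k; T maps the initial clock state to the final one. *)
Definition lcu_gates (T M : 'M[C]_(2 ^ l)) : seq (gate R g m) :=
  [:: Free (kmx g T); inv_gate (prepare_gate R g l)] ++ walk_steps (2 ^ l) ++
  [:: Free (kmx g M)] ++ inv_gates (walk_steps (2 ^ l)) ++ [:: prepare_gate R g l].

(** With R the reflection about the fixed state, which is free, this is - B R B^* R B. The sign
    makes the amplified amplitude positive. *)
Definition amplified_gates (phi : 'cV[C]_(2 ^ m * g)) (s : seq (gate R g m)) : seq (gate R g m) :=
  Free ((-1)%:M) :: s ++ Free (1%:M - 2 *: (phi *m phi^t*)) :: inv_gates s ++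
  Free (1%:M - 2 *: (phi *m phi^t*)) :: s.

Lemma queries_walk_steps n : count (@is_query R g m) (walk_steps n) = (4 * n)%N.
Proof. by elim: n => //= n IH; rewrite count_cat IH /= mulnS addnC. Qed.

Lemma queries_lcu T M : count (@is_query R g m) (lcu_gates T M) = (8 * 2 ^ l + 2)%N.
Proof.
rewrite /lcu_gates !count_cat queries_inv queries_walk_steps /=; lia.
Qed.

Lemma queries_amplified phi s :
  count (@is_query R g m) (amplified_gates phi s) = (3 * count (@is_query R g m) s)%N.
Proof. by rewrite /amplified_gates /= !count_cat /= count_cat /= queries_inv; lia. Qed.

Fixpoint good_gates (s : seq (gate R g m)) : Prop :=
  if s is x :: s' then good_gate x /\ good_gates s' else True.

Lemma good_gates_cat s1 s2 : good_gates (s1 ++ s2) <-> good_gates s1 /\ good_gates s2.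
Proof. by elim: s1 => [|x s1 IH] /=; [tauto | rewrite IH; tauto]. Qed.

Lemma good_gates_inv s : good_gates s -> good_gates (inv_gates s).
Proof.
elim: s => [//|x s IH] [gx gs]; rewrite /inv_gates /= rev_cons -cats1.
apply/good_gates_cat; split; first exact: IH.
split; last by [].
case: x gx => [V|o c b] /=; last by [].
by rewrite trmxC_unitary.
Qed.

Lemma good_gates_onth s i V : good_gates s -> onth s i = Some (Free V) -> V \is unitarymx.
Proof.
elim: s i => [|x s IH] [|i] //= [gx gs]; last exact: IH.
by move=> [xV]; move: gx; rewrite xV.
Qed.

Hypothesis e0_unit : e0^t* *m e0 = 1%:M.

Lemma sqrt_half_sqr : (Num.sqrt 2^-1)%:C * (Num.sqrt 2^-1)%:C = 2^-1 :> C.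
Proof. by rewrite -rmorphM /= -expr2 sqr_sqrtr ?invr_ge0// fmorphV rmorph_nat. Qed.

Lemma conj_realC (x : R) : ((x%:C : C)^* )%R = x%:C.
Proof. exact: conjc_real. Qed.

Lemma scale_half_addmx a b (A : 'M[C]_(a, b)) : 2^-1 *: (A + A) = A.
Proof.
rewrite -[X in _ *: (X + X)]scale1r -scalerDl scalerA -(natrD _ 1 1).
by rewrite mulVf ?scale1r ?pnatr_eq0.
Qed.

Lemma plus_state_unit : plus_state^t* *m plus_state = 1%:M.
Proof.
rewrite /plus_state adjmxZ conj_realC -scalemxAl -scalemxAr scalerA sqrt_half_sqr.
by rewrite tr_col_mx map_row_mx mul_row_col e0_unit scale_half_addmx.
Qed.

Lemma reflection_unitary n p (G : 'M[C]_(n, p)) : G^t* *m G = 1%:M -> reflection G \is unitarymx.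
Proof. by move=> GG; apply/unitarymxP; rewrite reflection_adj reflection_inv. Qed.

Lemma good_walk_steps n : good_gates (walk_steps n).
Proof.
elim: n => //= n IH; apply/good_gates_cat; split => //=; do !split.
- apply: dmx_unitary => k; case: ifP => _; last exact: unitary1.
  exact: reflection_unitary plus_state_unit.
- apply: dmx_unitary => k; case: ifP => _; [exact: swap_unitary | exact: unitary1].
Qed.

Lemma good_lcu T M : T \is unitarymx -> M \is unitarymx -> good_gates (lcu_gates T M).
Proof.
move=> Tu Mu; rewrite /lcu_gates /=; split; first exact: kmx_unitary.
split=> //; apply/good_gates_cat; split; first exact: good_walk_steps.
split; first exact: kmx_unitary.
by apply/good_gates_cat; split => //; apply: good_gates_inv; exact: good_walk_steps.
Qed.

Lemma proj_reflection_unitary n (phi : 'cV[C]_n) : phi^t* *m phi = 1%:M ->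
  1%:M - 2 *: (phi *m phi^t*) \is unitarymx.
Proof.
move=> /reflection_unitary/unitarymxP; rewrite /reflection => H; apply/unitarymxP.
by rewrite -opprB adjmxN mulNmx mulmxN opprK.
Qed.

Lemma good_amplified phi s : phi^t* *m phi = 1%:M -> good_gates s -> good_gates (amplified_gates phi s).
Proof.
move=> phi1 gs; rewrite /amplified_gates /=; split.
  apply/unitarymxP; rewrite raddfN /=.
  by rewrite adjmxN adjmx1 mulNmx mul1mx opprK.
apply/good_gates_cat; split => //=; split; first exact: proj_reflection_unitary.
apply/good_gates_cat; split; first exact: good_gates_inv.
by split => //; exact: proj_reflection_unitary.
Qed.

Variable N : nat.
Variables (P : 'M[C]_g) (S : 'M[C]_(g * N)).
Hypotheses (Pu : P \is unitarymx) (Su : S \is unitarymx).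
Local Notation re := (@reassoc R g N m).

Definition prepared : 'M[C]_(g * N + g * N, N) := prep2 N P *m lift_ket N plus_state.
(* S need not be self-inverse; compressed to plus_state, this Hermitian
   involution is (S + S^* ) / 2. *)
Definition symm_select : 'M[C]_(g * N + g * N) :=
  csel S *m swap_mx R (g * N) *m (csel S)^t*.

Lemma lift_plus_unit : (lift_ket N plus_state)^t* *m lift_ket N plus_state = 1%:M.
Proof.
rewrite /lift_ket tr_col_mx map_row_mx mul_row_col !ketmx_adj_mul.
have /(congr1 (fun A : 'M[C]_1 => A 0 0)) := plus_state_unit.
rewrite -{1 2}[plus_state]vsubmxK tr_col_mx map_row_mx mul_row_col mxE => H.
by rewrite -raddfD /= H mxE.
Qed.

Lemma prepared_unit : prepared^t* *m prepared = 1%:M.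
Proof.
rewrite /prepared adjmxM mulmxA -[_ *m _ *m prep2 N P]mulmxA unitarymxC ?prep2_unitary//.
by rewrite mulmx1 lift_plus_unit.
Qed.

Lemma symm_select_adj : symm_select^t* = symm_select.
Proof. by rewrite /symm_select !adjmxM trmxCK swap_adj mulmxA. Qed.

Lemma symm_select_inv : symm_select *m symm_select = 1%:M.
Proof.
rewrite /symm_select !mulmxA -[_ *m (csel S)^t* *m csel S]mulmxA unitarymxC ?csel_unitary// mulmx1.
rewrite -[_ *m swap_mx R _ *m swap_mx R _]mulmxA.
have -> : swap_mx R (g * N) *m swap_mx R (g * N) = 1%:M.
  by rewrite -{2}swap_adj; apply/unitarymxP; exact: swap_unitary.
by rewrite mulmx1; apply/unitarymxP; exact: csel_unitary.
Qed.

Local Notation W := (walk prepared symm_select).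

Lemma gates_cons_dmx x s A B : gate_mx P S x = re (dmx A) -> gates_mx P S s = re (dmx B) ->
  gates_mx P S (x :: s) = re (dmx (fun k => A k *m B k)).
Proof.
have -> : gates_mx P S (x :: s) = gate_mx P S x *m gates_mx P S s by [].
by move=> -> ->; rewrite reassoc_mul dmx_mul.
Qed.

Lemma gates_walk_step j :
  gates_mx P S (walk_step j) = re (dmx (fun k => if (j < k)%N then W else 1%:M)).
Proof.
have nil_dmx : gates_mx P S ([::] : seq (gate R g m)) = re (dmx (fun=> 1%:M)).
  by rewrite dmx1 reassoc1.
transitivity (re (dmx (fun k => prep2 N P *m (lift_mx N (if (j < k)%N then reflection plus_state else 1%:M) *m
  ((prep2 N P)^t* *m (csel S *m (lift_mx N (if (j < k)%N then swap_mx R g else 1%:M) *m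
  ((csel S)^t* *m 1%:M)))))))).
  apply: gates_cons_dmx; first exact: gate_prepare.
  apply: gates_cons_dmx; first exact: gate_dmx.
  apply: gates_cons_dmx; first exact: gate_prepare_inv.
  apply: gates_cons_dmx; first exact: gate_select.
  apply: gates_cons_dmx; first exact: gate_dmx.
  by apply: gates_cons_dmx; first exact: gate_select_inv.
congr (re (dmx _)); apply: funext => k; case: ifP => _; last first.
  rewrite !lift_mx1 !(mul1mx, mulmx1) mulmxA.
  have /unitarymxP -> := csel_unitary Su.
  by rewrite mulmx1; apply/unitarymxP; exact: prep2_unitary.
rewrite lift_mx_reflection lift_swap.
rewrite mulmx1 /walk /symm_select !mulmxA.
do 3![congr (_ *m _)].
rewrite /reflection /prepared adjmxM mulmxBr mulmxBl mulmx1 -scalemxAr -scalemxAl !mulmxA.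
by have /unitarymxP -> := prep2_unitary N Pu.
Qed.

Lemma gates_walk_steps n :
  gates_mx P S (walk_steps n) = re (dmx (fun k => W ^+ minn k n)).
Proof.
elim: n => [|n IH] /=.
  rewrite (_ : dmx _ = 1%:M) ?reassoc1// -[RHS]dmx1; congr dmx.
rewrite gates_mx_cat IH gates_walk_step reassoc_mul dmx_mul; congr (re (dmx _)).
apply/funext => k; case: ltnP => nk.
  by rewrite (minn_idPr nk) exprSr.
by rewrite mulmx1 (minn_idPl (leqW nk)).
Qed.

Definition kets (v : 'cV[C]_(2 ^ l)) p (F : 'M[C]_(g * N + g * N, p)) :=
  pack (fun k : 'I_(2 ^ l) => v k 0 *: F).

Definition body_mx (T M : 'M[C]_(2 ^ l)) : 'M[C]_(2 ^ m * (g * N)) :=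
  kmx (g * N) T *m dmx (fun=> (prep2 N P)^t*) *m dmx (fun k => W ^+ k) *m
  kmx (g * N) M *m (dmx (fun k : 'I_(2 ^ l) => W ^+ k))^t* *m dmx (fun=> prep2 N P).

Lemma gates_lcu T M : gates_mx P S (lcu_gates T M) = re (body_mx T M).
Proof.
have prepE (s : seq (gate R g m)) : gates_mx P S (inv_gate (prepare_gate R g l) :: s) =
    re (dmx (fun=> (prep2 N P)^t*)) *m gates_mx P S s.
  by rewrite -(gate_prepare_inv l Pu Su).
have prep1 : gates_mx P S [:: prepare_gate R g l] = re (dmx (fun=> prep2 N P)).
  by rewrite -(gate_prepare l P S) /gates_mx /foldr mulmx1.
have freeE (M' : 'M[C]_(2 ^ l)) (s : seq (gate R g m)) :
    gates_mx P S (Free (kmx g M') :: s) = re (kmx (g * N) M') *m gates_mx P S s.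
  by rewrite -(gate_kmx P S).
rewrite /lcu_gates cat_cons freeE cat_cons prepE cat0s !gates_mx_cat prep1 freeE.
rewrite gates_mx_inv// gates_walk_steps mulmx1 reassoc_adj !reassoc_mul /body_mx !mulmxA.
have -> : (fun k : 'I_(2 ^ l) => W ^+ minn k (2 ^ l)) = (fun k => W ^+ k).
  by apply/funext => k; rewrite (minn_idPl (ltnW (ltn_ord k))).
by [].
Qed.

Lemma kets_adj_mul v w p (F : 'M[C]_(g * N + g * N, p)) : F^t* *m F = 1%:M ->
  (kets v F)^t* *m kets w F = ((v^t* *m w) 0 0)%:M.
Proof.
move=> FF; rewrite /kets pack_adj_mul mxE raddf_sum; apply: eq_bigr => k _ /=.
by rewrite adjmxZ -scalemxAl -scalemxAr FF scalerA scalemx1 !mxE.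
Qed.

Lemma dmx_kets v p (A : 'M[C]_(g * N + g * N)) (F : 'M[C]_(g * N + g * N, p)) :
  dmx (fun=> A) *m kets v F = kets v (A *m F).
Proof. by rewrite /kets dmx_pack; congr pack; apply/funext => k; rewrite scalemxAr. Qed.

Lemma kmx_kets v p T (F : 'M[C]_(g * N + g * N, p)) :
  kmx (g * N) T *m kets v F = kets (T *m v) F.
Proof.
rewrite /kets kmx_pack; congr pack; apply/funext => k; rewrite mxE scaler_suml.
by apply: eq_bigr => k' _; rewrite scalerA.
Qed.

Local Notation tau k := (prepared^t* *m W ^+ k).

Lemma tau_adj k : (tau k)^t* = (W ^+ k)^t* *m prepared.
Proof. by rewrite [LHS]adjmxM trmxCK. Qed.

(** The PREPARE gates turn [lift_ket N plus_state] into [prepared], and the compression becomes a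
    double sum of products tau k tau k'^* over final and initial clock values, into which [M] enters
    only through its scalar entries. Self-adjointness of [T] moves it onto the left-hand clock
    vector. *)
Lemma body_block v T M : T^t* = T ->
  (kets v (lift_ket N plus_state))^t* *m body_mx T M *m kets v (lift_ket N plus_state) =
  \sum_k (((T *m v) k 0)^* )%R *: (tau k *m \sum_k' (M k k' * v k' 0) *: (tau k')^t*).
Proof.
move=> Th; set J := kets _ _.
have JT : J^t* *m kmx (g * N) T *m dmx (fun=> (prep2 N P)^t*) *m dmx (fun k => W ^+ k) =
    (pack (fun k => (T *m v) k 0 *: (tau k)^t*))^t*.
  rewrite -[LHS]trmxCK; congr (_^t*).
  rewrite 3![in LHS]adjmxM trmxCK kmx_adj Th dmx_adj dmx_adj trmxCK kmx_kets.
  rewrite dmx_kets -/prepared /kets dmx_pack; congr pack.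
  by apply/funext => k; rewrite -scalemxAr tau_adj.
have MJ : kmx (g * N) M *m ((dmx (fun k : 'I_(2 ^ l) => W ^+ k))^t* *m (dmx (fun=> prep2 N P) *m J)) =
    pack (fun k => \sum_k' (M k k' * v k' 0) *: (tau k')^t*).
  rewrite dmx_kets -/prepared /kets dmx_adj dmx_pack kmx_pack; congr pack.
  apply/funext => k; apply: eq_bigr => k' _.
  by rewrite -scalemxAr scalerA tau_adj.
rewrite /body_mx !mulmxA JT -!mulmxA MJ pack_adj_mul; apply: eq_bigr => k _.
by rewrite adjmxZ trmxCK -scalemxAl.
Qed.

End WalkCircuit.

(** * Amplification and block encoding *)

Section Amplification.
Variables (R : realType).
Local Notation C := R[i].

Lemma reflected_product n (B X : 'M[C]_n) : B \is unitarymx ->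
  B *m ((1%:M - 2 *: X) *m (B^t* *m ((1%:M - 2 *: X) *m B))) =
  B - 2 *: (X *m B) - 2 *: (B *m X) + 4 *: (B *m X *m B^t* *m X *m B).
Proof.
move=> Bu; have BB : B *m B^t* = 1%:M by apply/unitarymxP.
have BB' : B^t* *m B = 1%:M by exact: unitarymxC.
have -> : (1%:M - 2 *: X) *m B = B - 2 *: (X *m B).
  by rewrite mulmxBl mul1mx scalemxAl.
have -> : B^t* *m (B - 2 *: (X *m B)) = 1%:M - 2 *: (B^t* *m X *m B).
  by rewrite mulmxBr BB' -scalemxAr mulmxA.
set Y := B^t* *m X *m B.
have BY : B *m Y = X *m B by rewrite /Y !mulmxA BB mul1mx.
have XY : B *m X *m B^t* *m X *m B = B *m (X *m Y) by rewrite /Y !mulmxA.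
rewrite XY; have -> : (1%:M - 2 *: X) *m (1%:M - 2 *: Y) =
    1%:M - 2 *: Y - 2 *: X + 4 *: (X *m Y).
  rewrite mulmxBl mul1mx mulmxBr mulmx1 -scalemxAl -scalemxAr.
  by move: (X *m Y) => Z; apply/matrixP => i j; rewrite !mxE; ring.
rewrite mulmxDr !mulmxBr mulmx1 -!scalemxAr BY.
by [].
Qed.

(** Since J^* absorbs the projection J J^* on the left and J on the right, the four terms of
    [reflected_product], with the global sign, compress to 2 A + 2 A - A - 4 A A^* A. *)
Lemma amplified_block n p (B : 'M[C]_n) (J : 'M[C]_(n, p)) :
  B \is unitarymx -> J^t* *m J = 1%:M ->
  let Rj := 1%:M - 2 *: (J *m J^t*) in
  let A := J^t* *m B *m J in
  J^t* *m ((-1)%:M *m (B *m (Rj *m (B^t* *m (Rj *m B))))) *m J =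
  3 *: A - 4 *: (A *m A^t* *m A).
Proof.
move=> Bu JJ Rj A; rewrite reflected_product//.
have Aadj : A^t* = J^t* *m B^t* *m J by rewrite /A !adjmxM trmxCK mulmxA.
set X := J *m J^t*.
have JX : J^t* *m X = J^t* by rewrite /X mulmxA JJ mul1mx.
have XJ : X *m J = J by rewrite /X -mulmxA JJ mulmx1.
have linE (M1 M2 M3 M4 : 'M[C]_n) :
    J^t* *m ((-1)%:M *m (M1 - 2 *: M2 - 2 *: M3 + 4 *: M4)) *m J =
    2 *: (J^t* *m M2 *m J) + 2 *: (J^t* *m M3 *m J) - J^t* *m M1 *m J - 4 *: (J^t* *m M4 *m J).
  rewrite mul_scalar_mx scaleN1r mulmxN mulNmx mulmxDr !mulmxBr mulmxDl !mulmxBl.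
  rewrite -!scalemxAr -!scalemxAl.
  move: (J^t* *m M1 *m J) (J^t* *m M2 *m J) (J^t* *m M3 *m J) (J^t* *m M4 *m J).
  by move=> N1 N2 N3 N4; apply/matrixP => i j; rewrite !mxE; ring.
rewrite linE [J^t* *m (X *m B)]mulmxA JX -/A.
rewrite [J^t* *m (B *m X)]mulmxA -[_ *m X *m J]mulmxA XJ -/A.
have -> : J^t* *m (B *m X *m B^t* *m X *m B) *m J = A *m A^t* *m A.
  by rewrite Aadj /A /X !mulmxA.
by move: (A *m A^t* *m A) (A) => Z A'; apply/matrixP => i j; rewrite !mxE; ring.
Qed.

Lemma telescope n (A V : 'M[C]_n) (E := A - V) :
  A *m A^t* *m A = E *m A^t* *m A + V *m E^t* *m A + V *m V^t* *m E + V *m V^t* *m V.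
Proof.
rewrite -addrA -mulmxDr [E + V]subrK.
rewrite -addrA -[V *m E^t* *m A + _]mulmxDl -mulmxDr -adjmxD [E + V]subrK.
by rewrite -[E *m _ *m A + _]mulmxDl -mulmxDl [E + V]subrK.
Qed.

(** The cubic map sends V/2 to V, because 3/2 - 4/8 = 1. Telescoping the cubic term, with norm
    bounds 1 for A and 1/2 for V/2, yields the constant 3 + 4 (1 + 1/2 + 1/4) = 10. *)
Lemma bnd_amplified n (A V : 'M[C]_n) delta : 0 <= delta -> bnd A 1 -> V \is unitarymx ->
  bnd (A - 2^-1 *: V) delta ->
  bnd (3 *: A - 4 *: (A *m A^t* *m A) - V) (10 * delta).
Proof.
move=> d0 A1 Vu Ed; set h := 2^-1 *: V in Ed.
have VV : V *m V^t* = 1%:M by apply/unitarymxP.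
have hV1 : bnd h 2^-1.
  have := bndZ 2^-1 (bnd_unitary Vu); rewrite mulr1 -[X in Normc.normc X](_ : (2^-1)%:C = _).
    by rewrite normc_real ?invr_ge0.
  by rewrite fmorphV rmorph_nat.
have hh : h *m h^t* *m h = 8^-1 *: V.
  rewrite /h adjmxZ conj_half -!scalemxAl -!scalemxAr -!scalemxAl VV mul1mx !scalerA.
  by congr (_ *: _); field.
have Ea := bnd_adj d0 Ed; have Aa := bnd_adj ler01 A1.
have half0 : 0 <= 2^-1 :> R by rewrite invr_ge0.
have ha := bnd_adj half0 hV1.
rewrite (telescope A h) /= hh; set E := A - h.
rewrite (_ : 3 *: A = 3 *: E + (3 / 2) *: V); last first.
  by rewrite /E /h; move: (A) (V) => A' V'; apply/matrixP => i j; rewrite !mxE; field.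
set T := E *m _ *m _ + _ + _.
rewrite (_ : _ - V = 3 *: E - 4 *: T); last first.
  by move: (E) T (V) => E' T V'; apply/matrixP => i j; rewrite !mxE; field.
have n3 (k : nat) : Normc.normc (k%:R : C) = k%:R.
  by rewrite -(rmorph_nat (real_complex R)) normc_real.
have b1 : bnd (E *m A^t* *m A) (delta * 1 * 1).
  by apply: bndM A1; [rewrite mulr1 | exact: (bndM d0 Ed Aa)].
have b2 : bnd (h *m E^t* *m A) (2^-1 * delta * 1).
  by apply: bndM A1; [rewrite mulr_ge0 | exact: (bndM half0 hV1 Ea)].
have b3 : bnd (h *m h^t* *m E) (2^-1 * 2^-1 * delta).
  by apply: bndM Ed; [rewrite mulr_ge0 | exact: (bndM half0 hV1 ha)].
have := bndB (bndZ 3 Ed) (bndZ 4 (bndD (bndD b1 b2) b3)); rewrite !n3.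
by apply: bnd_le; lra.
Qed.
End Amplification.

(** * The block encoding given by PREPARE and SELECT *)

Section Encoding.
Variables (R : realType) (K n : nat) (U : 'I_(K ^ 2) -> 'M[R[i]]_K).
Local Notation C := R[i].
Local Notation normc := Normc.normc.
Hypotheses (K_gt0 : (0 < K)%N) (HU : normalized_unitary_local_basis U).
Variable H : 'M[C]_(sysdim K n).
Local Notation g := #|supp U H|.

Lemma supp_coef (k : 'I_g) : coef U H (enum_val k) != 0.
Proof. by have := enum_valP k; rewrite finset.inE. Qed.

Lemma basis_expansion_supp :
  H = \sum_(k < g) coef U H (enum_val k) *: basis_tensor U (enum_val k).
Proof.
rewrite [LHS](basis_tensor_expansion HU) -(big_enum_val (fun b => coef U H b *: basis_tensor U b)).
rewrite [RHS]big_mkcond; apply: eq_bigr => b _; rewrite finset.inE.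
by case: eqP => //= ->; rewrite scale0r.
Qed.

Lemma phased_unitary (k : 'I_g) : phased U H (enum_val k) \is unitarymx.
Proof.
apply/unitarymxP; rewrite /phased adjmxZ -scalemxAl -scalemxAr scalerA.
have /unitarymxP -> := basis_tensor_unitary HU (enum_val k).
rewrite rmorphM fmorphV /= mulrACA -normCK -invfM.
have -> : `|coef U H (enum_val k)| * (`|coef U H (enum_val k)|^* )%R = `|coef U H (enum_val k)| ^+ 2.
  by rewrite -normCK normr_id.
by rewrite divff ?scale1r// expf_neq0// normr_eq0 supp_coef.
Qed.

Lemma delta_mul_tens (j k : 'I_g) (A B : 'M[C]_(sysdim K n)) :
  (delta_mx j j *t A) *m (delta_mx k k *t B) = (j == k)%:R *: (delta_mx j j *t (A *m B)).
Proof.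
rewrite tensmx_mul mul_delta_mx_cond; case: eqP => [->|_]; rewrite ?scale1r ?mulr1n//.
by rewrite mulr0n scale0r tens0mx.
Qed.

Lemma select_unitary : select U H \is unitarymx.
Proof.
apply/unitarymxP; rewrite /select.
have -> : (\sum_(k < g) (delta_mx k k *t phased U H (enum_val k)))^t* =
    \sum_(k < g) (delta_mx k k *t (phased U H (enum_val k))^t*).
  rewrite raddf_sum /= map_mx_sum; apply: eq_bigr => k _.
  rewrite [LHS]adj_tensmx; congr (_ *t _).
  by apply/matrixP => i j; rewrite !mxE rmorph_nat andbC.
rewrite mulmx_suml.
transitivity (\sum_(k < g) ((delta_mx k k : 'M[C]_g) *t (1%:M : 'M[C]_(sysdim K n)))).
  apply: eq_bigr => k _; rewrite mulmx_sumr (bigD1 k)//= big1 ?addr0.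
    rewrite delta_mul_tens eqxx scale1r; congr (_ *t _).
    by apply/unitarymxP; exact: phased_unitary.
  by move=> j /negbTE jk; rewrite delta_mul_tens eq_sym jk scale0r.
rewrite -tensmx_id; apply/matrixP => i j; rewrite summxE.
under eq_bigr do rewrite tensmxE'.
rewrite -mulr_suml tensmxE'; congr (_ * _).
by rewrite mx1_sum_delta summxE.
Qed.

Lemma lambda_ge0 : 0 <= lambda U H.
Proof. by apply: sumr_ge0 => b _; exact: normc_ge0. Qed.

Hypothesis H_neq0 : H != 0.

Lemma lambda_gt0 : 0 < lambda U H.
Proof.
rewrite lt_def lambda_ge0 andbT; apply: contra_neq H_neq0 => l0.
rewrite basis_expansion_supp big1// => k _.
have : lambda U H == 0 by rewrite l0.
rewrite /lambda psumr_eq0; last by move=> b _; exact: normc_ge0.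
move=> /allP /(_ (enum_val k) (mem_index_enum _)); rewrite enum_valP /= => /eqP/Normc.eq0_normc.
by move=> ->; rewrite scale0r.
Qed.

Hypothesis H_herm : H \is hermsymmx.
Variables (e0 : 'cV[C]_g) (P : 'M[C]_g).
Hypothesis HP : is_prepare e0 P.

(** Between prepared states SELECT compresses to sum_b (|h_b| / lambda) V_b = H / lambda. As H is
    Hermitian, the adjoint of SELECT compresses to the same matrix, so the symmetrised involution
    encodes H / lambda as well. *)
Lemma prepared_encodes : encoded (prepared e0 (sysdim K n) P) (symm_select (select U H)) = (lambda U H)^-1%:C *: H.
Proof.
have [Pu Pe] := HP; set S := select U H; set r2 : C := (Num.sqrt 2^-1)%:C.
pose Kt := ketmx (sysdim K n) (r2 *: (P *m e0)).
have GE : prepared e0 (sysdim K n) P = col_mx Kt Kt.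
  rewrite /prepared /prep2 /lift_ket /plus_state scale_col_mx col_mxKu col_mxKd.
  by rewrite mul_block_col !mul0mx addr0 add0r !tensmx_ketmx -scalemxAr.
have KSK : Kt^t* *m S *m Kt = 2^-1 *: ((lambda U H)^-1%:C *: H).
  rewrite /S /select mulmx_sumr mulmx_suml [X in _ = _ *: (_ *: X)]basis_expansion_supp !scaler_sumr.
  apply: eq_bigr => k _; rewrite ketmx_sandwich /phased !scalerA; congr (_ *: _).
  set c := coef U H (enum_val k); set v := r2 *: _.
  have -> : (v^t* *m delta_mx k k *m v) 0 0 = ((v k 0)^* )%R * v k 0.
    rewrite -(mul_delta_mx (0 : 'I_1)) mulmxA -mulmxA -colE -rowE mxE big_ord_recl big_ord0 addr0 [col k _ _ _]mxE [row k _ _ _]mxE.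
    by rewrite [(_^t*) _ _]mxE [(_^T) _ _]mxE.
  rewrite /v Pe !mxE rmorphM /= !conj_realC.
  have -> : r2 * (Num.sqrt (normc c / lambda U H))%:C * (r2 * (Num.sqrt (normc c / lambda U H))%:C)
     = 2^-1 * ((lambda U H)^-1%:C * `|c|).
    rewrite mulrACA sqrt_half_sqr -rmorphM /= -expr2 sqr_sqrtr ?divr_ge0 ?normc_ge0 ?lambda_ge0//.
    by rewrite rmorphM /= normcC; congr (_ * _); rewrite mulrC.
  have c0 : `|c| != 0 by rewrite normr_eq0 supp_coef.
  by move: (`|c|) c0 (_^-1%:C) => a a0 L; field.
have YH : (Kt^t* *m S *m Kt)^t* = Kt^t* *m S *m Kt.
  rewrite KSK !adjmxZ conj_half conj_realC; congr (_ *: (_ *: _)); exact: hermsymmx_adj.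
rewrite /encoded GE /symm_select /csel /swap_mx adj_block !adj0 adjmx1.
rewrite !mulmx_block !(mul0mx, mulmx0, mul1mx, mulmx1, addr0, add0r).
rewrite tr_col_mx map_row_mx mul_row_block mul_row_col !(mulmx0, addr0, add0r).
have -> : Kt^t* *m S^t* *m Kt = (Kt^t* *m S *m Kt)^t* by rewrite !adjmxM trmxCK mulmxA.
by rewrite YH KSK -scalerDr scale_half_addmx.
Qed.
End Encoding.

(** * The protocol *)

Section Windows.
Variables (R : realType) (p : nat).
Local Notation C := R[i].
Local Notation L := (2 ^ p.+2)%N.
Local Notation D := (2 ^ p)%N.

Definition amplitude : R := (Num.sqrt D%:R)^-1.

(* The clock starts uniform on [D, 2D) and is projected onto the uniform state
   on [0, 4D); their overlap 1/2 is the amplitude that a single round of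
   amplification turns into 1. *)
Definition window : 'cV[C]_L := \col_k (if (k %/ D == 1)%N then amplitude%:C else 0).
Definition flat : 'cV[C]_L := const_mx (amplitude / 2)%:C.

Lemma sum_window (x : C) : \sum_(k < L) (if (k %/ D == 1)%N then x else 0) = D%:R * x.
Proof.
have D0 : (0 < D)%N by rewrite expn_gt0.
have LE : L = (D + (D + (D + D)))%N by rewrite !expnS; lia.
rewrite -(big_mkord xpredT (fun k => if (k %/ D == 1)%N then x else 0)) LE.
rewrite (@big_cat_nat _ _ _ D)//= ?leq_addr// [X in X + _]big_nat_cond.
rewrite [X in X + _]big1 ?add0r => [|k /andP[/andP[_ kD] _]]; last by rewrite divn_small.
rewrite (@big_cat_nat _ _ _ (D + D))//= ?leq_addr ?leq_add2l ?leq_addr//.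
rewrite [X in _ + X]big_nat_cond [X in _ + X]big1 ?addr0 => [|k /andP[/andP[kD _] _]]; last first.
  by rewrite ifF//; apply/negbTE; rewrite neq_ltn orbC leq_divRL// mulSn mul1n kD.
rewrite big_nat_cond (eq_bigr (fun=> x)) => [|k /andP[/andP[kD kDD] _]]; last first.
  by rewrite ifT// eqn_leq leq_divRL// mul1n kD andbT -ltnS ltn_divLR// mulSn mul1n.
by rewrite -big_nat_cond sumr_const_nat addnK mulr_natl.
Qed.

Lemma amplitude_sqr : D%:R * (amplitude%:C * amplitude%:C) = 1 :> C.
Proof.
rewrite -rmorphM /= -expr2 exprVn sqr_sqrtr// fmorphV rmorph_nat mulfV//.
Qed.

Lemma half_amplitude : (amplitude / 2)%:C = amplitude%:C * 2^-1 :> C.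
Proof. by rewrite rmorphM /= [X in _ * X]fmorphV rmorph_nat. Qed.

Lemma window_window : window^t* *m window = 1%:M.
Proof.
apply/matrixP => i j; rewrite !ord1 !mxE -amplitude_sqr -sum_window.
by apply: eq_bigr => k _; rewrite !mxE; case: ifP; rewrite ?rmorph0 ?mulr0// conj_realC.
Qed.

Lemma flat_window : flat^t* *m window = (2^-1)%:M.
Proof.
apply/matrixP => i j; rewrite !ord1 !mxE eqxx mulr1n.
have -> : 2^-1 = D%:R * (amplitude%:C * amplitude%:C) * 2^-1 :> C by rewrite amplitude_sqr mul1r.
rewrite -mulrA -sum_window.
apply: eq_bigr => k _; rewrite !mxE conj_realC; case: ifP; rewrite ?mulr0//.
by rewrite half_amplitude mulrAC.
Qed.

Lemma flat_flat : flat^t* *m flat = 1%:M.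
Proof.
apply/matrixP => i j; rewrite !ord1 !mxE -amplitude_sqr eqxx mulr1n.
rewrite (eq_bigr (fun=> (amplitude%:C * amplitude%:C) * 4^-1)) => [|k _]; last first.
  by rewrite !mxE conj_realC half_amplitude; field.
have LE : L%:R = 4 * D%:R :> C by rewrite !expnS mulnA natrM.
by rewrite sumr_const card_ord -[LHS]mulr_natr LE; field.
Qed.

(** The Householder reflection that exchanges [window] and [flat]. Its axis [flat - window] is a
    unit vector without rescaling because the overlap of the two unit vectors is 1/2. *)
Definition exchange : 'M[C]_L := 1%:M - 2 *: ((flat - window) *m (flat - window)^t*).

Lemma window_flat : window^t* *m flat = (2^-1)%:M.
Proof.
rewrite -[LHS]trmxCK adjmxM trmxCK flat_window -scalemx1 adjmxZ conj_half adjmx1.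
by [].
Qed.

Lemma diff_unit : (flat - window)^t* *m (flat - window) = 1%:M.
Proof.
rewrite adjmxD adjmxN mulmxBr !mulmxBl flat_flat window_window flat_window window_flat.
by apply/matrixP => i j; rewrite !ord1 !mxE eqxx !mulr1n; field.
Qed.

Lemma exchange_unitary : exchange \is unitarymx.
Proof. exact: proj_reflection_unitary diff_unit. Qed.

Lemma exchange_adj : exchange^t* = exchange.
Proof.
by rewrite /exchange -opprB adjmxN -/(reflection _) reflection_adj.
Qed.

Lemma exchange_window : exchange *m window = flat.
Proof.
have dw : (flat - window)^t* *m window = (- 2^-1)%:M.
  rewrite adjmxD adjmxN mulmxBl flat_window window_window.
  by apply/matrixP => i j; rewrite !ord1 !mxE eqxx !mulr1n; field.
rewrite /exchange mulmxBl mul1mx -scalemxAl -mulmxA dw mul_mx_scalar scalerA.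
rewrite (_ : 2 * _ = -1); last by field.
by rewrite scaleN1r opprK addrC subrK.
Qed.
End Windows.

(** * The norm of the path matrix *)

Section PathBound.
Variable R : realType.
Local Notation C := R[i].

(** The matrix of a partial injection, such as the shift on a path, which drops an end point: every
    coordinate of the vector is used at most once. *)
Lemma bnd_subperm a b (A : 'M[C]_(a, b)) (f : 'I_a -> option 'I_b) :
  (forall i j, A i j = (f i == Some j)%:R) ->
  (forall i i' j, f i = Some j -> f i' = Some j -> i = i') -> bnd A 1.
Proof.
move=> AE finj v; rewrite mul1r -(@ler_sqr _ (l2norm (A *m v))) ?nnegrE ?l2norm_ge0//.
rewrite !l2norm_sqr.
have AvE i : Normc.normc ((A *m v) i 0) ^+ 2 = \sum_(j | f i == Some j) Normc.normc (v j 0) ^+ 2.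
  rewrite mxE; case fi: (f i) => [j|]; last first.
    rewrite big1 ?Normc.normc0 ?expr0n ?big_pred0// => j _; by rewrite AE fi mul0r.
  rewrite (bigD1 j)//= big1 ?addr0 => [|j' jj']; last first.
    by rewrite AE fi (_ : Some j == Some j' = false) ?mul0r//; apply/eqP => -[jj]; rewrite jj eqxx in jj'.
  rewrite AE fi eqxx mul1r (eq_bigl (pred1 j)) ?big_pred1_eq//.
under eq_bigr do rewrite AvE.
rewrite (exchange_big_dep xpredT)//=; apply: ler_sum => j _.
case: (pickP (fun i => f i == Some j)) => [i0 /eqP fi0|none]; last first.
  by rewrite big_pred0 ?sqr_ge0.
rewrite (eq_bigl (pred1 i0)) ?big_pred1_eq// => i /=.
by apply/eqP/eqP => [fi|->//]; exact: finj fi fi0.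
Qed.

Lemma bnd_path_mx L : bnd (path_mx R L) 1.
Proof.
pose Sh : 'M[C]_L := \matrix_(k, j) (k.+1 == j :> nat)%:R.
have ShB : bnd Sh 1.
  apply: (@bnd_subperm _ _ _ (fun k : 'I_L => insub k.+1)) => [i j|i i' j].
    rewrite mxE; congr (nat_of_bool _)%:R; case: insubP => [k _ kE|iL] /=.
      by rewrite -kE; apply/eqP/eqP => [/val_inj->|[->]].
    by apply/negbTE; apply: contraNneq iL => ->; exact: ltn_ord.
  case: insubP => //= k _ ik [kj]; case: insubP => //= k' _ ik' [k'j].
  by apply: val_inj; apply: succn_inj; rewrite -[LHS]ik -[RHS]ik' kj k'j.
have normc_half : Normc.normc (2^-1 : C) = 2^-1.
  rewrite (_ : 2^-1 = (2^-1)%:C); last by rewrite fmorphV rmorph_nat.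
  by rewrite normc_real ?invr_ge0.
have half2 : 2^-1 * (1 + 1) = 1 :> R by field.
have -> : path_mx R L = 2^-1 *: (Sh + Sh^t*).
  apply/matrixP => k j; rewrite !mxE rmorph_nat.
  have [e|] := eqVneq k.+1 j; have [e'|] := eqVneq j.+1 k; rewrite ?addr0 ?add0r ?mulr1 ?mulr0//=.
  by move: e e'; lia.
have := bndZ 2^-1 (bndD ShB (bnd_adj ler01 ShB)).
by rewrite normc_half half2.
Qed.
End PathBound.

(** * The circuit and its number of queries *)

Section Protocol.
Variable R : realType.
Local Notation C := R[i].

(* The order M at which 30 exp(e lam t - M) falls below eps. *)
Definition cutoff (lam t eps : R) : nat :=
  (Num.truncn (expR 1 * (lam * t) + ln (30 / eps))).+1.

Definition clock_exp (lam t eps : R) : nat := up_log 2 (cutoff lam t eps).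

Definition initial_state (g p : nat) (e0 : 'cV[C]_g) : 'cV[C]_(2 ^ p.+3 * g) :=
  pack (fun k : 'I_(2 ^ p.+2) => window R p k 0 *: plus_state e0).

Definition clock_evolution (p : nat) (s : R) : 'M[C]_(2 ^ p.+2) :=
  evolution (path_mx R (2 ^ p.+2)) s.

(* In the first case the empty circuit is accurate enough, while lam t + ln (1/eps)
   may be too small to pay for a single query. *)
Definition simulation : protocol R := fun g e0 lam t eps =>
  let p := clock_exp lam t eps in
  @Circuit R g p.+3 (initial_state p e0)
    (if (lam * t * (4 * expR 1) <= 1) && (2^-1 <= eps) then [::]
     else amplified_gates (initial_state p e0)
            (lcu_gates e0 (exchange R p) (clock_evolution p (lam * t)))).

Lemma initial_state_unit g p (e0 : 'cV[C]_g) : e0^t* *m e0 = 1%:M ->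
  (initial_state p e0)^t* *m initial_state p e0 = 1%:M.
Proof.
move=> e01; rewrite /initial_state pack_adj_mul.
have := window_window R p => /(congr1 (fun A : 'M[C]_1 => A 0 0)); rewrite !mxE => w1.
rewrite -[RHS]scale1r -[X in _ = X *: _]w1 scaler_suml; apply: eq_bigr => k _.
by rewrite adjmxZ -scalemxAl -scalemxAr plus_state_unit// scalerA !mxE.
Qed.

Lemma simulation_well_formed g (e0 : 'cV[C]_g) lam t eps : e0^t* *m e0 = 1%:M ->
  well_formed (simulation e0 lam t eps).
Proof.
move=> e01; have phi1 := initial_state_unit (clock_exp lam t eps) e01.
split => /=.
  apply/eqP; rewrite -(@eqrXn2 _ 2) ?l2norm_ge0//; apply/eqP/complexI.
  by rewrite l2norm_sqrC phi1 mxE expr1n.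
case: ifP => _ i V; first by case: i.
apply: good_gates_onth; apply: good_amplified => //; apply: good_lcu => //.
  exact: exchange_unitary.
by apply: evolution_unitary; exact: path_mx_herm.
Qed.

Lemma cutoff_gt lam t eps : expR 1 * (lam * t) + ln (30 / eps) < (cutoff lam t eps)%:R.
Proof. exact: truncnS_gt. Qed.

Lemma cutoff_le lam t eps : 0 <= expR 1 * (lam * t) + ln (30 / eps) ->
  (cutoff lam t eps)%:R <= expR 1 * (lam * t) + ln (30 / eps) + 1.
Proof. by move=> /truncn_itv/andP[h _]; rewrite /cutoff -natr1 lerD2r. Qed.

Lemma clock_exp_bounds lam t eps (M := cutoff lam t eps) (p := clock_exp lam t eps) :
  (M <= 2 ^ p)%N /\ (2 ^ p <= 2 * M)%N.
Proof.
split; first exact: up_logP.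
rewrite /p /clock_exp -/M; have [M1|M1] := leqP M 1.
  by rewrite (_ : M = 1%N) ?up_log1//; apply/eqP; rewrite eqn_leq M1.
have := @up_log_gtn 2 M isT M1; have := up_log_gt0 2 M; rewrite M1 /=.
by case: up_log => // k _ /=; rewrite expnS leq_pmul2l// => /ltnW.
Qed.

(** With M the cutoff and 2^p <= 2 M, the circuit makes 3 (8 . 2^(p+2) + 2) <= 192 M + 6 queries.
    The constant k = 4 e + 1 / ln 2 satisfies 1 <= k (lam t + ln (1 / eps)) unless the circuit is
    empty, and so pays for the additive terms ln 30 + 1 and 6; 384 is 192 doubled, with some
    slack. *)
Definition query_const : R :=
  384 * (expR 1 + (ln 30 + 1) * (4 * expR 1 + (ln 2)^-1)) + 6 * (4 * expR 1 + (ln 2)^-1).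

Lemma ln2_gt0 : 0 < ln 2 :> R. Proof. by rewrite ln_gt0// ltr1n. Qed.

Lemma ln30_gt0 : 0 < ln 30 :> R. Proof. by rewrite ln_gt0// ltr1n. Qed.

Lemma query_const_gt0 : 0 < query_const.
Proof.
have := ln2_gt0; have := ln30_gt0; have := expR_gt0 (1 : R) => e0 l3 l2.
have i2 : 0 < (ln 2)^-1 :> R by rewrite invr_gt0.
rewrite /query_const; move: (expR 1) (ln 30) ((ln 2)^-1) e0 l3 i2 => e a b e0 a0 b0.
have f0 : 0 < 4 * e + b by rewrite addr_gt0 ?mulr_gt0.
have g0 : 0 < a + 1 by rewrite addr_gt0.
apply: addr_gt0; last exact: mulr_gt0 (ltr0Sn _ _) f0.
exact: mulr_gt0 (ltr0Sn _ _) (addr_gt0 e0 (mulr_gt0 g0 f0)).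
Qed.

Lemma simulation_queries g (e0 : 'cV[C]_g) lam t eps : 0 <= lam * t -> 0 < eps -> eps < 1 ->
  (queries (simulation e0 lam t eps))%:R <= query_const * (lam * t + ln (1 / eps)).
Proof.
have lin1 (a b c d e f : R) : a <= b -> c <= d -> e <= b -> 1 <= f ->
  a + (c + e) + 1 <= 2 * b + (d + f) by move=> ? ? ? ?; lra.
have lin2 (a b c d : R) : a <= b + c -> 0 <= c -> 1 <= d ->
  192 * a + 6 <= 192 * (b + c) + 192 * c + 6 * d by move=> ? ? ?; lra.
move=> s0 eps0 eps1; set s := lam * t in s0 *.
have le0 : 0 <= ln (1 / eps) by rewrite ln_ge0// ler_pdivlMr// mul1r ltW.
have qc := query_const_gt0; have l2 := ln2_gt0; have l30 := ln30_gt0.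
have e0' := expR_gt0 (1 : R).
rewrite /simulation /queries /=; case: ifP => [_|triv].
  by apply: mulr_ge0; [exact: ltW | exact: addr_ge0].
rewrite queries_amplified queries_lcu.
have [_ pM] := clock_exp_bounds lam t eps.
set M := cutoff lam t eps in pM; set p := clock_exp lam t eps in pM *.
have lnE : ln (30 / eps) = ln 30 + ln (1 / eps).
  by rewrite -lnM ?posrE ?divr_gt0// mul1r.
have M_le : M%:R <= expR 1 * s + ln (30 / eps) + 1.
  apply: cutoff_le; rewrite lnE; have : 0 <= expR 1 * s by rewrite mulr_ge0// ltW.
  by move=> es0; apply: addr_ge0 => //; apply: addr_ge0 => //; exact: ltW.
have qM : (3 * (8 * 2 ^ p.+2 + 2))%:R <= 192 * M%:R + 6 :> R.
  rewrite -[192]/(192%:R) -[6]/(6%:R) -natrM -natrD ler_nat !expnS.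
  by move: (2 ^ p)%N (M) pM => a b; clear; lia.
apply: (le_trans qM).
set y := s + ln (1 / eps).
have y0 : 0 <= y by rewrite addr_ge0.
pose k := 4 * expR 1 + (ln 2)^-1 : R.
have k0 : 0 < k by rewrite addr_gt0 ?invr_gt0// mulr_gt0.
have ky : 1 <= k * y.
  have b0 : 0 <= (ln 2)^-1 :> R by rewrite invr_ge0 ltW.
  have -> : k * y = 4 * expR 1 * s + 4 * expR 1 * ln (1 / eps) + (ln 2)^-1 * s + (ln 2)^-1 * ln (1 / eps).
    by rewrite /k /y; move: (s) (ln (1 / eps)) (expR 1) ((ln 2)^-1) => s1 l1 a1 b1; ring.
  have e4 : 0 <= 4 * expR 1 :> R by apply: mulr_ge0 => //; exact: expR_ge0.
  have p1 : 0 <= 4 * expR 1 * s by apply: mulr_ge0.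
  have p2 : 0 <= 4 * expR 1 * ln (1 / eps) by apply: mulr_ge0.
  have p3 : 0 <= (ln 2)^-1 * s by apply: mulr_ge0.
  have p4 : 0 <= (ln 2)^-1 * ln (1 / eps) by apply: mulr_ge0.
  (* When the circuit is not empty, either 4 e lam t > 1 or eps < 1/2, that is ln (1 / eps) > ln 2;
     each summand of [k] takes care of one alternative. *)
  move/negbT: triv; rewrite negb_and -!ltNge => /orP[st|ep].
    have /le_trans : 1 <= 4 * expR 1 * s by rewrite ltW// mulrC.
    by apply; rewrite -!addrA lerDl; do !apply: addr_ge0.
  have : ln 2 <= ln (1 / eps).
    by rewrite ler_ln ?posrE ?divr_gt0// ler_pdivlMr// -ler_pdivlMl// mulr1 ltW.
  move=> /(ler_wpM2l b0); rewrite mulVf ?gt_eqF// => /le_trans; apply.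
  by rewrite lerDr; do !apply: addr_ge0.
have e1 : 1 <= expR 1 :> R by rewrite -expR0 ler_expR.
have M_y : M%:R <= 2 * (expR 1 * y) + (ln 30 + 1) * (k * y).
  apply: (le_trans M_le); rewrite lnE [(ln 30 + 1) * _]mulrDl [1 * (k * y)]mul1r.
  have h1 : expR 1 * s <= expR 1 * y by apply: ler_wpM2l; [exact: expR_ge0 | rewrite /y lerDl].
  have h2 : ln 30 <= ln 30 * (k * y) by apply: ler_peMr => //; exact: ltW.
  have h3 : ln (1 / eps) <= expR 1 * y.
    by apply: (@le_trans _ _ y); [rewrite /y lerDr | rewrite ler_peMl].
  exact: (lin1 _ _ _ _ _ _ h1 h2 h3 ky).
rewrite /query_const -/k [leRHS](_ : _ = 192 * (2 * (expR 1 * y) + (ln 30 + 1) * (k * y))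
   + 192 * ((ln 30 + 1) * (k * y)) + 6 * (k * y)); last first.
  by move: (y) (k) (expR 1) (ln 30) => y' k' e' l'; ring.
apply: lin2 => //; apply: mulr_ge0; first by apply: addr_ge0 => //; exact: ltW.
by apply: mulr_ge0 => //; exact: ltW.
Qed.
End Protocol.

(** * The compressed clock circuit approximates half the evolution *)

Section Correctness.
Variables (R : realType) (K n : nat) (U : 'I_(K ^ 2) -> 'M[R[i]]_K).
Local Notation C := R[i].
Hypothesis HU : normalized_unitary_local_basis U.
Variable H : 'M[C]_(sysdim K n).
Hypotheses (H_neq0 : H != 0) (H_herm : H \is hermsymmx).
Local Notation g := #|supp U H|.
Local Notation lam := (lambda U H).
Variables (e0 : 'cV[C]_g) (P : 'M[C]_g).
Hypotheses (e0_unit : e0^t* *m e0 = 1%:M) (HP : is_prepare e0 P).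
Local Notation N := (sysdim K n).
Local Notation S := (select U H).
Local Notation G := (prepared e0 N P).
Local Notation Sw := (symm_select S).
Local Notation x := (encoded G Sw).

Let Pu : P \is unitarymx. Proof. by case: HP. Qed.
Let Su : S \is unitarymx. Proof. exact: select_unitary. Qed.
Let G_iso : G^t* *m G = 1%:M. Proof. exact: prepared_unit. Qed.
Let Sw_adj : Sw^t* = Sw. Proof. exact: symm_select_adj. Qed.
Let Sw_inv : Sw *m Sw = 1%:M. Proof. exact: symm_select_inv. Qed.
Let xE : x = lam^-1%:C *: H. Proof. exact: prepared_encodes. Qed.

Lemma encoded_herm : x \is hermsymmx.
Proof.
apply/is_hermitianmxP; rewrite expr0 scale1r xE [RHS]adjmxZ conj_realC.
by rewrite (hermsymmx_adj H_herm).
Qed.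

Lemma bnd_encoded : bnd x 1.
Proof.
rewrite /encoded -[1]mulr1 -{1}[1]mulr1; apply: bndM => //; rewrite ?mulr1//.
  rewrite -[1]mulr1; apply: bndM => //; first exact: bnd_adj (bnd_isometry G_iso).
  by apply: bnd_isometry; rewrite Sw_adj.
exact: bnd_isometry.
Qed.

Lemma generator_scaling t : (0 -i* t) *: H = (0 -i* (lam * t)) *: x.
Proof.
rewrite xE scalerA; congr (_ *: _).
have l0 : lam != 0 by rewrite gt_eqF// lambda_gt0.
apply/eqP; rewrite eq_complex /= !mul0r !mulr0 subr0 add0r eqxx /= mulNr.
by rewrite mulrAC mulfV// mul1r.
Qed.

Lemma evolution_scaling t : evolution H t = evolution x (lam * t).
Proof. by rewrite /evolution generator_scaling. Qed.

Lemma bnd_evolution_trunc M s r : 1 <= r -> 0 <= s ->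
  bnd (evolution x s - expmx_trunc M ((0 -i* s) *: x)) (2 * (r ^- M * expR (r * s))).
Proof.
move=> r1 s0; apply: (evolution_trunc_bnd M encoded_herm bnd_encoded) => //.
by rewrite mulr1 ger0_norm.
Qed.

Variable p : nat.
Local Notation L := (2 ^ p.+2)%N.
Local Notation D := (2 ^ p)%N.
Local Notation J := (kets (window R p) (lift_ket N (plus_state e0))).
Local Notation block M := (J^t* *m body_mx e0 P S (exchange R p) M *m J).

Lemma J_iso : J^t* *m J = 1%:M.
Proof. by rewrite kets_adj_mul ?lift_plus_unit// window_window mxE. Qed.

(** The flat state weighs all final clock values equally, so the sum over them is that of
    [path_mx_trunc_walk] and returns the truncated exponential of x times tau k'. As tau k' tau k'^*
    = 1, the dependence on k' disappears and only the overlap 1/2 of the clock states remains. The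
    window [D, 2D) is far enough from both ends of [0, 4D) for M <= D. *)
Lemma block_trunc (M : nat) (c : C) : (M <= D)%N ->
  block (expmx_trunc M (c *: path_mx R L)) = 2^-1 *: expmx_trunc M (c *: x).
Proof.
move=> MD; rewrite body_block//; last exact: exchange_adj.
rewrite exchange_window; set X := expmx_trunc M (c *: path_mx R L).
pose tau k := G^t* *m walk G Sw ^+ k.
have tau_tau k : tau k *m (tau k)^t* = 1%:M.
  rewrite /tau -(walk_exp_adj _ Sw_adj) trmxCK.
  by rewrite (walk_exp_adj _ Sw_adj) -mulmxA [_ *m (_ *m G)]mulmxA walk_expK// mul1mx.
transitivity (\sum_(k' < L) (window R p k' 0 * (amplitude R p / 2)%:C) *:
    ((\sum_k X k k' *: tau k) *m (tau k')^t*)).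
  under eq_bigr do rewrite mulmx_sumr scaler_sumr.
  rewrite exchange_big; apply: eq_bigr => k' _; rewrite mulmx_suml scaler_sumr.
  apply: eq_bigr => k _; rewrite -scalemxAr -scalemxAl !scalerA mxE conj_realC.
  by congr (_ *: _); ring.
transitivity (\sum_(k' < L) (window R p k' 0 * (amplitude R p / 2)%:C) *: expmx_trunc M (c *: x)).
  apply: eq_bigr => k' _; rewrite mxE; case: ifP => [kD|_]; last by rewrite mul0r !scale0r.
  congr (_ *: _); have D0 : (0 < D)%N by rewrite expn_gt0.
  have [Dk kDD] : (D <= k')%N /\ (k' < 2 * D)%N.
    have := divn_eq k' D; rewrite (eqP kD) mul1n => kE; rewrite kE leq_addr.
    by rewrite mul2n -addnn ltn_add2l ltn_mod.
  have LE : (2 ^ p.+2 = 4 * 2 ^ p)%N by rewrite !expnS mulnA.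
  rewrite path_mx_trunc_walk//; first by rewrite -mulmxA tau_tau mulmx1.
  - exact: leq_trans MD (leqW Dk).
  - by lia.
rewrite -scaler_suml; congr (_ *: _).
have := flat_window R p => /(congr1 (fun A : 'M[C]_1 => A 0 0)); rewrite !mxE mulr1n => <-.
by apply: eq_bigr => k _; rewrite !mxE conj_realC mulrC.
Qed.

Lemma walk_powers_unitary : dmx (fun k : 'I_L => walk G Sw ^+ k) \is unitarymx.
Proof.
apply: dmx_unitary => k; elim: (nat_of_ord k) => [|j IH]; first exact: unitary1.
rewrite exprS; apply: mul_unitarymx IH; apply/unitarymxP.
by rewrite (walk_adj G Sw_adj) (walkK G_iso Sw_inv).
Qed.

Lemma prep_unitary : dmx (fun _ : 'I_L => prep2 N P) \is unitarymx.
Proof. by apply: dmx_unitary => k; exact: prep2_unitary. Qed.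

Lemma prep_adj_unitary : dmx (fun _ : 'I_L => (prep2 N P)^t*) \is unitarymx.
Proof. by apply: dmx_unitary => k; rewrite trmxC_unitary; exact: prep2_unitary. Qed.

Lemma body_unitary M : M \is unitarymx -> body_mx e0 P S (exchange R p) M \is unitarymx.
Proof.
move=> Mu; rewrite /body_mx; apply: mul_unitarymx; last exact: prep_unitary.
apply: mul_unitarymx; last by rewrite trmxC_unitary walk_powers_unitary.
apply: mul_unitarymx; last exact: kmx_unitary.
apply: mul_unitarymx; last exact: walk_powers_unitary.
apply: mul_unitarymx; last exact: prep_adj_unitary.
by apply: kmx_unitary; exact: exchange_unitary.
Qed.

(** The block is linear in the clock operator, and all its other factors are contractions. This
    admits the truncated exponential, which need not be unitary, in place of the clock evolution. *)
Lemma block_lipschitz M M' c : 0 <= c -> bnd (M - M') c -> bnd (block M - block M') c.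
Proof.
move=> c0 Mc.
have -> : block M - block M' = J^t* *m (kmx (g * N) (exchange R p) *m
   dmx (fun=> (prep2 N P)^t*) *m dmx (fun k : 'I_L => walk G Sw ^+ k)) *m kmx (g * N) (M - M') *m
   ((dmx (fun k : 'I_L => walk G Sw ^+ k))^t* *m dmx (fun=> prep2 N P) *m J).
  rewrite -(kmxB _ M M') /body_mx; set Q0 := kmx _ (exchange R p).
  by rewrite mulmxBr mulmxBl !mulmxA.
have bmul1 a b d (A : 'M[C]_(a, b)) (B : 'M[C]_(b, d)) : bnd A 1 -> bnd B 1 -> bnd (A *m B) 1.
  by move=> A1 B1; rewrite -[1]mulr1; apply: bndM.
have bJ : bnd J 1 by apply: bnd_isometry; exact: J_iso.
have l1 : bnd (J^t* *m (kmx (g * N) (exchange R p) *m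
   dmx (fun=> (prep2 N P)^t*) *m dmx (fun k : 'I_L => walk G Sw ^+ k))) 1.
  apply: (@bmul1 _ _ _); first exact: bnd_adj.
  apply: (@bmul1 _ _ _); last exact/bnd_unitary/walk_powers_unitary.
  apply: (@bmul1 _ _ _); last exact/bnd_unitary/prep_adj_unitary.
  exact/bnd_unitary/kmx_unitary/exchange_unitary.
have r1 : bnd ((dmx (fun k : 'I_L => walk G Sw ^+ k))^t* *m dmx (fun=> prep2 N P) *m J) 1.
  apply: (@bmul1 _ _ _) => //; apply: (@bmul1 _ _ _); last exact/bnd_unitary/prep_unitary.
  by apply: bnd_unitary; rewrite trmxC_unitary walk_powers_unitary.
rewrite -[c]mulr1 -[c]mul1r; apply: bndM => //; first by rewrite mul1r.
by apply: bndM => //; exact: bnd_kmx.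
Qed.

(** The block of the truncated series is exact, so only two truncation errors occur: 2 T for the
    path matrix, and half of 2 T for x. *)
Lemma bnd_block_evolution M s r : (M <= D)%N -> 1 <= r -> 0 <= s ->
  bnd (block (evolution (path_mx R L) s) - 2^-1 *: evolution x s) (3 * (r ^- M * expR (r * s))).
Proof.
move=> MD r1 s0; set T := r ^- M * _.
have T0 : 0 <= T by rewrite mulr_ge0 ?expR_ge0 ?invr_ge0 ?exprn_ge0// (le_trans ler01).
have b1 : bnd (block (evolution (path_mx R L) s) - 2^-1 *: expmx_trunc M ((0 -i* s) *: x)) (2 * T).
  rewrite -(block_trunc (0 -i* s) MD); apply: block_lipschitz; first by rewrite mulr_ge0.
  apply: (evolution_trunc_bnd M (path_mx_herm R L) (@bnd_path_mx R L)) => //.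
  by rewrite mulr1 ger0_norm.
have b2 := bndZ 2^-1 (bndN (bnd_evolution_trunc M r1 s0)).
move: b2; rewrite [X in Normc.normc X](_ : _ = (2^-1)%:C); last by rewrite fmorphV rmorph_nat.
rewrite normc_real ?invr_ge0// -/T => b2.
have := bndD b1 b2.
rewrite opprB scalerBr addrA subrK.
have -> : 2 * T + 2^-1 * (2 * T) = 3 * T by field.
by [].
Qed.

Lemma bnd_block_1 M : M \is unitarymx -> bnd (block M) 1.
Proof.
move=> Mu; have bJ : bnd J 1 by apply: bnd_isometry; exact: J_iso.
rewrite -[1]mulr1; apply: bndM => //; rewrite -[1]mulr1; apply: bndM => //.
  exact: bnd_adj.
exact/bnd_unitary/body_unitary.
Qed.

End Correctness.

(** * The total error *)

Section SimulationError.
Variables (R : realType) (K n : nat) (U : 'I_(K ^ 2) -> 'M[R[i]]_K).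
Local Notation C := R[i].
Hypothesis HU : normalized_unitary_local_basis U.
Variable H : 'M[C]_(sysdim K n).
Hypotheses (H_neq0 : H != 0) (H_herm : H \is hermsymmx).
Local Notation g := #|supp U H|.
Local Notation lam := (lambda U H).
Variables (e0 : 'cV[C]_g) (P : 'M[C]_g).
Hypotheses (e0_unit : e0^t* *m e0 = 1%:M) (HP : is_prepare e0 P).
Local Notation N := (sysdim K n).
Local Notation S := (select U H).

Lemma gates_amplified p (s : seq (gate R g p.+3)) (B : 'M[C]_(2 ^ p.+3 * (g * N))) :
  gates_mx P S s = reassoc B ->
  let J := kets (window R p) (lift_ket N (plus_state e0)) in
  let Rj := 1%:M - 2 *: (J *m J^t*) in
  gates_mx P S (amplified_gates (initial_state p e0) s) =
  reassoc ((-1)%:M *m (B *m (Rj *m (B^t* *m (Rj *m B))))).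
Proof.
have [Pu _] := HP; have Su := select_unitary HU H.
move=> sB J Rj.
have consE y s' : gates_mx P S (y :: s') = gate_mx P S y *m gates_mx P S s' by [].
rewrite /amplified_gates consE gates_mx_cat consE gates_mx_cat consE gates_mx_inv// sB.
by rewrite gate_scalar gate_pack_proj reassoc_adj !reassoc_mul.
Qed.

Lemma simulation_error t eps : 0 <= t -> 0 < eps -> eps < 1 ->
  bnd (implemented P S (simulation e0 lam t eps) - evolution H t) eps.
Proof.
move=> t0 eps0 eps1; have [Pu _] := HP; have Su := select_unitary HU H.
have s0 : 0 <= lam * t by rewrite mulr_ge0// lambda_ge0.
have e1 : 1 <= expR 1 :> R by rewrite -expR0 ler_expR.
rewrite (evolution_scaling HU H_neq0 H_herm HP) /simulation.
set p := clock_exp lam t eps.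
case: ifP => [/andP[small epsh]|_].
  have W1 : gates_mx P S ([::] : seq (gate R g p.+3)) = reassoc 1%:M by rewrite reassoc1.
  rewrite (implemented_pack _ _ W1) mulmx1.
  rewrite (_ : _ *m pack _ = 1%:M); last exact: J_iso.
  (* Truncating at order 1 leaves the identity. For r = 4 e its error 2 e^(4 e lam t) / (4 e) is at
     most 1/2 once 4 e lam t <= 1, hence the thresholds in [simulation]. *)
  have r1 : 1 <= 4 * expR 1 :> R by lra.
  have := bnd_evolution_trunc HU H_herm e0_unit HP 1 r1 s0.
  rewrite /expmx_trunc big_ord_recl big_ord0 addr0 fact0 invr1 scale1r expr0 expr1.
  move=> /bndN; rewrite opprB; apply: bnd_le; apply: le_trans epsh.
  have er : expR (4 * expR 1 * (lam * t)) <= expR 1 by rewrite ler_expR mulrC.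
  have r0 : 0 < 4 * expR 1 :> R by apply: lt_le_trans r1.
  apply: (@le_trans _ _ (2 * ((4 * expR 1)^-1 * expR 1))).
    by rewrite !ler_pM2l ?invr_gt0.
  by rewrite invfM -mulrA mulVf ?gt_eqF ?expR_gt0//; lra.
set M := clock_evolution p (lam * t).
have Mu : M \is unitarymx by apply: evolution_unitary; exact: path_mx_herm.
have W1 := gates_amplified (gates_lcu e0 Pu Su (exchange R p) M).
rewrite (implemented_pack _ _ W1) amplified_block; [|exact: body_unitary|exact: J_iso].
have [MD _] := clock_exp_bounds lam t eps.
have Ab := bnd_block_evolution HU H_neq0 H_herm e0_unit HP MD e1 s0.
have A1 := bnd_block_1 HU e0_unit HP Mu.
have Vu := evolution_unitary (lam * t) (encoded_herm HU H_herm HP).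
set T := _ ^- _ * _ in Ab.
have T0 : 0 <= T by rewrite mulr_ge0 ?expR_ge0 ?invr_ge0 ?exprn_ge0 ?expR_ge0.
have T30 : 0 <= 3 * T by rewrite mulr_ge0.
(* The 30 of [cutoff] is 10 . 3: amplification multiplies the error 3 T of the block by 10, where T
   = exp(e lam t - M). *)
apply: bnd_le (bnd_amplified T30 A1 Vu Ab).
rewrite mulrA -natrM -ler_pdivlMl ?ltr0n// /T -expRM_natr mul1r -expRN -expRD.
rewrite -[leRHS]lnK ?posrE ?mulr_gt0 ?invr_gt0// ler_expR.
rewrite addrC lerBlDl -lerBlDr.
apply: le_trans (ltW (cutoff_gt lam t eps)).
rewrite lerD2l -lnV ?posrE ?mulr_gt0 ?invr_gt0//.
by rewrite invfM invrK mulrC.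
Qed.

Lemma l2norm_unit m (v : 'cV[C]_m) : l2norm v = 1 -> v^t* *m v = 1%:M.
Proof.
move=> v1; apply/matrixP => i j; rewrite !ord1 -l2norm_sqrC v1 expr1n.
by rewrite mxE.
Qed.
End SimulationError.

Lemma simulation_correct (R : realType) (K : nat) (U : 'I_(K ^ 2) -> 'M[R[i]]_K) :
  (0 < K)%N -> normalized_unitary_local_basis U ->
  simulates_within (query_const R) (local_const R K) (@simulation R) U.
Proof.
move=> K0 HU d n d1 dn H Hh H0 Hd t eps t0 eps0 eps1 e0 P e01 HP.
have e0u := l2norm_unit e01; split.
- exact: simulation_well_formed.
- have s0 : 0 <= lambda U H * t by rewrite mulr_ge0// lambda_ge0.
  apply: le_trans (simulation_queries _ s0 eps0 eps1) _.
  apply: ler_wpM2l; first by rewrite ltW ?query_const_gt0.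
  by rewrite lerD2r ler_wpM2r//; exact: lambda_bound.
- apply: opnorm_le; first exact: ltW.
  exact: simulation_error.
Qed.

(** * The Heisenberg-Weyl basis *)

Section HeisenbergWeyl.
Variables (R : realType) (K : nat).
Hypothesis K2 : (2 <= K)%N.
Local Notation C := R[i].
Local Notation om := (expi (- (2 * pi / K%:R)) : C).

Let K0 : (0 < K)%N. Proof. exact: ltnW. Qed.

Lemma expiD (x y : R) : expi (x + y) = expi x * expi y.
Proof. by apply/eqP; rewrite eq_complex /= cosD sinD; apply/andP; split; apply/eqP; ring. Qed.

Lemma expiX (x : R) k : expi x ^+ k = expi (x *+ k).
Proof.
elim: k => [|k IH]; last by rewrite exprS IH mulrS expiD.
by rewrite expr0 mulr0n /expi cos0 sin0 oppr0.
Qed.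

Lemma root_primitive : K.-primitive_root om.
Proof.
rewrite /primitive_root_of_unity K0 /=; apply/forallP => -[k kK]; apply/eqP/esym.
rewrite unity_rootE expiX /= mulNrn /expi cosN sinN opprK.
have [k1K|kneK] := eqVneq k.+1 K.
  rewrite k1K -[_ / _ *+ _]mulr_natr divfK ?pnatr_eq0 -?lt0n// [2 * pi]mulrC mulr_natr.
  by rewrite cos2pi sin2pi eqxx.
apply/esym/negbTE/eqP => -[c1 _].
have kK' : (k.+1 < K)%N by rewrite ltn_neqAle kneK.
have Kr : 0 < K%:R :> R by rewrite ltr0n.
(* Half the angle: cos (2 y) = 1 would force sin y = 0, while y lies strictly between 0 and pi. *)
pose y : R := pi * k.+1%:R / K%:R.
have s0 : 0 < sin y.
  rewrite sin_gt0_pi// divr_gt0 ?mulr_gt0 ?pi_gt0 ?ltr0n//=.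
  by rewrite ltr_pdivrMr// ltr_pM2l ?pi_gt0// ltr_nat.
have yE : 2 * pi / K%:R *+ k.+1 = y *+ 2 by rewrite -[LHS]mulr_natr -[RHS]mulr_natr /y; ring.
have := cos2Dsin2 y; have := cos_mulr2n y; rewrite -yE c1 => h1 h2.
have : 0 < sin y ^+ 2 by rewrite exprn_gt0.
by lra.
Qed.

Lemma shift_exp a : shift_mx K ^+ a = \matrix_(r, s) (r == (s + a) %% K :> nat)%N%:R :> 'M[C]_K.
Proof.
elim: a => [|a IH].
  by apply/matrixP => r s; rewrite expr0 !mxE addn0 modn_small.
apply/matrixP => r s; rewrite exprSr IH !mxE.
have sK : (s.+1 %% K < K)%N by rewrite ltn_mod.
rewrite (bigD1 (Ordinal sK))//= !mxE eqxx mulr1 big1 => [|k ks]; last first.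
  by rewrite !mxE [k == _ :> nat](negbTE ks) mulr0.
by rewrite addr0 modnDml addSnnS.
Qed.

Lemma clock_exp_mx b : clock_mx K ^+ b = diag_mx (\row_s om ^+ (s * b)%N) :> 'M[C]_K.
Proof.
have cE : clock_mx K = diag_mx (\row_s om ^+ s) :> 'M[C]_K.
  congr diag_mx; apply/rowP => s; rewrite !mxE expiX mulNrn /expi cosN sinN opprK.
  by rewrite -[_ / _ *+ s]mulr_natr mulrAC.
elim: b => [|b IH].
  by apply/matrixP => r s; rewrite expr0 !mxE muln0 expr0.
rewrite exprSr IH cE -[LHS]/(diag_mx _ *m diag_mx _) mul_diag_mx; apply/matrixP => r s.
by rewrite !mxE mulrnAr -exprD mulnS addnC.
Qed.

Lemma heisenberg_weylE (i : 'I_(K ^ 2)) : heisenberg_weyl i = \matrix_(r, s)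
  ((r == (s + i %/ K) %% K :> nat)%N%:R * om ^+ (s * (i %% K))%N) :> 'M[C]_K.
Proof.
rewrite /heisenberg_weyl shift_exp clock_exp_mx mul_mx_diag.
by apply/matrixP => r s; rewrite !mxE.
Qed.

Lemma om_conj : om * om^* = 1. Proof. exact: expi_mul_conj. Qed.

Lemma heisenberg_weyl_gram (i j : 'I_(K ^ 2)) s s' :
  ((heisenberg_weyl j)^t* *m heisenberg_weyl i : 'M[C]_K) s s' =
  (((s + j %/ K) %% K == (s' + i %/ K) %% K)%N)%:R *
   ((om^*) ^+ (s * (j %% K))%N * om ^+ (s' * (i %% K))%N).
Proof.
rewrite !heisenberg_weylE mxE; have sK : ((s + j %/ K) %% K < K)%N by rewrite ltn_mod.
rewrite (bigD1 (Ordinal sK))//= big1 => [|r rs]; last first.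
  by rewrite !mxE [r == _ :> nat](negbTE rs) mul0r conjC0 mul0r.
by rewrite addr0 !mxE/= eqxx mul1r rmorphXn mulrCA.
Qed.

Lemma heisenberg_weyl_unitary (i : 'I_(K ^ 2)) : heisenberg_weyl i \is @unitarymx C K K.
Proof.
apply/unitarymxP/mulmx1C/matrixP => s s'; rewrite heisenberg_weyl_gram mxE.
rewrite eqn_modDr (modn_small (ltn_ord s)) (modn_small (ltn_ord s')); have [<-|ns] := eqVneq s s'.
  by rewrite eqxx mul1r -exprMn mulrC om_conj expr1n.
by rewrite (negbTE (_ : s != s' :> nat)) ?mul0r.
Qed.

Lemma geometric_root_sum b b' : (b < K)%N -> (b' < K)%N ->
  \sum_(s < K) (om^*) ^+ (s * b')%N * om ^+ (s * b)%N = (b == b')%:R * K%:R.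
Proof.
move=> bK b'K; pose z := (om^*) ^+ b' * om ^+ b.
rewrite (eq_bigr (fun s : 'I_K => z ^+ s)) => [|s _]; last first.
  by rewrite /z exprMn -!exprM [(b' * _)%N]mulnC [(b * _)%N]mulnC.
have [bb|bb] := eqVneq b b'.
  rewrite mul1r (eq_bigr (fun=> 1)) ?sumr_const ?card_ord// => s _.
  by rewrite /z bb -exprMn mulrC om_conj !expr1n.
have zK : z ^+ K = 1.
  rewrite /z exprMn -!exprM ![(_ * K)%N]mulnC !exprM -rmorphXn.
  by rewrite (prim_expr_order root_primitive) rmorph1 !expr1n mulr1.
have z1 : z - 1 != 0.
  rewrite subr_eq0; apply: contra bb => /eqP z1.
  have : om ^+ b == om ^+ b'.
    by rewrite -[om ^+ b']mulr1 -z1 /z mulrA -exprMn om_conj expr1n mul1r.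
  by rewrite (eq_prim_root_expr root_primitive) !modn_small.
by apply: (mulfI z1); rewrite mul0r mulr0 -subrX1 zK subrr.
Qed.

Lemma heisenberg_weyl_orthonormal (i j : 'I_(K ^ 2)) :
  K%:R^-1 * \tr (heisenberg_weyl i *m (heisenberg_weyl j)^t*) = (i == j)%:R :> C.
Proof.
rewrite mxtrace_mulC /mxtrace (eq_bigr _ (fun s _ => heisenberg_weyl_gram i j s s)).
have lt_div (k : 'I_(K ^ 2)) : (k %/ K < K)%N by rewrite ltn_divLR// mulnn.
rewrite (eq_bigr (fun s : 'I_K => (i %/ K == j %/ K)%N%:R *
   ((om^*) ^+ (s * (j %% K))%N * om ^+ (s * (i %% K))%N))) => [|s _]; last first.
  by rewrite eqn_modDl (modn_small (lt_div i)) (modn_small (lt_div j)) eq_sym.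
rewrite -mulr_sumr geometric_root_sum ?ltn_mod// mulrCA [K%:R^-1 * _]mulrCA.
rewrite mulVf ?pnatr_eq0 -?lt0n// mulr1 -natrM mulnb; congr (nat_of_bool _)%:R.
apply/andP/eqP => [[/eqP da /eqP db]|->//]; apply: val_inj.
by rewrite /= (divn_eq i K) (divn_eq j K) da db.
Qed.

Lemma heisenberg_weyl_basis : normalized_unitary_local_basis (@heisenberg_weyl R K).
Proof.
split => [i i0|||].
- by rewrite /heisenberg_weyl i0 div0n mod0n !expr0 mulmx1.
- exact: heisenberg_weyl_unitary.
- exact: heisenberg_weyl_orthonormal.
have KC : K%:R != 0 :> C by rewrite pnatr_eq0 -lt0n.
rewrite basisEfree subvf size_map -cardE card_ord dimvf dim_matrix -[(K * K)%R]/(K * K)%N mulnn leqnn !andbT.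
apply/(@freeP _ _ _ (codom_tuple (@heisenberg_weyl R K))) => k; under eq_bigr do rewrite nth_codom.
move=> k0 i; set j := enum_val i.
have := congr1 (fun A : 'M[C]_K => K%:R^-1 * \tr (A *m (heisenberg_weyl j)^t*)) k0.
rewrite mul0mx mxtrace0 mulr0 mulmx_suml raddf_sum mulr_sumr.
under eq_bigr do rewrite -scalemxAl /= mxtraceZ mulrCA heisenberg_weyl_orthonormal.
rewrite (bigD1 i)//= eqxx mulr1 big1 ?addr0// => l li.
by rewrite (inj_eq enum_val_inj) (negbTE li) mulr0.
Qed.
End HeisenbergWeyl.

Theorem corollary5p3 (R : realType) :
  exists2 Cu : R, 0 < Cu &
  exists pr : protocol R,
  forall K : nat, (2 <= K)%N ->
  exists2 c : R, 1 <= c &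
    (forall U : 'I_(K ^ 2) -> 'M[R[i]]_K,
       normalized_unitary_local_basis U -> simulates_within Cu c pr U) /\
    (normalized_unitary_local_basis (@heisenberg_weyl R K) /\
     simulates_within Cu c pr (@heisenberg_weyl R K)).
Proof.
exists (query_const R); first exact: query_const_gt0.
exists (@simulation R) => K K2; have K0 : (0 < K)%N := ltnW K2.
exists (local_const R K); first exact: local_const_ge1.
have HW := heisenberg_weyl_basis R K2.
split=> [U HU|]; first exact: simulation_correct.
by split=> //; exact: simulation_correct.
Qed.
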